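(* Let $K$ be a field with $\operatorname{char} K \neq 2$, let $a,c \in K^\times$, and let $x_1,x_2,x_3$ be independent indeterminates over $K$. Let $\sigma$ be the $K$-automorphism of $K(x_1,x_2,x_3)$ given by $$\sigma(x_1) = \frac{a}{x_2},\quad \sigma(x_2) = x_1,\quad \sigma(x_3) = \frac{c}{x_3}.$$ Then $K(x_1,x_2,x_3)^{\langle\sigma\rangle}$ is rational over $K$ if and only if $[K(\sqrt{a},\sqrt{-1},\sqrt{c}):K] \le 4$.
   Context: Rational over $K$ means purely transcendental over $K$. $F^{\langle\sigma\rangle}$ denotes the subfield of $F$ fixed by the group generated by $\sigma$ (here a cyclic group of order 4). *)

(* Defs.v *)
From HB Require Import structures.
From mathcomp Require Import all_boot all_order all_algebra all_field.
From mathcomp Require Import fraction mpoly.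

Set Implicit Arguments.
Unset Strict Implicit.
Unset Printing Implicit Defensive.

Import GRing.Theory.
Local Open Scope ring_scope.

Notation ratfun K n := {fraction {mpoly K[n]}}.

Section RationalFunctions.
Variables (K : fieldType) (n : nat).

Definition ratC : {rmorphism K -> ratfun K n} :=
  (@FracField.tofrac {mpoly K[n]} \o @mpolyC n K : {rmorphism _ -> _}).

Definition ratX (i : 'I_n) : ratfun K n := FracField.tofrac 'X_i.

End RationalFunctions.

Section FieldExtension.
Variables (K L : fieldType) (iota : {rmorphism K -> L}).
Implicit Types (S E : L -> Prop).

Definition is_automorphism_over (sigma : {rmorphism L -> L}) : Prop :=
  bijective sigma /\ forall k : K, sigma (iota k) = iota k.

(* As x / 0 = 0, closure under division by 0 only requires 0 to be in E. *)
Definition is_subfield E : Prop :=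
  [/\ E 1, forall x y, E x -> E y -> E (x - y)
         & forall x y, E x -> E y -> E (x / y)].

Definition generated_subfield S : L -> Prop := fun x =>
  forall E, is_subfield E -> (forall k : K, E (iota k)) ->
    (forall s, S s -> E s) -> E x.

(* S may be infinite: the condition bears on all its finite subfamilies. *)
Definition algebraically_independent S : Prop :=
  forall (n : nat) (s : 'I_n -> L), injective s -> (forall i, S (s i)) ->
    forall p : {mpoly K[n]}, mmap iota s p = 0 -> p = 0.

Definition purely_transcendental E : Prop :=
  exists S : L -> Prop, algebraically_independent S /\
    forall x, E x <-> generated_subfield S x.

End FieldExtension.

Section FixedField.
Variables (T : Type) (sigma : T -> T).

(* The maps sigma ^ m for an integer m, the second disjunct being m = - n. *)
Definition in_cyclic_group (tau : T -> T) : Prop :=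
  exists n : nat, tau =1 iter n sigma \/
    (cancel tau (iter n sigma) /\ cancel (iter n sigma) tau).

Definition fixed_by_cyclic_group : T -> Prop := fun x =>
  forall tau, in_cyclic_group tau -> tau x = x.

End FixedField.

(* Main.v *)
Require Import Defs.
From HB Require Import structures.
From mathcomp Require Import all_boot all_order all_algebra all_field.
From mathcomp Require Import fraction mpoly polyXY boolp ring zify.

Set Implicit Arguments.
Unset Strict Implicit.
Unset Printing Implicit Defensive.

Import Order.TTheory GRing.Theory Num.Theory.
Local Open Scope ring_scope.

(**
With [s = (x1 x2 + a) / (x1 + x2)] and [t = (x1 x2 - a) / (x1 - x2)], the fixed
field of [sigma ^ 2] is [K(s, t, x3)], on which [sigma] acts by [s |-> a / s],
[t |-> - a / t] and [x3 |-> c / x3].  The degree condition says that some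
nonempty product of the three constants [a], [- a], [c] is a square in [K].

In that case, a monomial change of variables gives a generator [p] with
[sigma p = 1 / p], hence [z = (p - 1) / (p + 1)] with [sigma z = - z]; the
invariants of [sigma] form the function field of a conic bundle with a section.

Otherwise let [M = K(sqrt a, sqrt (- a), sqrt c)], with Galois group
[G = (Z/2)^3] over [K].  Moebius coordinates [x], [y], [z] over [M] are negated
by [sigma], and the i-th generator of [G] inverts the i-th of them.  If the
fixed field were rational with basis [T], the polynomial ring [M[T]] would be
factorial and [G]-stable with units [M^*], so the divisors of [x^2], [y^2],
[z^2], which differ pairwise by squares of invariants of [sigma], would yield
[e] and [p] in [M(T)] with [p^2 = mu x^2 N_G(e)] and [tau p = nu p / x^2], where
[tau] is the product of the generators of [G].  Comparing with divisors in the
Laurent ring [M[x^+-1, y^+-1, z^+-1]] makes a monomial of odd total degree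
invariant under [sigma], which negates it.
*)

(** * Morphisms out of rational function fields *)

(** The nonrationality argument plays two factorial rings against each other. In [M[T]] the only
    units are constants, so a divisor determines an element up to a constant; but [x] is negated by
    [sigma], hence absent from [M(T)], and only its square is there. Multiplying by the norm of [e]
    repairs the odd multiplicities of [x ^ 2], so [p] is a substitute for [x] times a square root of
    [N_G(e)]. This takes three coordinates: where the three divisors are odd, their signs form a
    vector of [{1, -1}^3], and [G] permutes these vectors simply transitively. In the Laurent ring
    [x] is a unit, so the divisor of [p] is half that of a norm. It is also the divisor of an
    element whose invariance under [sigma] is automatic, and the unit by which [p] differs from that
    element is a monomial whose exponents are forced by [tau p = nu p / x ^ 2]: 1 at [x], 0 at [y],
    even at [z]. *)

Section FractionLift.
Variables (R : idomainType) (F : fieldType) (f : {rmorphism R -> F}).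
Hypothesis f_inj : forall x, f x = 0 -> x = 0.
Local Notation "x %:F" := (@FracField.tofrac R x).

Lemma fraction_numden (x : {fraction R}) :
  exists n d, d != 0 /\ x = n%:F / d%:F.
Proof.
exists (frac (repr x)).1, (frac (repr x)).2; have dn0 := denom_ratioP (repr x).
split=> //; apply: (canRL (mulfK _)); first by rewrite tofrac_eq0.
rewrite -{1}[x]reprK [FracField.tofrac _]piE -[_ * _]/(FracField.mul _ _).
rewrite [FracField.tofrac _]piE; apply/eqP; rewrite !piE /FracField.mulf.
by rewrite FracField.equivfE !numden_Ratio ?mulf_neq0 ?oner_neq0 ?mulr1 //= mulrC.
Qed.

Definition frac_lift_fun (x : {fraction R}) : F :=
  f (frac (repr x)).1 / f (frac (repr x)).2.

Let fn0 x : x != 0 -> f x != 0.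
Proof. by apply: contra_neq => /f_inj. Qed.

Lemma frac_lift_funE n d : d != 0 -> frac_lift_fun (n%:F / d%:F) = f n / f d.
Proof.
move=> dn0; rewrite /frac_lift_fun; set x := n%:F / d%:F.
have en0 := denom_ratioP (repr x).
have xE : x = (frac (repr x)).1%:F / (frac (repr x)).2%:F.
  apply: (canRL (mulfK _)); first by rewrite tofrac_eq0.
  rewrite -{1}[x]reprK [FracField.tofrac _]piE -[_ * _]/(FracField.mul _ _).
  rewrite [FracField.tofrac _]piE; apply/eqP; rewrite !piE /FracField.mulf.
  by rewrite FracField.equivfE !numden_Ratio ?mulf_neq0 ?oner_neq0 ?mulr1 //= mulrC.
move: en0 xE; move: (frac (repr x)).1 (frac (repr x)).2 => p q qn0 /eqP.
rewrite /x eqr_div ?tofrac_eq0 // -!tofracM tofrac_eq => /eqP npd.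
by apply/eqP; rewrite eqr_div ?fn0 // -!rmorphM npd.
Qed.

Lemma frac_lift_is_zmod : zmod_morphism frac_lift_fun.
Proof.
move=> x y; have [n [d [dn0 ->]]] := fraction_numden x.
have [p [q [qn0 ->]]] := fraction_numden y.
rewrite -mulNr -tofracN addf_div ?tofrac_eq0 // -!tofracM -tofracD.
by rewrite !frac_lift_funE ?mulf_neq0 // -mulNr addf_div ?fn0 // rmorphD !rmorphM rmorphN.
Qed.

Lemma frac_lift_is_monoid : monoid_morphism frac_lift_fun.
Proof.
split; first by rewrite -[1](@divr1 {fraction R}) -tofrac1 frac_lift_funE ?oner_neq0 // rmorph1 divr1.
move=> x y; have [n [d [dn0 ->]]] := fraction_numden x.
have [p [q [qn0 ->]]] := fraction_numden y.
rewrite mulf_div -!tofracM !frac_lift_funE ?mulf_neq0 //.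
by rewrite mulf_div !rmorphM.
Qed.

HB.instance Definition _ :=
  GRing.isZmodMorphism.Build {fraction R} F frac_lift_fun frac_lift_is_zmod.
HB.instance Definition _ :=
  GRing.isMonoidMorphism.Build {fraction R} F frac_lift_fun frac_lift_is_monoid.

Lemma frac_lift : exists h : {rmorphism {fraction R} -> F},
  forall x, h x%:F = f x.
Proof.
exists (frac_lift_fun : {rmorphism _ -> _}) => x /=.
by rewrite -[x%:F]divr1 -tofrac1 frac_lift_funE ?oner_neq0 // rmorph1 divr1.
Qed.

End FractionLift.

Lemma frac_rmorph_ext (R : idomainType) (F : fieldType)
    (g h : {rmorphism {fraction R} -> F}) :
  (forall x : R, g (FracField.tofrac x) = h (FracField.tofrac x)) -> g =1 h.
Proof.
move=> gh x; have [n [d [_ ->]]] := fraction_numden x.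
by rewrite !fmorph_div !gh.
Qed.

(** Identities between composite maps are proved below by packaging both sides as morphisms and
    comparing them on constants and variables. *)
Lemma mpoly_rmorph_ext (n : nat) (R : comNzRingType) (S : nzRingType)
    (g h : {rmorphism {mpoly R[n]} -> S}) :
  (forall c, g c%:MP = h c%:MP) -> (forall i, g 'X_i = h 'X_i) -> g =1 h.
Proof.
move=> ghC ghX p; elim/mpolyind: p => [|c m p _ _ IH]; first by rewrite !rmorph0.
rewrite !rmorphD /= IH -mul_mpolyC !rmorphM /= ghC mpolyXE_id !rmorph_prod.
by congr (_ * _ + _); apply: eq_bigr => i _; rewrite !rmorphXn /= ghX.
Qed.

Section RatfunMorphisms.
Variables (K F : fieldType) (n : nat).

Lemma ratfun_lift (iota : {rmorphism K -> F}) (s : 'I_n -> F) :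
    (forall p : {mpoly K[n]}, mmap iota s p = 0 -> p = 0) ->
  exists h : {rmorphism ratfun K n -> F},
    (forall k, h (ratC K n k) = iota k) /\ forall i, h (ratX K i) = s i.
Proof.
move=> indep; have [h hE] := frac_lift (f := mmap iota s) indep.
exists h; split=> [k|i] /=; first by rewrite hE; exact: mmapC.
by rewrite /ratX hE [LHS]mmapX mmap1U.
Qed.

Lemma ratfun_rmorph_ext (g h : {rmorphism ratfun K n -> F}) :
    (forall k, g (ratC K n k) = h (ratC K n k)) ->
    (forall i, g (ratX K i) = h (ratX K i)) -> g =1 h.
Proof.
move=> ghC ghX; apply: frac_rmorph_ext => x.
exact: (@mpoly_rmorph_ext _ _ _ (g \o @FracField.tofrac _) (h \o @FracField.tofrac _)).
Qed.

End RatfunMorphisms.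

(** * Factorial rings *)

Section Factoriality.
Variables (N : idomainType) (B : N -> Prop).

(** These notions are relative to a predicate [B] on an ambient domain, so that a subring of a
    function field, such as a Laurent ring, needs no type of its own. *)
Definition dvd_in (a b : N) : Prop := exists2 c, B c & b = c * a.

Definition unit_in (u : N) : Prop := B u /\ exists2 w, B w & w * u = 1.

Definition prime_in (p : N) : Prop :=
  [/\ B p, p != 0, ~ unit_in p & forall a b, B a -> B b ->
      dvd_in p (a * b) -> dvd_in p a \/ dvd_in p b].

(** The factors are prime rather than irreducible, so the existence of a factorization already
    implies its uniqueness. *)
Definition factorial_ring : Prop := forall x, B x -> x != 0 ->
  exists u s, [/\ unit_in u, forall p, p \in s -> prime_in p
                & x = u * \prod_(p <- s) p].

End Factoriality.

Section FactorialityTheory.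
Variables (N : idomainType) (B : N -> Prop).
Hypotheses (B1 : B 1) (BM : forall x y, B x -> B y -> B (x * y)).
Local Notation dvdB := (dvd_in B).
Local Notation unitB := (unit_in B).
Local Notation primeB := (prime_in B).

Lemma dvd_in_trans a b c : dvdB a b -> dvdB b c -> dvdB a c.
Proof. by move=> [x Bx ->] [y By ->]; exists (y * x); rewrite ?mulrA //; apply: BM. Qed.

Lemma unit_in1 : unitB 1.
Proof. by split=> //; exists 1; rewrite ?mulr1. Qed.

Lemma unit_inM u v : unitB u -> unitB v -> unitB (u * v).
Proof.
move=> [Bu [u' Bu' u'u]] [Bv [v' Bv' v'v]]; split; first exact: BM.
exists (v' * u'); first exact: BM.
have -> : v' * u' * (u * v) = (u' * u) * (v' * v) by ring.
by rewrite u'u v'v mulr1.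
Qed.

Lemma unit_in_dvd u p : unitB u -> dvdB p u -> B p -> unitB p.
Proof.
move=> [Bu [w Bw wu]] [c Bc uE] Bp; split=> //; exists (w * c); first exact: BM.
by rewrite -mulrA -uE.
Qed.

Lemma prod_in s : (forall p, p \in s -> primeB p) -> B (\prod_(p <- s) p).
Proof.
elim: s => [|q s IH] ps; first by rewrite big_nil.
rewrite big_cons; apply: BM; first by case: (ps q (mem_head _ _)).
by apply: IH => p sp; apply: ps; rewrite inE sp orbT.
Qed.

Lemma prime_in_dvd_unit u p : unitB u -> primeB p -> ~ dvdB p u.
Proof. by move=> uu [Bp _ np _] /(unit_in_dvd uu) /(_ Bp). Qed.

Lemma prime_in_dvd_prime p q : primeB p -> primeB q -> dvdB p q -> dvdB q p.
Proof.
move=> [Bp p0 np _] [Bq q0 nq qP] [c Bc qE].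
have [|//|[d Bd cE]] := qP p c Bp Bc; first by exists 1 => //; rewrite qE mul1r mulrC.
case: np; split=> //; exists d => //; apply: (mulfI q0).
by rewrite mulrA [q * d]mulrC -cE mulr1.
Qed.

Lemma prime_in_dvd_prod p u s : unitB u -> primeB p ->
    (forall q, q \in s -> primeB q) -> dvdB p (u * \prod_(q <- s) q) ->
  exists2 q, q \in s & dvdB p q /\ dvdB q p.
Proof.
move=> uu pp; elim: s => [|q s IH] ps.
  by rewrite big_nil mulr1 => /(prime_in_dvd_unit uu pp).
have pq := ps q (mem_head _ _).
have ps' r : r \in s -> primeB r by move=> sr; apply: ps; rewrite inE sr orbT.
rewrite big_cons mulrCA; case: (pp) => _ _ _ pP.
case/pP; [by case: pq | by apply: BM; [case: uu | exact: prod_in] | |].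
  by move=> dpq; exists q; rewrite ?mem_head //; split=> //; apply: prime_in_dvd_prime.
by move/(IH ps') => [r sr dr]; exists r; rewrite // inE sr orbT.
Qed.

End FactorialityTheory.

(** * Gauss's lemma and the factoriality of polynomial rings *)

Section PolyFactorial.
Variable R : idomainType.
Let T {A : Type} (_ : A) := True.
Local Notation dvdR := (dvd_in (@T R)).
Local Notation primeR := (prime_in (@T R)).
Local Notation dvdX := (dvd_in (@T {poly R})).
Local Notation primeX := (prime_in (@T {poly R})).
Local Notation unitX := (unit_in (@T {poly R})).
Hypothesis factR : factorial_ring (@T R).

Lemma dvd_polyC_coef p (f : {poly R}) : dvdX p%:P f -> forall i, dvdR p f`_i.
Proof. by move=> [c _ ->] i; rewrite coefMC; exists c`_i. Qed.

Lemma dvd_polyC_sub p (f g : {poly R}) : dvdX p%:P f -> dvdX p%:P (f + g) -> dvdX p%:P g.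
Proof.
move=> [c _ ->] [d _ E]; exists (d - c) => //.
by rewrite mulrBl -E addrC addKr.
Qed.

(** Induction on the total size of the two factors: [p] divides the product of the leading
    coefficients, hence one of them, and the corresponding leading term can be removed without
    affecting divisibility by [p]. *)
Lemma polyC_prime_in p : primeR p -> primeX p%:P.
Proof.
case=> _ p0 np pP; split=> //; first by rewrite polyC_eq0.
  move=> [_ [w _ wp]]; apply: np; split=> //; exists w`_0 => //.
  by have := congr1 (fun f : {poly R} => f`_0) wp; rewrite coefMC coef1.
move=> f g _ _; move: {2}(size f + size g).+1 (ltnSn (size f + size g)) => n.
elim: n f g => // n IH f g; rewrite ltnS => len dfg.
have [->|f0] := eqVneq f 0; first by left; exists 0; rewrite ?mul0r.
have [->|g0] := eqVneq g 0; first by right; exists 0; rewrite ?mul0r.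
have szt (h : {poly R}) : h != 0 -> (size (h - lead_coef h *: 'X^((size h).-1))%R < size h)%N.
  move=> h0; have sh : (0 < size h)%N by rewrite size_poly_gt0.
  rewrite -[X in (_ < X)%N](prednK sh) ltnS; apply/leq_sizeP => j.
  rewrite leq_eqVlt => /predU1P[<-|lt_j].
    by rewrite coefB coefZ coefXn eqxx mulr1 subrr.
  rewrite coefB coefZ coefXn gtn_eqF // mulr0 subr0 nth_default //.
  by rewrite -(prednK sh).
have dl (h : {poly R}) : dvdR p (lead_coef h) -> dvdX p%:P (lead_coef h *: 'X^((size h).-1)).
  move=> [c _ ->]; exists (c *: 'X^((size h).-1)) => //.
  by rewrite -!mul_polyC polyCM; ring.
have : dvdR p (lead_coef f * lead_coef g).
  by rewrite -lead_coefM lead_coefE; apply: dvd_polyC_coef.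
case/pP => // dpl.
  have := dl f dpl; set h := _ *: _ => dh.
  have [||dF|?] := IH (f - h) g; [| | |by right].
  - by apply: leq_trans len; rewrite ltn_add2r szt.
  - apply: (@dvd_polyC_sub _ (h * g)); last by rewrite mulrBl addrC subrK.
    by move: dh => [c _ ->]; exists (c * g) => //; ring.
  left; move: dF dh => [c _ cE] [d _ dE]; exists (c + d) => //.
  by rewrite mulrDl -cE -dE subrK.
have := dl g dpl; set h := _ *: _ => dh.
have [||?|dG] := IH f (g - h); [| |by left|].
- by apply: leq_trans len; rewrite ltn_add2l szt.
- apply: (@dvd_polyC_sub _ (f * h)); last by rewrite mulrBr addrC subrK.
  by move: dh => [c _ ->]; exists (f * c) => //; ring.
right; move: dG dh => [c _ cE] [d _ dE]; exists (c + d) => //.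
by rewrite mulrDl -cE -dE subrK.
Qed.

Let primitive (f : {poly R}) := forall p, primeR p -> ~ dvdX p%:P f.

(** A constant prime dividing [f] divides its leading coefficient, so the number of prime factors of
    that coefficient bounds how many primes can be divided out. *)
Lemma primitive_part (f : {poly R}) : f != 0 ->
  exists c f0, [/\ c != 0, primitive f0 & f = c%:P * f0].
Proof.
move=> f0; have lf0 : lead_coef f != 0 by rewrite lead_coef_eq0.
have [u [s [uu ps]]] := factR I lf0.
move: {2}(size s) (erefl (size s)) => k.
elim: k u s f uu ps f0 {lf0} => [|k IH] u s f uu ps f0 sk lE;
  (have [[p [pp dpf]]|nP] := pselect (exists p, primeR p /\ dvdX p%:P f); last first).
- by exists 1, f; rewrite oner_neq0 mul1r; split=> // p pp dp; apply: nP; exists p.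
- have := dvd_polyC_coef dpf (size f).-1; rewrite -lead_coefE lE.
  by case/(prime_in_dvd_prod _ _ uu pp ps) => // q; case: (s) sk.
- by exists 1, f; rewrite oner_neq0 mul1r; split=> // p pp dp; apply: nP; exists p.
have := dvd_polyC_coef dpf (size f).-1; rewrite -lead_coefE lE.
case/(prime_in_dvd_prod _ _ uu pp ps) => // q sq [[e _ qE] [e' _ pE]].
have p0 : p != 0 by case: pp.
have ee' : e' * e = 1 by apply: (mulIf p0); rewrite -mulrA -qE -pE mul1r.
move: dpf f0 lE => [g _ ->]; rewrite mulf_eq0 negb_or => /andP[g0 _].
rewrite lead_coefM lead_coefC (perm_big _ (perm_to_rem sq)) big_cons /= {1}qE.
set t := \prod_(_ <- _) _ => lE.
have [|r rs|//|||c [h [c0 ph gE]]] := IH (u * e) (rem q s) g.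
- by apply: unit_inM => //; split=> //; exists e'.
- by apply: ps; apply: mem_rem rs.
- by rewrite size_rem // sk.
- by apply: (mulIf p0); rewrite lE -/t /=; ring.
by exists (c * p), h; rewrite mulf_neq0 // polyCM gE; split=> //; ring.
Qed.

(** The prime factors of [d] are removed one at a time, each from the factor [g] or [h] that it
    divides. The sizes are recorded because the lemma serves to bring a factorization over the
    fraction field back to [R] without losing its degrees. *)
Lemma polyC_mul_cancel d (f g h : {poly R}) : d != 0 -> d%:P * f = g * h ->
  exists g' h', [/\ f = g' * h', size g' = size g & size h' = size h].
Proof.
move=> d0; have [u [s [[_ [w _ wu]] ps ->]]] := factR I d0.
elim: s f g h ps => [|p s IH] f g h ps.
  rewrite big_nil mulr1 => E; exists (w%:P * g), h; split=> //.
    by rewrite -mulrA -E mulrA -polyCM wu mul1r.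
  by rewrite size_Cmul //; apply: contra_eq_neq wu => ->; rewrite mul0r eq_sym oner_neq0.
have pp := ps p (mem_head _ _); have ps' r : r \in s -> primeR r by move=> sr; apply: ps; rewrite inE sr orbT.
have p0 : p != 0 by case: pp.
have pP0 : p%:P != 0 :> {poly R} by rewrite polyC_eq0.
rewrite big_cons mulrCA polyCM => E.
have [_ _ _ /(_ g h I I)[]] := polyC_prime_in pp.
- by exists ((u * \prod_(j <- s) j)%:P * f) => //; rewrite -E; ring.
- move=> [g1 _ gE]; have [|g' [h' [-> sg sh]]] := IH f g1 h ps'.
    by apply: (mulfI pP0); rewrite mulrA E gE; ring.
  by exists g', h'; rewrite sg sh gE [g1 * _]mulrC size_Cmul.
move=> [h1 _ hE]; have [|g' [h' [-> sg sh]]] := IH f g h1 ps'.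
  by apply: (mulfI pP0); rewrite mulrA E hE; ring.
by exists g', h'; rewrite sg sh hE [h1 * _]mulrC size_Cmul.
Qed.

(** No prime factor of [d] divides the primitive [f], so all of them are absorbed by [q]. This
    brings divisibility over the fraction field back to [R]. *)
Lemma primitive_dvd_cancel d (f g q : {poly R}) : d != 0 -> primitive f ->
  d%:P * g = q * f -> dvdX f g.
Proof.
move=> d0 pf; have [u [s [[_ [w _ wu]] ps ->]]] := factR I d0.
elim: s g q ps => [|p s IH] g q ps.
  rewrite big_nil mulr1 => E; exists (w%:P * q) => //.
  by rewrite -mulrA -E mulrA -polyCM wu mul1r.
have pp := ps p (mem_head _ _); have ps' r : r \in s -> primeR r by move=> sr; apply: ps; rewrite inE sr orbT.
have p0 : p != 0 by case: pp.
have pP0 : p%:P != 0 :> {poly R} by rewrite polyC_eq0.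
rewrite big_cons mulrCA polyCM => E.
have [_ _ _ /(_ q f I I)[]] := polyC_prime_in pp.
- by exists ((u * \prod_(j <- s) j)%:P * g) => //; rewrite -E; ring.
- move=> [q1 _ qE]; apply: (IH g q1 ps').
  by apply: (mulfI pP0); rewrite mulrA E qE; ring.
by move/(pf _ pp).
Qed.

Local Notation toF := (@FracField.tofrac R).
Local Notation toFX := (map_poly toF).

Lemma clear_denominators (G : {poly {fraction R}}) :
  exists d g, d != 0 /\ toF d *: G = toFX g.
Proof.
elim/poly_ind: G => [|G c [d [g [d0 E]]]].
  by exists 1, 0; rewrite oner_neq0 rmorph0 scaler0.
have [n [e [e0 ->]]] := fraction_numden c.
exists (d * e), (e%:P * g * 'X + (d * n)%:P); rewrite mulf_neq0 //; split=> //.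
rewrite rmorphD !rmorphM /= map_polyX !map_polyC /= -E scalerDr.
rewrite -!mul_polyC !rmorphM /= -!polyCM; congr (_ + _); first by ring.
by congr (_%:P); rewrite mulrACA divff ?tofrac_eq0 // mulr1 [RHS]mulrC mulrC.
Qed.

Lemma size_toFX (g : {poly R}) : size (toFX g) = size g.
Proof. by rewrite size_map_inj_poly ?rmorph0 // => x y /eqP; rewrite tofrac_eq => /eqP. Qed.

Lemma toFX_inj : injective toFX.
Proof. by apply: map_inj_poly => [x y /eqP|]; [rewrite tofrac_eq => /eqP | rewrite rmorph0]. Qed.

(** Over the fraction field an irreducible polynomial is prime, by coprimality. The two cancellation
    lemmas carry irreducibility to the fraction field and divisibility back. *)
Lemma primitive_prime_in (f : {poly R}) : primitive f -> (1 < size f)%N ->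
    (forall g h, f = g * h -> (1 < size g)%N -> (1 < size h)%N -> False) ->
  primeX f.
Proof.
move=> pf sf irr; have f0 : f != 0 by rewrite -size_poly_gt0 ltnW.
have irrF : irreducible_poly (toFX f).
  split=> [|G sG]; first by rewrite size_toFX.
  move=> /dvdpP[H fE]; rewrite -dvdp_size_eqp ?fE ?dvdp_mull // -fE.
  have F0 : toFX f != 0 by rewrite -size_poly_gt0 size_toFX ltnW.
  have : H * G != 0 by rewrite -fE.
  rewrite mulf_eq0 negb_or => /andP[H0 G0].
  have [sH|sH] := leqP (size H) 1%N.
    have sH1 : size H = 1%N by apply/eqP; rewrite eqn_leq sH size_poly_gt0.
    by rewrite fE size_mul // sH1.
  have [d [g [d0 dE]]] := clear_denominators G.
  have [e [h [e0 eE]]] := clear_denominators H.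
  have sg : size g = size G by rewrite -size_toFX -dE size_scale ?tofrac_eq0.
  have sh : size h = size H by rewrite -size_toFX -eE size_scale ?tofrac_eq0.
  have [||g' [h' [E sg' sh']]] := @polyC_mul_cancel (d * e) f g h.
  - by rewrite mulf_neq0.
  - apply: toFX_inj; rewrite !rmorphM /= -dE -eE map_polyC /= fE -!mul_polyC ?rmorphM /=.
    by rewrite map_polyC /=; ring.
  case: (irr g' h' E); rewrite ?sg' ?sh' ?sg ?sh //.
  by rewrite ltn_neqAle eq_sym sG size_poly_gt0.
split=> //.
  move=> [_ [w _ wf]]; have := congr1 (fun p : {poly R} => size p) wf.
  have w0 : w != 0 by apply: contra_eq_neq wf => ->; rewrite mul0r eq_sym oner_neq0.
  rewrite size_mul // size_poly1; move: w0 sf; rewrite -size_poly_gt0.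
  by move: (size w) (size f) => a b; lia.
move=> g h _ _ [q _ qE].
have dF (l : {poly R}) : toFX f %| toFX l -> dvdX f l.
  move=> /dvdpP[Q E]; have [d [r [d0 dE]]] := clear_denominators Q.
  apply: (@primitive_dvd_cancel d f l r d0 pf); apply: toFX_inj.
  by rewrite !rmorphM /= -dE map_polyC /= E -!mul_polyC; ring.
have := irreducible_poly_coprime (toFX g) irrF.
case: (boolP (toFX f %| toFX g)) => [/dF dg _|_ /= cop]; first by left.
by right; apply: dF => //; rewrite -(Gauss_dvdpr _ cop) -rmorphM /= qE rmorphM /= dvdp_mull.
Qed.

Lemma poly_factorial : factorial_ring (@T {poly R}).
Proof.
have factC c : c != 0 -> exists u s, [/\ unitX u, forall p, p \in s -> primeX p & c%:P = u * \prod_(p <- s) p].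
  move=> c0; have [u [s [[_ [w _ wu]] ps ->]]] := factR I c0.
  exists u%:P, [seq p%:P | p <- s]; split.
  - by split=> //; exists w%:P => //; rewrite -polyCM wu.
  - by move=> _ /mapP[p sp ->]; apply/polyC_prime_in/ps.
  - by rewrite big_map polyCM rmorph_prod.
have cat_fact (f g : {poly R}) :
  (exists u s, [/\ unitX u, forall p, p \in s -> primeX p & f = u * \prod_(p <- s) p]) ->
  (exists u s, [/\ unitX u, forall p, p \in s -> primeX p & g = u * \prod_(p <- s) p]) ->
  (exists u s, [/\ unitX u, forall p, p \in s -> primeX p & f * g = u * \prod_(p <- s) p]).
  move=> [u [s [uu ps ->]]] [v [t [uv pt ->]]]; exists (u * v), (s ++ t); split.
  - exact: unit_inM.
  - by move=> p; rewrite mem_cat => /orP[/ps|/pt].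
  - by rewrite big_cat /= mulrACA.
move=> f _; move: {2}(size f).+1 (ltnSn (size f)) => n.
elim: n f => // n IH f; rewrite ltnS => len f0.
have [c [g [c0 pg fE]]] := primitive_part f0.
rewrite fE; apply: (cat_fact); first exact: factC.
have g0 : g != 0 by apply: contra_neq f0 => g0; rewrite fE g0 mulr0.
have sg : (size g <= n)%N by move: len; rewrite fE size_Cmul.
have [sz|sz] := leqP (size g) 1%N.
  by rewrite (size1_polyC sz); apply: factC; rewrite -polyC_eq0 -size1_polyC.
have [[h [k [gE sh sk]]]|nred] := pselect (exists h k, [/\ g = h * k, (1 < size h)%N & (1 < size k)%N]).
  have h0 : h != 0 by rewrite -size_poly_gt0 ltnW.
  have k0 : k != 0 by rewrite -size_poly_gt0 ltnW.
  move: sg; rewrite gE size_mul // => sg.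
  by apply: cat_fact; apply: IH => //; move: sg sh sk; lia.
exists 1, [:: g]; rewrite big_seq1 mul1r; split=> //; first exact: unit_in1.
move=> p; rewrite inE => /eqP ->; apply: primitive_prime_in => // h k gE sh sk.
by apply: nred; exists h, k.
Qed.

End PolyFactorial.

Lemma factorial_range (R N : idomainType) (f : {rmorphism R -> N}) :
    (forall x, f x = 0 -> x = 0) -> factorial_ring (fun _ : R => True) ->
  factorial_ring (fun y => exists x, y = f x).
Proof.
move=> f0 factR _ [x ->] fx0.
have finj y z : f y = f z -> y = z.
  by move=> E; apply/eqP; rewrite -subr_eq0; apply/eqP/f0; rewrite rmorphB E subrr.
have x0 : x != 0 by apply: contra_neq fx0 => ->; rewrite rmorph0.
have [u [s [[_ [w _ wu]] ps ->]]] := factR x I x0.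
exists (f u), (map f s); split.
- by split; [exists u | exists (f w); [exists w | rewrite -rmorphM wu rmorph1]].
- move=> _ /mapP[p sp ->]; have [_ p0 np pP] := ps p sp; split.
  + by exists p.
  + by apply: contra_neq p0 => /f0.
  + move=> [_ [_ [v ->]]]; rewrite -rmorphM -(rmorph1 f) => /finj vp.
    by apply: np; split=> //; exists v.
  + move=> _ _ [y ->] [z ->] [_ [c ->]]; rewrite -!rmorphM => /finj E.
    have [|[e _ ->]|[e _ ->]] := pP y z I I; first by exists c.
      by left; exists (f e); [exists e | rewrite rmorphM].
    by right; exists (f e); [exists e | rewrite rmorphM].
- by rewrite rmorphM rmorph_prod big_map.
Qed.

Section MpolyFactorial.
Variable F : fieldType.

(** The inverse of [muni]: the last variable is the image of the polynomial variable. *)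
Definition poly_to_mpoly n : {rmorphism {poly {mpoly F[n]}} -> {mpoly F[n.+1]}} :=
  (horner_eval 'X_ord_max \o map_poly (@mwiden n F) : {rmorphism _ -> _}).

Lemma muni_X n (i : 'I_n.+1) : @muni n F 'X_i =
  if unlift ord_max i is Some j then ('X_j)%:P else 'X.
Proof.
rewrite [LHS]mmapX mmap1U; case: splitP => [j ij|j ij].
  have -> : i = lift ord_max j by apply: val_inj; rewrite /= /bump leqNgt ltn_ord.
  by rewrite liftK.
by have -> : i = ord_max; [apply: val_inj; move: ij; rewrite /= ord1 addn0 | rewrite unlift_none].
Qed.

Lemma poly_to_mpolyK n : cancel (@muni n F) (poly_to_mpoly n).
Proof.
apply: (@mpoly_rmorph_ext _ _ _ (poly_to_mpoly n \o @muni n F) idfun) => [c|i] /=.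
  by rewrite muniC map_polyC /= /horner_eval hornerC mwidenC.
rewrite muni_X; case: unliftP => [j|] ->.
  rewrite map_polyC /horner_eval hornerC /= mwidenX mnmwiden1.
  by congr 'X_(_); apply: val_inj; rewrite /= /bump leqNgt ltn_ord.
by rewrite map_polyX /horner_eval hornerX.
Qed.

Lemma muniK n : cancel (poly_to_mpoly n) (@muni n F).
Proof.
have mwE : @muni n F \o @mwiden n F =1 polyC.
  apply: (@mpoly_rmorph_ext _ _ _ (@muni n F \o @mwiden n F) polyC) => [c|i] /=.
    by rewrite mwidenC muniC.
  rewrite mwidenX mnmwiden1 muni_X.
  have -> : widen_ord (leqnSn n) i = lift ord_max i by apply: val_inj; rewrite /= /bump leqNgt ltn_ord.
  by rewrite liftK.
elim/poly_ind => [|p c IH]; first by rewrite !rmorph0.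
rewrite (rmorphD (poly_to_mpoly n)) (rmorphM (poly_to_mpoly n)) muniD muniM IH; congr (_ * _ + _).
  by rewrite /= map_polyX /horner_eval hornerX muni_X unlift_none.
by rewrite /= map_polyC /horner_eval hornerC; apply: mwE.
Qed.

Lemma mpoly_factorial n : factorial_ring (fun _ : {mpoly F[n]} => True).
Proof.
elim: n => [|n IH].
  move=> p _ p0.
  have -> : p = (p@_0)%:MP.
    by apply/mpolyP => m; rewrite mcoeffC (_ : m = 0%MM) ?eqxx ?mulr1 //; apply/mnmP; case.
  exists (p@_0)%:MP, [::]; rewrite big_nil mulr1; split=> //; split=> //.
  exists (p@_0)^-1%:MP => //; rewrite -mpolyCM mulVf //; apply: contra_neq p0 => p0.
  by apply/mpolyP => m; rewrite mcoeff0 (_ : m = 0%MM) //; apply/mnmP; case.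
have f0 p : poly_to_mpoly n p = 0 -> p = 0.
  by move/(congr1 (@muni n F)); rewrite muniK rmorph0.
have fact := factorial_range f0 (poly_factorial IH).
have BE : (fun y => exists x, y = poly_to_mpoly n x) = (fun _ => True).
  by apply: funext => y; apply/propext; split=> // _; exists (muni y); rewrite poly_to_mpolyK.
by rewrite BE in fact.
Qed.

End MpolyFactorial.

(** * Divisors *)

(** Valuations indexed by the primes of [B] up to units. The arguments on divisors use only these
    properties, and are applied both to a polynomial ring over [M] and to a Laurent ring. The field
    [div_act] says that an involution of the ring acts on its primes. *)
Record divisor_theory (N : fieldType) (B : N -> Prop) (S : choiceType)
    (v : S -> N -> int) : Prop := DivisorTheory {
  divM : forall s f g, f != 0 -> g != 0 -> v s (f * g) = v s f + v s g;
  div_finite : forall f, f != 0 -> exists t : seq S, forall s, v s f != 0 -> s \in t;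
  div_realize : forall (n : S -> int) (t : seq S), (forall s, n s != 0 -> s \in t) ->
    exists2 f, f != 0 & forall s, v s f = n s;
  div_unit : forall f, f != 0 -> (forall s, v s f = 0) <-> unit_in B f;
  div_act : forall h : {rmorphism N -> N}, involutive h -> (forall x, B x -> B (h x)) ->
    exists ah : S -> S, forall s f, f != 0 -> v (ah s) (h f) = v s f }.

Section DivisorTheory.
Variables (N : fieldType) (B : N -> Prop).
Hypotheses (B0 : B 0) (B1 : B 1) (BM : forall x y, B x -> B y -> B (x * y)).
Hypothesis fracB : forall f, exists b c, [/\ B b, B c, c != 0 & f = b / c].
Hypothesis factB : factorial_ring B.
Local Notation dvdB := (dvd_in B).
Local Notation unitB := (unit_in B).
Local Notation primeB := (prime_in B).

Let is_val p f (k : int) := exists b c,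
  [/\ B b, B c, ~ dvdB p b, ~ dvdB p c & f = p ^ k * (b / c)].

Let dvd0 p : dvdB p 0. Proof. by exists 0; rewrite ?mul0r. Qed.

Let ndvd_neq0 p b : ~ dvdB p b -> b != 0.
Proof. by move=> npb; apply/eqP => b0; apply: npb; rewrite b0. Qed.

Let unitB_neq0 u : unitB u -> u != 0.
Proof.
by move=> [_ [w _ wu]]; apply: contra_eq_neq wu => ->; rewrite mulr0 eq_sym oner_neq0.
Qed.

Lemma unit_inV u : unitB u -> unitB u^-1.
Proof.
move=> uu; have u0 := unitB_neq0 uu; case: uu => Bu [w Bw wu].
have -> : u^-1 = w by apply: (mulIf u0); rewrite mulVf ?wu.
by split=> //; exists u; rewrite // mulrC.
Qed.

Lemma unit_in_expz u (k : int) : unitB u -> unitB (u ^ k).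
Proof.
move=> uu; have uX n : unitB (u ^+ n).
  elim: n => [|n IH]; first by rewrite expr0; apply: unit_in1.
  by rewrite exprS; apply: unit_inM.
by case: k => n; [exact: uX | rewrite NegzE -exprnN; exact/unit_inV/uX].
Qed.

Let prime_unit_ndvd p u b : unitB u -> ~ dvdB p b -> ~ dvdB p (u * b).
Proof.
move=> uu npb dub; apply: npb; case: (uu) => _ [w Bw wu].
by case: dub => c Bc E; exists (w * c); [exact: BM | rewrite -mulrA -E mulrA wu mul1r].
Qed.

Let is_val_uniq p f k l : primeB p -> is_val p f k -> is_val p f l -> k = l.
Proof.
move=> pp; have p0 : p != 0 by case: pp.
wlog lekl : k l / k <= l.
  by move=> W vk vl; case: (lerP k l) => [/W|/ltW/W]; [apply | move=> /(_ vl vk)].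
move=> [b [c [Bb Bc nb nc ->]]] [d [e [Bd Be nd ne E]]].
have [//|/eqP nkl] := pselect (k = l).
have [m lE] : exists m, l = k + Posz m.+1.
  move: lekl; rewrite le_eqVlt (negPf nkl) /= => ltkl; exists (absz (l - k - 1)%R); lia.
have [_ _ _ pP] := pp; case: (pP b e Bb Be) => //.
exists (p ^+ m * (d * c)); first by apply: BM; [elim: m {lE} => [|m IH]; rewrite ?expr0 // exprS; apply: BM => //; case: pp | exact: BM].
have c0 := ndvd_neq0 nc; have e0 := ndvd_neq0 ne.
move: E; rewrite lE expfzDr // -[RHS]mulrA => E.
have {}E : b / c = p ^+ m.+1 * (d / e) := mulfI (expfz_neq0 k p0) E.
by transitivity (b / c * (c * e)); [field; rewrite ?c0 ?e0 | rewrite E exprS; field; rewrite ?c0 ?e0].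
Qed.

(** For a prime [p], the default 0 is reached only at [f = 0]. *)
Let ord p f : int :=
  if pselect (exists k, is_val p f k) is left h then sval (cid h) else 0.

Let ordE p f k : primeB p -> is_val p f k -> ord p f = k.
Proof.
move=> pp vk; rewrite /ord; case: pselect => [h|[]]; last by exists k.
exact: is_val_uniq pp (svalP (cid h)) vk.
Qed.

Let is_val_prod p u s : primeB p -> unitB u -> (forall q, q \in s -> primeB q) ->
  exists (n : nat) c, [/\ B c, ~ dvdB p c & u * \prod_(q <- s) q = p ^+ n * c].
Proof.
move=> pp uu; have [Bp p0 np pP] := pp.
elim: s => [|q s IH] ps.
  exists 0%N, u; rewrite big_nil mulr1 expr0 mul1r; split=> //; first by case: uu.
  exact: prime_in_dvd_unit.
have pq := ps q (mem_head _ _).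
have [|n [c [Bc nc E]]] := IH; first by move=> r sr; apply: ps; rewrite inE sr orbT.
rewrite big_cons mulrCA E; have [dpq|npq] := pselect (dvdB p q).
  have [e Be pE] := prime_in_dvd_prime B1 pp pq dpq.
  case: dpq => d Bd qE; have ud : unitB d.
    by split=> //; exists e => //; apply: (mulIf p0); rewrite -mulrA -qE -pE mul1r.
  exists n.+1, (d * c); split; [exact: BM | exact: prime_unit_ndvd |].
  by rewrite qE exprS; ring.
exists n, (q * c); split; [by apply: BM => //; case: pq | | by ring].
by move=> /pP []//; case: pq.
Qed.

Let is_val_ex p f : primeB p -> f != 0 -> exists k, is_val p f k.
Proof.
move=> pp; have p0 : p != 0 by case: pp.
have [b [c [Bb Bc c0 ->]]] := fracB f; rewrite mulf_eq0 invr_eq0 (negPf c0) orbF => b0.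
have [u [s [uu ps bE]]] := factB Bb b0; have [w [t [uw pt cE]]] := factB Bc c0.
have [n [b' [Bb' nb bE']]] := is_val_prod pp uu ps.
have [m [c' [Bc' nc cE']]] := is_val_prod pp uw pt.
exists (Posz n - Posz m), b', c'; split=> //; rewrite bE bE' cE cE' expfzDr // -exprnN.
have := ndvd_neq0 nc; rewrite -exprnP => c'0; field; rewrite c'0 expf_neq0 //.
Qed.

Let ordP p f : primeB p -> f != 0 -> is_val p f (ord p f).
Proof. by move=> pp /(is_val_ex pp)[k vk]; rewrite (ordE pp vk). Qed.

Let ordM p f g : primeB p -> f != 0 -> g != 0 -> ord p (f * g) = ord p f + ord p g.
Proof.
move=> pp f0 g0; have p0 : p != 0 by case: pp.
have [b [c [Bb Bc nb nc fE]]] := ordP pp f0; have [d [e [Bd Be nd ne gE]]] := ordP pp g0.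
apply: (ordE pp); exists (b * d), (c * e); have [_ _ _ pP] := pp.
split; try exact: BM; [by move/pP => [] | by move/pP => [] |].
by rewrite {1}fE {1}gE expfzDr // -mulf_div; ring.
Qed.

Let ord_assoc p q f : primeB p -> primeB q -> dvdB p q -> f != 0 -> ord p f = ord q f.
Proof.
move=> pp pq dpq f0; have p0 : p != 0 by case: pp.
have [e Be pE] := prime_in_dvd_prime B1 pp pq dpq; case: (dpq) => d Bd qE.
have ue : unitB e.
  by split=> //; exists d => //; apply: (mulIf p0); rewrite mul1r [RHS]pE qE; ring.
have [b [c [Bb Bc nb nc fE]]] := ordP pp f0.
have ndq x : ~ dvdB p x -> ~ dvdB q x by move=> nx dx; apply: nx; apply: dvd_in_trans dx.
apply/esym/(ordE pq); exists (e ^ ord p f * b), c; have uek := unit_in_expz (ord p f) ue.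
split=> //; [by apply: BM => //; case: uek | exact/prime_unit_ndvd/ndq | exact: ndq |].
by rewrite {1}fE {1}pE expfzMl; ring.
Qed.

Let assocb p q := `[< primeB q /\ dvdB p q >].
(** Associate primes define extensionally equal predicates, and [choose] then returns the same
    element: this selects one prime in each class, and the index type [S] consists of the selected
    ones. *)
Let rep p := choose (assocb p) p.

Let assocb_refl p : primeB p -> assocb p p.
Proof. by move=> pp; apply/asboolP; split=> //; exists 1; rewrite ?mul1r. Qed.

Let repP p : primeB p -> primeB (rep p) /\ dvdB p (rep p).
Proof. by move/assocb_refl/chooseP/asboolP. Qed.

Let rep_eq p q : primeB p -> primeB q -> dvdB p q -> rep p = rep q.
Proof.
move=> pp pq dpq; rewrite /rep; have aE : assocb p =1 assocb q.
  move=> r; apply/asboolP/asboolP => -[pr dr]; split=> //; apply: dvd_in_trans dr => //.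
  exact: prime_in_dvd_prime.
rewrite (eq_choose aE); apply: choose_id; last exact: assocb_refl.
by rewrite -aE; apply: assocb_refl.
Qed.

Let S := {p : N | `[< primeB p >] && (rep p == p)}.
Let v (s : S) f := ord (sval s) f.

Let S_prime (s : S) : primeB (sval s).
Proof. by case: s => p /= /andP[/asboolP]. Qed.

Let S_of p : primeB p -> {s : S | dvdB p (sval s)}.
Proof.
move=> pp; have [prp dp] := repP pp.
have h : `[< primeB (rep p) >] && (rep (rep p) == rep p).
  by apply/andP; split; [exact/asboolP | rewrite -(rep_eq pp prp dp)].
by exists (exist _ (rep p) h).
Qed.

Let S_eq (s t : S) : dvdB (sval s) (sval t) -> s = t.
Proof.
move=> dst; apply: val_inj; rewrite /=.
have := rep_eq (S_prime s) (S_prime t) dst.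
by case: s t {dst} => p /= /andP[_ /eqP ep] [q /= /andP[_ /eqP eq]]; rewrite ep eq.
Qed.

Let v_val (s t : S) : v s (sval t) = (s == t)%:R.
Proof.
have pt := S_prime t; have ps := S_prime s; apply: (ordE ps).
have n1 : ~ dvdB (sval s) 1 by apply: prime_in_dvd_unit ps => //; apply: unit_in1.
case: eqP => [<-|nst].
  by exists 1, 1; split=> //; rewrite divr1 mulr1.
exists (sval t), 1; split=> //; [by case: pt | by move/S_eq |].
by rewrite divr1 expr0z mul1r.
Qed.

Let v1 (s : S) : v s 1 = 0.
Proof. by have := ordM (S_prime s) (oner_neq0 N) (oner_neq0 N); rewrite mulr1 -/(v s 1); move: (v s 1) => x; lia. Qed.

Let vV (s : S) f : f != 0 -> v s f^-1 = - v s f.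
Proof.
move=> f0; have := ordM (S_prime s) f0 (invr_neq0 f0); rewrite divff // -!/(v s _) v1.
by move: (v s f) (v s f^-1) => x y; lia.
Qed.

Let v_expz (s : S) f (k : int) : f != 0 -> v s (f ^ k) = k * v s f.
Proof.
move=> f0; have vX n : v s (f ^+ n) = Posz n * v s f.
  elim: n => [|n IH]; first by rewrite expr0 v1 mul0r.
  by rewrite exprS /v (ordM (S_prime s)) ?expf_neq0 // -/(v s _) -/(v s _) IH -addn1 PoszD; ring.
case: k => n; first by rewrite -exprnP.
by rewrite NegzE -exprnN vV ?expf_neq0 // vX mulNr.
Qed.

Let ord_prod_unit p u s : primeB p -> unitB u -> (forall q, q \in s -> primeB q) ->
  (forall q, q \in s -> ~ dvdB p q) -> ~ dvdB p (u * \prod_(q <- s) q).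
Proof.
move=> pp uu ps ns /(prime_in_dvd_prod B1 BM uu pp ps) [q sq [dq _]].
exact: ns dq.
Qed.

Let v_finite f : f != 0 -> exists t : seq S, forall s, v s f != 0 -> s \in t.
Proof.
have [b [c [Bb Bc c0 ->]]] := fracB f; rewrite mulf_eq0 invr_eq0 (negPf c0) orbF => b0.
have [u [s [uu ps bE]]] := factB Bb b0; have [w [t [uw pt cE]]] := factB Bc c0.
exists (pmap insub (map rep (s ++ t))) => r; apply: contraR => nr; apply/eqP.
have pr := S_prime r.
have nst q : q \in s ++ t -> ~ dvdB (sval r) q.
  move=> stq dq; move: nr; rewrite mem_pmap_sub /= => /mapP[]; exists q => //.
  have pq : primeB q by move: stq; rewrite mem_cat => /orP[/ps|/pt].
  rewrite -(rep_eq pr pq dq); case: (r) => p /= /andP[_ /eqP].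
  by [].
apply: (ordE pr); exists b, c; split=> //; last by rewrite expr0z mul1r.
  rewrite bE; apply: ord_prod_unit => // q sq; apply: nst; by rewrite mem_cat sq.
rewrite cE; apply: ord_prod_unit => // q sq; apply: nst; by rewrite mem_cat sq orbT.
Qed.

Let v_realize (n : S -> int) (t : seq S) : (forall s, n s != 0 -> s \in t) ->
    exists2 f, f != 0 & forall s, v s f = n s.
Proof.
move=> nt; wlog ut : t nt / uniq t.
  by move/(_ (undup t)); apply; [move=> s /nt; rewrite mem_undup | exact: undup_uniq].
have p0 (r : S) : sval r != 0 by case: (S_prime r).
exists (\prod_(r <- t) sval r ^ n r).
  by rewrite prodf_seq_neq0; apply/allP => r _; apply: expfz_neq0.
move=> s; transitivity (\sum_(r <- t) n r * v s (sval r)).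
  elim: (t) => [|r t' IH]; first by rewrite !big_nil v1.
  rewrite !big_cons /v (ordM (S_prime s)) ?expfz_neq0 //.
    by rewrite -/(v s _) -/(v s _) IH v_expz.
  by rewrite prodf_seq_neq0; apply/allP => q _; apply: expfz_neq0.
have [st|nst] := boolP (s \in t).
  rewrite (bigD1_seq s) //= v_val eqxx mulr1 big1 ?addr0 // => r /negPf nr.
  by rewrite v_val eq_sym nr mulr0.
rewrite big1_seq; last by move=> r /andP[_ tr]; rewrite v_val; case: eqP tr nst => [-> ->|_ _ _] //; rewrite mulr0.
by apply/esym/eqP; apply: contraNT nst; apply: nt.
Qed.

Let v_unit f : f != 0 -> (forall s, v s f = 0) <-> unitB f.
Proof.
move=> f0; split=> [vf0|uf s]; last first.
  apply: (ordE (S_prime s)); exists f, 1; split=> //; [by case: uf | | | ].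
  - by apply: prime_in_dvd_unit (S_prime s).
  - by apply: prime_in_dvd_unit (S_prime s) => //; apply: unit_in1.
  - by rewrite divr1 expr0z mul1r.
have of0 p : primeB p -> ord p f = 0.
  by move=> pp; have [s ds] := S_of pp; rewrite (ord_assoc pp (S_prime s) ds f0); apply: vf0.
have [b [c [Bb Bc c0 fE]]] := fracB f.
have b0 : b != 0 by apply: contra_neq f0 => b0; rewrite fE b0 mul0r.
have [u [s [uu ps bE]]] := factB Bb b0; have [w [t [uw pt cE]]] := factB Bc c0.
have {b c Bb Bc c0 b0 bE cE fE u w uu uw} [u uu fE] :
    exists2 u, unitB u & f = u * (\prod_(q <- s) q) / \prod_(q <- t) q.
  exists (u / w); first by apply: unit_inM => //; apply: unit_inV.
  by rewrite fE bE cE invfM; ring.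
have prn0 (l : seq N) : (forall q, q \in l -> primeB q) -> \prod_(q <- l) q != 0.
  by move=> pl; rewrite prodf_seq_neq0; apply/allP => q lq; case: (pl q lq).
have n1 p : primeB p -> ~ dvdB p 1 by move=> pp; apply: prime_in_dvd_unit pp => //; apply: unit_in1.
(* Induction on the prime factors of the denominator. Such a prime either cancels against an
   associate factor of the numerator or gives [f] a negative order; once the denominator is
   exhausted, a prime left in the numerator gives a positive order. *)
elim: t s u uu fE ps pt => [|q t IH] s u uu fE ps pt.
  rewrite big_nil divr1 in fE; case: s fE ps => [|q s] fE ps; first by rewrite fE big_nil mulr1.
  have pq := ps q (mem_head _ _).
  have [|n [c [Bc nc E]]] := is_val_prod (p := q) (s := s) pq uu; first by move=> r sr; apply: ps; rewrite inE sr orbT.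
  have : ord q f = Posz n.+1.
    apply: (ordE pq); exists c, 1; split=> //; first exact: n1.
    by rewrite fE big_cons mulrCA E divr1 -exprnP exprS mulrA.
  by rewrite of0.
have pq := pt q (mem_head _ _); have q0 : q != 0 by case: pq.
have pt' r : r \in t -> primeB r by move=> tr; apply: pt; rewrite inE tr orbT.
have [[r sr dqr]|ns] := pselect (exists2 r, r \in s & dvdB q r).
  have pr := ps r sr; have [e Be qE] := prime_in_dvd_prime B1 pq pr dqr.
  case: dqr => d Bd rE.
  have ud : unitB d by split=> //; exists e => //; apply: (mulIf q0); rewrite -mulrA -rE -qE mul1r.
  apply: (IH (rem r s) (u * d)) => //; first exact: unit_inM.
    rewrite fE (perm_big _ (perm_to_rem sr)) !big_cons /= {1}rE.
    by field; rewrite q0 prn0.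
  by move=> x /mem_rem /ps.
have [n [c [Bc nc E]]] := is_val_prod (p := q) pq (unit_in1 B1) pt.
have : ord q f = - Posz n.
  apply: (ordE pq); exists (u * \prod_(r <- s) r), c; split=> //.
  - by apply: BM; [case: uu | exact: prod_in].
  - by apply: ord_prod_unit => // r sr dr; apply: ns; exists r.
  - rewrite fE; move: E; rewrite mul1r => ->; rewrite -exprnN.
    by have := ndvd_neq0 nc => c0; field; rewrite c0 expf_neq0.
rewrite of0 // => /eqP; rewrite eq_sym oppr_eq0 => /eqP[n0].
case: nc; rewrite n0 expr0 !mul1r big_cons in E; rewrite -E.
by exists (\prod_(r <- t) r); [exact: prod_in | rewrite mulrC].
Qed.

Let v_act (h : {rmorphism N -> N}) : involutive h -> (forall x, B x -> B (h x)) ->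
  exists ah : S -> S, forall s f, f != 0 -> v (ah s) (h f) = v s f.
Proof.
move=> hK hB.
have hd p b : dvdB p b -> dvdB (h p) (h b).
  by move=> [c Bc ->]; exists (h c); [exact: hB | rewrite rmorphM].
have hdE p b : dvdB (h p) (h b) -> dvdB p b by move/hd; rewrite !hK.
have hu u : unitB u -> unitB (h u).
  by move=> [Bu [w Bw wu]]; split; [exact: hB | exists (h w); [exact: hB | rewrite -rmorphM wu rmorph1]].
have hp p : primeB p -> primeB (h p).
  move=> [Bp p0 np pP]; split; [exact: hB | by rewrite fmorph_eq0 | by move/hu; rewrite hK |].
  move=> a b Ba Bb; rewrite -[a * b]hK rmorphM => /hdE /pP [||/hd|/hd]; rewrite ?hK; auto.
exists (fun s => sval (S_of (hp _ (S_prime s)))) => s f f0; case: S_of => t dt /=.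
have hf0 : h f != 0 by rewrite fmorph_eq0.
rewrite /v -(ord_assoc (hp _ (S_prime s)) (S_prime t) dt hf0).
have [b [c [Bb Bc nb nc fE]]] := ordP (S_prime s) f0.
apply: (ordE (hp _ (S_prime s))); exists (h b), (h c).
split; [exact: hB | exact: hB | by move/hdE | by move/hdE |].
by rewrite {1}fE rmorphM fmorph_div fmorphXz.
Qed.

Lemma divisor_theory_of_factorial :
  exists (S : choiceType) (v : S -> N -> int), divisor_theory B v.
Proof.
exists S, v; split.
- by move=> s f g; apply: ordM (S_prime s).
- exact: v_finite.
- exact: v_realize.
- exact: v_unit.
- exact: v_act.
Qed.

End DivisorTheory.

Section DivisorFacts.
Variables (N : fieldType) (B : N -> Prop) (S : choiceType) (v : S -> N -> int).
Hypothesis dt : divisor_theory B v.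

Lemma div1 s : v s 1 = 0.
Proof.
by have := divM dt s (oner_neq0 N) (oner_neq0 N); rewrite mulr1; move: (v s 1) => x; lia.
Qed.

Lemma divV s f : f != 0 -> v s f^-1 = - v s f.
Proof.
move=> f0; have := divM dt s f0 (invr_neq0 f0); rewrite divff // div1.
by move: (v s f) (v s f^-1) => x y; lia.
Qed.

(** Since a prime is determined by its valuation, identities between automorphisms turn into
    identities between the maps that they induce on [S]. *)
Lemma div_separates s t : (forall f, f != 0 -> v s f = v t f) -> s = t.
Proof.
move=> st; have [|f f0 fE] := div_realize dt (n := fun r => (r == s)%:R) (t := [:: s]).
  by move=> r /=; rewrite inE; case: (r == s); rewrite ?eqxx.
by have := st f f0; rewrite !fE eqxx; case: eqP.
Qed.

Lemma div_involution (h : {rmorphism N -> N}) :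
    involutive h -> (forall x, B x -> B (h x)) ->
  exists ah : S -> S, forall s f, f != 0 -> v s (h f) = v (ah s) f.
Proof.
move=> hK hB; have [ah ahE] := div_act dt hK hB; exists ah => s f f0.
by rewrite -{2}[f]hK ahE // fmorph_eq0.
Qed.

Lemma div_ratio_unit f g : f != 0 -> g != 0 -> (forall s, v s f = v s g) ->
  unit_in B (f / g).
Proof.
move=> f0 g0 fg; apply/(div_unit dt); first by rewrite mulf_neq0 ?invr_eq0.
by move=> s; rewrite (divM dt) ?invr_eq0 // divV // fg subrr.
Qed.

End DivisorFacts.

(** * Divisors under a group of order eight *)

Definition norm4 (N : fieldType) (g1 g2 : N -> N) (f : N) : N :=
  f * g1 f * g2 f * g1 (g2 f).

Lemma addzz_eq0 (i : int) : i + i = 0 -> i = 0.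
Proof. lia. Qed.

(** Here [x], [y], [z] are orders at one prime and have the same parity. If they are odd, none
    vanishes and exactly one of the eight sign changes makes all three positive; if they are even,
    every indicator is 0. The sum is thus the parity of [x], which is the error made by rounding
    [x / 2] up to [n]. The eight terms stand in the order in which the norm of [e] expands: [norm4],
    then its image under [tau]. *)
Lemma octant_count (x y z q r : int) : x = y + q + q -> x = z + r + r ->
  let o (x y z : int) := Posz ([&& (x %% 2)%Z == 1, 0 < x, 0 < y & 0 < z] : nat) in
  let n := ((x + (x %% 2)%Z) %/ 2)%Z in
  n + n = x + (o x y z + o (- x) y z + o x (- y) z + o (- x) (- y) z +
    (o (- x) (- y) (- z) + o x (- y) (- z) + o (- x) y (- z) + o x y (- z))).
Proof.
move=> xy xz o n; have xN : (- x %% 2)%Z = (x %% 2)%Z by clear; lia.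
rewrite /o xN !oppr_gt0; case: eqP => /= [x1|x1]; last first.
  by rewrite /n; move: x1; clear; lia.
have y0 : 0 != y by move: xy x1; clear; lia.
have z0 : 0 != z by move: xz x1; clear; lia.
have x0 : 0 != x by move: x1; clear; lia.
have nE : n + n = x + 1 by rewrite /n; move: x1; clear; lia.
case: (ltrgtP 0 x) x0 => //= _ _; case: (ltrgtP 0 y) y0 => //= _ _;
  by case: (ltrgtP 0 z) z0.
Qed.

Section NormDecomposition.
Variables (N : fieldType) (B : N -> Prop) (S : choiceType) (v : S -> N -> int).
Hypothesis dt : divisor_theory B v.
Variables g1 g2 tau : {rmorphism N -> N}.
Hypotheses (g1K : involutive g1) (g2K : involutive g2) (tauK : involutive tau).
Hypotheses (g1B : forall x, B x -> B (g1 x)) (g2B : forall x, B x -> B (g2 x))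
  (tauB : forall x, B x -> B (tau x)).

(* Where the divisor of [X] is odd, so are those of [Y] and [Z]; the three
   signs there show that the group moves such primes freely, and [e] collects
   the primes of the positive octant. *)
Lemma norm_decomposition (X Y Z q r : N) : X != 0 -> Y != 0 -> Z != 0 ->
    X = Y * q ^+ 2 -> X = Z * r ^+ 2 ->
    g1 X = X^-1 -> g2 X = X -> tau X = X^-1 ->
    g1 Y = Y -> g2 Y = Y^-1 -> tau Y = Y^-1 ->
    g1 Z = Z -> g2 Z = Z -> tau Z = Z^-1 ->
  exists e p, [/\ e != 0, p != 0,
    unit_in B (p ^+ 2 / (X * (norm4 g1 g2 e * tau (norm4 g1 g2 e))))
    & unit_in B (tau p / (p / X))].
Proof.
move=> X0 Y0 Z0 XY XZ g1X g2X tX g1Y g2Y tY g1Z g2Z tZ.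
have q0 : q != 0 by apply: contra_neq X0 => q0; rewrite XY q0 expr0n mulr0.
have r0 : r != 0 by apply: contra_neq X0 => r0; rewrite XZ r0 expr0n mulr0.
have vXY s : v s X = v s Y + v s q + v s q.
  by rewrite {1}XY expr2 !(divM dt) ?mulf_neq0 // addrA.
have vXZ s : v s X = v s Z + v s r + v s r.
  by rewrite {1}XZ expr2 !(divM dt) ?mulf_neq0 // addrA.
have [a1 a1E] := div_involution dt g1K g1B; have [a2 a2E] := div_involution dt g2K g2B.
have [at_ atE] := div_involution dt tauK tauB.
have [lX lXE] := div_finite dt X0.
pose ne s : int := Posz ([&& (v s X %% 2)%Z == 1, 0 < v s X, 0 < v s Y & 0 < v s Z] : nat).
(* Half of [v s X], rounded up. At the image of [s] under [tau], where the order of [X] changes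
   sign, this becomes [np s - v s X], the order of [p / X] at [s]; hence the last conclusion. *)
pose np s : int := ((v s X + (v s X %% 2)%Z) %/ 2)%Z.
have [|e e0 eE] := div_realize dt (n := ne) (t := lX).
  move=> s nes; apply: lXE; apply: contra_neq nes => X0'; rewrite /ne X0' //.
have [|p p0 pE] := div_realize dt (n := np) (t := lX).
  by move=> s nps; apply: lXE; apply: contra_neq nps => X0'; rewrite /np X0'.
have fn0 (g : {rmorphism N -> N}) f : f != 0 -> g f != 0 by rewrite fmorph_eq0.
have n40 f : f != 0 -> norm4 g1 g2 f != 0 by move=> f0; rewrite !mulf_neq0 ?fn0.
have v4 s f : f != 0 -> v s (norm4 g1 g2 f) = v s f + v (a1 s) f + v (a2 s) f + v (a2 (a1 s)) f.
  by move=> f0; rewrite /norm4 !(divM dt) ?mulf_neq0 ?fn0 // a1E // a1E ?fn0 // !a2E.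
exists e, p; split=> //; apply: (div_ratio_unit dt).
- by rewrite expf_neq0.
- by rewrite !mulf_neq0 ?fn0 ?n40.
- have ne0 := n40 e e0.
  move=> s; rewrite expr2 (divM dt s p0 p0) (divM dt s X0) ?mulf_neq0 ?fn0 //.
  rewrite (divM dt s ne0) ?fn0 // atE // !v4 // !eE !pE.
  have E1X t : v (a1 t) X = - v t X by rewrite -a1E // g1X (divV dt).
  have E1Y t : v (a1 t) Y = v t Y by rewrite -a1E // g1Y.
  have E1Z t : v (a1 t) Z = v t Z by rewrite -a1E // g1Z.
  have E2X t : v (a2 t) X = v t X by rewrite -a2E // g2X.
  have E2Y t : v (a2 t) Y = - v t Y by rewrite -a2E // g2Y (divV dt).
  have E2Z t : v (a2 t) Z = v t Z by rewrite -a2E // g2Z.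
  have E3X t : v (at_ t) X = - v t X by rewrite -atE // tX (divV dt).
  have E3Y t : v (at_ t) Y = - v t Y by rewrite -atE // tY (divV dt).
  have E3Z t : v (at_ t) Z = - v t Z by rewrite -atE // tZ (divV dt).
  rewrite /ne /np !(E1X, E1Y, E1Z, E2X, E2Y, E2Z, E3X, E3Y, E3Z).
  by rewrite !opprK; apply: (octant_count (vXY s) (vXZ s)).
- exact: fn0.
- by rewrite mulf_neq0 ?invr_eq0.
- move=> s; rewrite atE // (divM dt) ?invr_eq0 // (divV dt) // !pE /np -atE // tX (divV dt) //.
  by move: (v s X) => {}x; clear; lia.
Qed.

End NormDecomposition.

(** * A parity contradiction among monomial units *)

Section MonomialUnits.
Variables (N : fieldType) (B C : N -> Prop) (S : choiceType) (v : S -> N -> int).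
Hypothesis dt : divisor_theory B v.
Variables g1 g2 tau sigma : {rmorphism N -> N}.
Hypotheses (g1K : involutive g1) (g2K : involutive g2) (tauK : involutive tau)
  (sigmaK : involutive sigma).
Hypotheses (g1B : forall x, B x -> B (g1 x)) (g2B : forall x, B x -> B (g2 x))
  (tauB : forall x, B x -> B (tau x)) (sigmaB : forall x, B x -> B (sigma x)).
Hypotheses (g1t : forall f, g1 (tau f) = tau (g1 f))
  (g2t : forall f, g2 (tau f) = tau (g2 f))
  (g1s : forall f, g1 (sigma f) = sigma (g1 f)) (g2s : forall f, g2 (sigma f) = sigma (g2 f))
  (ts : forall f, tau (sigma f) = sigma (tau f)).
Variables x y z : N.
Hypotheses (x0 : x != 0) (y0 : y != 0) (z0 : z != 0) (N2 : 2%:R != 0 :> N).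
Hypotheses (xU : unit_in B x) (CU : forall m, C m -> unit_in B m).
Hypotheses (C_neq0 : forall m, C m -> m != 0) (CN : forall m, C m -> C (- m))
  (CM : forall m m', C m -> C m' -> C (m * m')) (CV : forall m, C m -> C m^-1)
  (Cg1 : forall m, C m -> C (g1 m)) (Cg2 : forall m, C m -> C (g2 m))
  (Ct : forall m, C m -> C (tau m)) (Cs : forall m, C m -> sigma m = m).
Hypothesis unitE : forall u, unit_in B u ->
  exists m (i j k : int), C m /\ u = m * (x ^ i * y ^ j * z ^ k).
Hypothesis indep : forall m (i j k : int), C m -> m * (x ^ i * y ^ j * z ^ k) = 1 ->
  [/\ i = 0, j = 0 & k = 0].
Hypotheses (g1x : g1 x = x^-1) (g1y : g1 y = y) (g1z : g1 z = z).
Hypotheses (g2x : g2 x = x) (g2y : g2 y = y^-1) (g2z : g2 z = z).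
Hypotheses (tx : tau x = x^-1) (ty : tau y = y^-1) (tz : tau z = z^-1).
Hypotheses (sx : sigma x = - x) (sy : sigma y = - y) (sz : sigma z = - z).

(** Applying [sigma] twice gives [sigma u * u = 1], while [sigma] changes a monomial unit only by a
    sign. So [u ^ 2] is constant, the exponents of [u] vanish, and [u] is a constant; being fixed by
    [sigma], it satisfies [u ^ 2 = 1]. *)
Let sigma_unit_ratio f u : f != 0 -> unit_in B u -> sigma f = u * f -> u = 1 \/ u = -1.
Proof.
move=> f0 /unitE[m [i [j [k [Cm uE]]]]] sf.
have : sigma (sigma f) = f by [].
rewrite sf rmorphM /= sf mulrA => /(canRL (mulfK f0)); rewrite divff //.
have sgn (l : int) : (-1) ^ l = 1 :> N \/ (-1) ^ l = -1 :> N.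
  have H n : (-1) ^+ n = 1 :> N \/ (-1) ^+ n = -1 :> N.
    by rewrite -signr_odd; case: (odd n); rewrite ?expr0 ?expr1; auto.
  case: l => n; first exact: H.
  by rewrite NegzE -exprnN; case: (H n.+1) => ->; rewrite ?invrN invr1; auto.
have [e [eE e1]] : exists e, sigma u = e * u /\ (e = 1 \/ e = -1).
  exists ((-1) ^ i * (-1) ^ j * (-1) ^ k); split.
    rewrite uE !rmorphM /= Cs // !fmorphXz /= sx sy sz -[- x]mulN1r -[- y]mulN1r -[- z]mulN1r !expfzMl.
    by ring.
  by case: (sgn i) => ->; case: (sgn j) => ->; case: (sgn k) => ->; rewrite ?mulNr ?mulrN ?mulr1 ?opprK; auto.
rewrite eE => E; have Cem : C (e * m * m) by case: e1 => ->; rewrite ?mul1r ?mulN1r ?mulNr; auto.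
have [|i0 j0 k0] := indep (i := i + i) (j := j + j) (k := k + k) Cem.
  by rewrite !expfzDr // -E uE; ring.
have um : u = m by rewrite uE (addzz_eq0 i0) (addzz_eq0 j0) (addzz_eq0 k0) !expr0z !mulr1.
have su : sigma u = u by rewrite um Cs.
have e1' : e = 1 by apply: (mulIf (C_neq0 Cm)); rewrite -um -eE su mul1r.
have : u ^+ 2 == 1 by rewrite expr2 -E e1' mul1r.
by rewrite sqrf_eq1 => /orP[]/eqP; auto.
Qed.

(** Call a prime special ([S2]) if [tau] acts on it trivially or as [sigma] does. There the
    [sigma]-invariant [e] has equal orders at the prime and at its image under [tau], so the
    equation for [p ^ 2] can be halved and [p] has the order of [norm4 g1 g2 e]. At the other primes
    [tau] exchanges two disjoint [sigma]-orbits, and the [tau]-invariant divisor of [p] is a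
    [sigma]-invariant divisor plus its image under [tau]. This writes [p] as a unit [u] times
    [fa * tau fa * norm4 g1 g2 fb], with [fa] and [fb] of [sigma]-invariant divisor. *)
Lemma monomial_units_contradiction e p mu nu : e != 0 -> p != 0 ->
    sigma e = e -> sigma p = p -> C mu -> C nu ->
    p ^+ 2 = mu * (x ^+ 2 * (norm4 g1 g2 e * tau (norm4 g1 g2 e))) ->
    tau p = nu * (p / x ^+ 2) -> False.
Proof.
move=> e0 p0 se sp Cmu Cnu p2E tpE.
have [a1 a1E] := div_involution dt g1K g1B; have [a2 a2E] := div_involution dt g2K g2B.
have [at_ atE] := div_involution dt tauK tauB.
have [as_ asE] := div_involution dt sigmaK sigmaB.
have fn0 (g : {rmorphism N -> N}) f : f != 0 -> g f != 0 by rewrite fmorph_eq0.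
have n40 f : f != 0 -> norm4 g1 g2 f != 0 by move=> f0; rewrite !mulf_neq0 ?fn0.
have v4 s f : f != 0 -> v s (norm4 g1 g2 f) = v s f + v (a1 s) f + v (a2 s) f + v (a2 (a1 s)) f.
  by move=> f0; rewrite /norm4 !(divM dt) ?mulf_neq0 ?fn0 // a1E // a1E ?fn0 // !a2E.
have vU u s : unit_in B u -> u != 0 -> v s u = 0 by move=> uu u0; apply/(div_unit dt): s.
have vC m s : C m -> v s m = 0 by move=> Cm; apply: vU; auto.
have vx s : v s (x ^+ 2) = 0 by rewrite expr2 (divM dt) // !vU.
have mu0 := C_neq0 Cmu; have nu0 := C_neq0 Cnu.
have x20 : x ^+ 2 != 0 by rewrite expf_neq0.
have comm (g h : {rmorphism N -> N}) (a b : S -> S) :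
    (forall s f, f != 0 -> v s (g f) = v (a s) f) ->
    (forall s f, f != 0 -> v s (h f) = v (b s) f) ->
    (forall f, g (h f) = h (g f)) -> forall s, a (b s) = b (a s).
  move=> gE hE gh s; apply: (div_separates dt) => f f0.
  by rewrite -gE // -hE ?fn0 // -gh gE ?fn0 // hE.
have invol (g : {rmorphism N -> N}) (a : S -> S) : involutive g ->
    (forall s f, f != 0 -> v s (g f) = v (a s) f) -> forall s, a (a s) = s.
  by move=> gK gE s; apply: (div_separates dt) => f f0; rewrite -gE // -gE ?fn0 // gK.
have ats := comm _ _ _ _ atE asE ts; have a1s := comm _ _ _ _ a1E asE g1s.
have a2s := comm _ _ _ _ a2E asE g2s; have a1t := comm _ _ _ _ a1E atE g1t.
have a2t := comm _ _ _ _ a2E atE g2t.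
have ass := invol _ _ sigmaK asE; have att := invol _ _ tauK atE.
have es s : v (as_ s) e = v s e by rewrite -asE // se.
have ps s : v (as_ s) p = v s p by rewrite -asE // sp.
(* The factor [x ^ 2] in the equation for [tau p] is a unit here, so the divisor of [p] is invariant
   under [tau]. *)
have pt s : v (at_ s) p = v s p.
  by rewrite -atE // tpE !(divM dt) ?mulf_neq0 ?invr_eq0 // (divV dt) // vx vC // oppr0 addr0 add0r.
pose S2 s := (at_ s == s) || (at_ s == as_ s).
have injs : injective as_ by apply: can_inj ass.
have injt : injective at_ by apply: can_inj att.
have inj1 : injective a1 by apply: can_inj (invol _ _ g1K a1E).
have inj2 : injective a2 by apply: can_inj (invol _ _ g2K a2E).
have S2s s : S2 (as_ s) = S2 s by rewrite /S2 ats !(inj_eq injs).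
have S2t s : S2 (at_ s) = S2 s by rewrite /S2 -ats !(inj_eq injt).
have S21 s : S2 (a1 s) = S2 s by rewrite /S2 -a1t -a1s !(inj_eq inj1).
have S22 s : S2 (a2 s) = S2 s by rewrite /S2 -a2t -a2s !(inj_eq inj2).
have et s : S2 s -> v (at_ s) e = v s e by case/orP => /eqP ->.
have [le leE] := div_finite dt e0; have [lp lpE] := div_finite dt p0.
pose nb s := if S2 s then v s e else 0.
pose orb s := [:: s; as_ s; at_ s; at_ (as_ s)].
pose rp s := choose (mem (orb s)) s.
have rpP s : rp s \in orb s by apply: (chooseP (P := mem (orb s))); rewrite inE mem_head.
have orbE s t : (t \in orb s) = [|| t == s, t == as_ s, t == at_ s | t == at_ (as_ s)].
  by rewrite !inE.
have rp_eq s t : orb s =i orb t -> rp s = rp t.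
  move=> st; rewrite /rp (eq_choose (Q := mem (orb t))) //; apply: choose_id.
    by rewrite /= -st orbE eqxx.
  by rewrite /= orbE eqxx.
have rps s : rp (as_ s) = rp s.
  apply: rp_eq => t; rewrite !orbE ass.
  by case: (t == s); case: (t == as_ s); case: (t == at_ s); case: (t == at_ (as_ s)).
have rpt s : rp (at_ s) = rp s.
  apply: rp_eq => t; rewrite !orbE -ats !att.
  by case: (t == s); case: (t == as_ s); case: (t == at_ s); case: (t == at_ (as_ s)).
(* An orbit of nonspecial primes under [sigma] and [tau] consists of two [sigma]-orbits; [na] keeps
   the order of [p] on the one that contains the chosen prime [rp s]. *)
pose na s := if ~~ S2 s && ((rp s == s) || (rp s == as_ s)) then v s p else 0.
have [|fb fb0 fbE] := div_realize dt (n := nb) (t := le).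
  by move=> s; rewrite /nb; case: ifP => // _ /leE.
have [|fa fa0 faE] := div_realize dt (n := na) (t := lp).
  by move=> s; rewrite /na; case: ifP => // _ /lpE.
pose w := fa * tau fa * norm4 g1 g2 fb.
have w0 : w != 0 by rewrite !mulf_neq0 ?fn0 // n40.
have vpw s : v s p = v s w.
  rewrite /w (divM dt) ?mulf_neq0 ?fn0 // (divM dt s fa0) ?fn0 // atE // v4 // !faE !fbE.
  have ne0 := n40 e e0.
  have := congr1 (v s) p2E; rewrite expr2 (divM dt s p0 p0) (divM dt s mu0) ?mulf_neq0 ?fn0 //.
  rewrite (divM dt s x20) ?mulf_neq0 ?fn0 // (divM dt s ne0) ?fn0 // (vC mu s Cmu) vx !add0r atE // !v4 //.
  rewrite a1t !a2t /nb !S22 !S21 /na S2t; case: (boolP (S2 s)) => S2s_ /=.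
    rewrite !et ?S22 ?S21 // !add0r => /eqP; rewrite -subr_eq0 opprD addrACA => /eqP.
    by move/addzz_eq0/subr0_eq.
  move=> _; rewrite !addr0 rpt pt -ats.
  have := rpP s; rewrite orbE.
  have n1 : at_ s != s by apply: contraNneq S2s_ => E; rewrite /S2 E eqxx.
  have n2 : at_ s != as_ s by apply: contraNneq S2s_ => E; rewrite /S2 E eqxx orbT.
  have n3 : at_ (as_ s) != s by apply: contra_neq n2 => E; rewrite -{1}E att.
  have n4 : at_ (as_ s) != as_ s by apply: contra_neq n1; rewrite ats => /injs.
  case/or4P => /eqP ->; rewrite !eqxx ?orbT /=.
  - by rewrite ![s == _]eq_sym (negPf n1) (negPf n3) addr0.
  - by rewrite ![as_ s == _]eq_sym (negPf n2) (negPf n4) addr0.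
  - by rewrite (negPf n1) (negPf n2) add0r.
  - by rewrite (negPf n3) (negPf n4) add0r.
have /unitE[m [i [j [k [Cm uE]]]]] := div_ratio_unit dt p0 w0 vpw.
pose u := p / w; have u0 : u != 0 by rewrite mulf_neq0 ?invr_eq0.
have pE : p = u * w by rewrite /u mulfVK.
have sfa : sigma fa = fa \/ sigma fa = - fa.
  have uu : unit_in B (sigma fa / fa).
    apply: (div_ratio_unit dt); rewrite ?fn0 // => s.
    by rewrite asE // !faE /na S2s rps ass ps orbC.
  have [|E|E] := sigma_unit_ratio fa0 uu; rewrite ?mulfVK //; [left | right].
    by rewrite -[LHS](mulfVK fa0) E mul1r.
  by rewrite -[LHS](mulfVK fa0) E mulN1r.
have sfb : sigma fb = fb \/ sigma fb = - fb.
  have uu : unit_in B (sigma fb / fb).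
    apply: (div_ratio_unit dt); rewrite ?fn0 // => s.
    by rewrite asE // !fbE /nb S2s es.
  have [|E|E] := sigma_unit_ratio fb0 uu; rewrite ?mulfVK //; [left | right].
    by rewrite -[LHS](mulfVK fb0) E mul1r.
  by rewrite -[LHS](mulfVK fb0) E mulN1r.
(* The sign of [fa] occurs twice in [w] and the sign of [fb] four times, so they cancel. *)
have sw : sigma w = w.
  rewrite /w /norm4 !rmorphM /= -ts -!g1s -!g2s.
  by case: sfa => ->; case: sfb => ->; rewrite ?(rmorphN tau) ?(rmorphN g2) ?(rmorphN g1) /=; ring.
have su : sigma u = u by rewrite /u fmorph_div sw sp.
(* The divisor of [fb] lives on special primes, where [e] has the same order at [s] and at its image
   under [tau]; so [tau fb] differs from [fb] by a unit. *)
have /unitE[m' [r1 [r2 [r3 [Cm' rE]]]]] : unit_in B (tau fb / fb).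
  apply: (div_ratio_unit dt); rewrite ?fn0 // => s.
  by rewrite atE // !fbE /nb S2t; case: ifP => // /et.
have tfb : tau fb = m' * (x ^ r1 * y ^ r2 * z ^ r3) * fb by rewrite -rE mulfVK.
have n4M f g : norm4 g1 g2 (f * g) = norm4 g1 g2 f * norm4 g1 g2 g.
  by rewrite /norm4 (rmorphM g2) !(rmorphM g1); ring.
have n4t f : tau (norm4 g1 g2 f) = norm4 g1 g2 (tau f).
  by rewrite /norm4 !(rmorphM tau) -!g1t -!g2t.
(* The norm kills [x] and [y], which [g1] and [g2] respectively invert, and raises [z] to the fourth
   power: this is why the exponent of [z] in [u] comes out even. *)
have n4x r : norm4 g1 g2 (x ^ r) = 1.
  rewrite /norm4 (fmorphXz g2) g2x (fmorphXz g1) g1x exprz_inv -invr_expz.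
  by field; rewrite expfz_neq0.
have n4y r : norm4 g1 g2 (y ^ r) = 1.
  rewrite /norm4 (fmorphXz g2) g2y !exprz_inv -!invr_expz (fmorphV g1) (fmorphXz g1) g1y.
  by field; rewrite expfz_neq0.
have n4z r : norm4 g1 g2 (z ^ r) = (z ^ r) ^+ 4.
  by rewrite /norm4 (fmorphXz g2) g2z (fmorphXz g1) g1z; ring.
have tw : tau w = norm4 g1 g2 m' * (z ^ r3) ^+ 4 * w.
  rewrite /w (rmorphM tau (fa * tau fa)) (rmorphM tau fa) tauK n4t tfb !n4M n4x n4y n4z.
  by move: (norm4 g1 g2 m') (norm4 g1 g2 fb) => n n'; ring.
have tu : tau u = tau m * (x ^ i * y ^ j * z ^ k)^-1.
  rewrite {1}/u uE !rmorphM /= !fmorphXz /= tx ty tz !exprz_inv -!invr_expz.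
  by rewrite !invfM.
(* The equation for [tau p], divided by its right-hand side and written in monomials. Independence
   then gives [i = 1], [j = 0] and [k = 2 * r3], so that [sigma] negates [u]. *)
have E : tau m * norm4 g1 g2 m' / nu / m * (x ^ (2%:Z - i - i) * y ^ (- j - j) * z ^ (r3 * 4%:Z - k - k)) = 1.
  have m0 := C_neq0 Cm.
  have : tau p = tau u * tau w by rewrite {1}pE rmorphM.
  rewrite tpE tw tu {1}pE {1}/u uE !expfzDr // -!invr_expz -exprnP.
  rewrite -exprz_exp -[_ ^ 4%:Z]exprnP.
  have := expfz_neq0 i x0; have := expfz_neq0 j y0; have := expfz_neq0 k z0; have := expfz_neq0 r3 z0.
  move: (x ^ i) (y ^ j) (z ^ k) (z ^ r3) (tau m) (norm4 g1 g2 m') => xi yj zk zr tm nm zr0 zk0 yj0 xi0 E.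
  apply: (mulfI (_ : (nu * (m * (xi * yj * zk) * w / x ^+ 2)) != 0)).
    apply: mulf_neq0 => //; apply: mulf_neq0; last exact: invr_neq0.
    by apply: mulf_neq0 => //; apply: mulf_neq0 => //; rewrite !mulf_neq0.
  rewrite mulr1 [RHS]E; field; rewrite ?m0 ?nu0 ?x0 ?xi0 ?yj0 ?zk0 //.
have CC : C (tau m * norm4 g1 g2 m' / nu / m) by rewrite /norm4; auto 12.
have [i1 j1 k1] := indep CC E.
have su' : sigma u = - u.
  have -> : u = m * (x ^ i * y ^ j * z ^ k) by [].
  rewrite !rmorphM /= Cs // !fmorphXz /= sx sy sz.
  have -> : i = 1 by move: i1; clear; lia.
  have -> : j = 0 by move: j1; clear; lia.
  have -> : k = 2%:Z * r3 by move: k1; clear; lia.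
  by rewrite !expr1z !expr0z -!exprz_exp -![_ ^ 2%:Z]exprnP sqrrN; ring.
move/eqP: su'; rewrite su -addr_eq0 -mulr2n -mulr_natr mulf_eq0 (negPf u0) (negPf N2) //.
Qed.

End MonomialUnits.

(** * Algebraic dependence and transcendence bases *)

Section SubfieldType.
Variable L : fieldType.

Record subfield_pred := SubfieldPred {
  sfp_car :> L -> Prop; sfp_ax : is_subfield sfp_car }.

Variable E : subfield_pred.

Definition sfp_pred : {pred L} := fun x => `[< E x >].

Lemma sfp_divring : divring_closed sfp_pred.
Proof.
have [E1 Es Ed] := sfp_ax E.
by split; [exact/asboolP | move=> x y /asboolP Ex /asboolP Ey; apply/asboolP; auto ..].
Qed.

HB.instance Definition _ := GRing.isDivringClosed.Build L sfp_pred sfp_divring.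

Record sfp_type := SfpType { sfp_val : L; _ : sfp_val \in sfp_pred }.
HB.instance Definition _ := [isSub for sfp_val].
HB.instance Definition _ := [Choice of sfp_type by <:].
HB.instance Definition _ := [SubChoice_isSubIntegralDomain of sfp_type by <:].
HB.instance Definition _ := [SubIntegralDomain_isSubField of sfp_type by <:].

End SubfieldType.

Section Algebraicity.
Variable L : fieldType.
Implicit Types (E A : L -> Prop).

(** Replaces a predicate by the range of a morphism of fields, which makes the results about
    [algebraicOver] available. *)
Lemma subfield_type E : is_subfield E ->
  exists (F : fieldType) (f : {rmorphism F -> L}), forall x, E x <-> exists y, x = f y.
Proof.
move=> sE; pose F := sfp_type (SubfieldPred sE).
exists F, (val : {rmorphism F -> L}) => x; split=> [Ex|[y ->]].
  have Px : x \in sfp_pred (SubfieldPred sE) by apply/asboolP.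
  by exists (SfpType Px).
by have /asboolP := valP y.
Qed.

Lemma subfield0 E : is_subfield E -> E 0.
Proof. by case=> E1 Es _; rewrite -(subrr 1); apply: Es. Qed.

Lemma subfieldD E x y : is_subfield E -> E x -> E y -> E (x + y).
Proof.
move=> sE Ex Ey; have [E1 Es _] := sE; rewrite -[y]opprK; apply: (Es) => //.
by rewrite -sub0r; apply: Es => //; apply: subfield0.
Qed.

Lemma subfieldM E x y : is_subfield E -> E x -> E y -> E (x * y).
Proof.
move=> [E1 Es Ed] Ex Ey; rewrite -[y]invrK; apply: (Ed) => //.
by rewrite -[y^-1]mul1r; apply: Ed.
Qed.

Lemma subfieldV E x : is_subfield E -> E x -> E x^-1.
Proof. by move=> [E1 _ Ed] Ex; rewrite -[x^-1]mul1r; apply: Ed. Qed.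

Lemma subfieldN E x : is_subfield E -> E x -> E (- x).
Proof. by move=> sE Ex; rewrite -sub0r; case: (sE) => _ Es _; apply: Es => //; apply: subfield0. Qed.

Lemma subfieldX E x n : is_subfield E -> E x -> E (x ^+ n).
Proof.
move=> sE Ex; elim: n => [|n IH]; first by rewrite expr0; case: sE.
by rewrite exprS; apply: subfieldM.
Qed.

Lemma subfield_nat E n : is_subfield E -> E n%:R.
Proof.
move=> sE; elim: n => [|n IH]; first exact: subfield0.
by rewrite -addn1 natrD; apply: subfieldD => //; case: sE.
Qed.

Lemma range_subfield (F : fieldType) (f : {rmorphism F -> L}) :
  is_subfield (fun x => exists y, x = f y).
Proof.
split; first by exists 1; rewrite rmorph1.
  by move=> _ _ [x ->] [y ->]; exists (x - y); rewrite rmorphB.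
by move=> _ _ [x ->] [y ->]; exists (x / y); rewrite fmorph_div.
Qed.

Lemma preim_subfield (F : fieldType) (f : {rmorphism F -> L}) E :
  is_subfield E -> is_subfield (fun x => E (f x)).
Proof.
case=> E1 Es Ed; split; first by rewrite rmorph1.
  by move=> x y Ex Ey; rewrite rmorphB; apply: Es.
by move=> x y Ex Ey; rewrite fmorph_div; apply: Ed.
Qed.

Definition fractions (R : comNzRingType) (f : R -> L) : L -> Prop :=
  fun x => exists a b, f b != 0 /\ x = f a / f b.

Lemma fractions_subfield (R : comNzRingType) (f : {rmorphism R -> L}) :
  is_subfield (fractions f).
Proof.
split; first by exists 1, 1; rewrite rmorph1 divr1 oner_neq0.
  move=> _ _ [a [b [b0 ->]]] [c [d [d0 ->]]]; exists (a * d - c * b), (b * d).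
  by rewrite rmorphB !rmorphM mulf_neq0 //; split=> //; field; rewrite b0 d0.
move=> _ _ [a [b [b0 ->]]] [c [d [d0 ->]]]; have [c0|c0] := eqVneq (f c) 0.
  by exists 0, 1; rewrite rmorph0 rmorph1 oner_neq0 c0 mul0r invr0 mulr0 mul0r.
by exists (a * d), (b * c); rewrite !rmorphM mulf_neq0 // invf_div mulf_div.
Qed.

Lemma fractions_clear (R : comNzRingType) (f : {rmorphism R -> L}) (p : {poly L}) :
    (forall i, fractions f p`_i) ->
  exists d P, f d != 0 /\ f d *: p = map_poly f P.
Proof.
elim/poly_ind: p => [|p c IH] cp.
  by exists 1, 0; rewrite rmorph1 oner_neq0 rmorph0 scaler0.
have [|d [P [d0 E]]] := IH.
  by move=> i; have := cp i.+1; rewrite coefD coefMX coefC addr0.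
have [a [b [b0 cE]]] := cp 0%N; rewrite coefD coefMX coefC add0r /= in cE.
exists (d * b), (b%:P * P * 'X + (d * a)%:P); rewrite rmorphM mulf_neq0 //; split=> //.
rewrite rmorphD !rmorphM /= map_polyX !map_polyC /= -E scalerDr cE -!mul_polyC !rmorphM /=.
congr (_ + _); first by ring.
by rewrite -!polyCM; congr (_%:P); field.
Qed.

Definition algebraic_in E (x : L) : Prop :=
  exists p : {poly L}, [/\ p != 0, forall i, E p`_i & root p x].

Lemma algebraic_in_range (F : fieldType) (f : {rmorphism F -> L}) x :
  algebraic_in (fun y => exists z, y = f z) x <-> algebraicOver f x.
Proof.
split=> [[p [p0 cp px]]|[p p0 px]]; last first.
  exists (map_poly f p); split=> //; first by rewrite map_poly_eq0.
  by move=> i; exists p`_i; rewrite coef_map.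
have [|d [P [d0 E]]] := fractions_clear (f := f) (p := p).
  by move=> i; have [y ->] := cp i; exists y, 1; rewrite rmorph1 oner_neq0 divr1.
exists P; last by rewrite -E rootZ.
by rewrite -(map_poly_eq0 f) -E scaler_eq0 negb_or d0.
Qed.

Lemma algebraic_in_eq E A x : (forall y, E y -> A y) -> algebraic_in E x -> algebraic_in A x.
Proof. by move=> EA [p [p0 cp px]]; exists p; split=> // i; apply: EA. Qed.

Lemma algebraic_inE E : is_subfield E ->
  exists (F : fieldType) (f : {rmorphism F -> L}),
    (forall x, E x <-> exists y, x = f y) /\
    (forall x, algebraic_in E x <-> algebraicOver f x).
Proof.
move=> /subfield_type[F [f fE]]; exists F, f; split=> // x.
by rewrite -algebraic_in_range; split; apply: algebraic_in_eq => y; rewrite fE.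
Qed.

Lemma algebraic_in_id E x : is_subfield E -> E x -> algebraic_in E x.
Proof.
move=> sE Ex; exists ('X - x%:P); rewrite polyXsubC_eq0 root_XsubC eqxx; split=> // i.
rewrite coefB coefX coefC; have [_ Es _] := sE.
by apply: Es; [exact: subfield_nat | case: ifP => // _; apply: subfield0].
Qed.

Lemma algebraic_in_subfield E : is_subfield E -> is_subfield (algebraic_in E).
Proof.
move=> sE; have [F [f [_ fA]]] := algebraic_inE sE; split.
- by apply: algebraic_in_id => //; case: sE.
- by move=> x y; rewrite !fA; apply: algebraic_sub.
- by move=> x y; rewrite !fA; apply: algebraic_div.
Qed.

Lemma algebraic_in_trans E A x : is_subfield E ->
  (forall y, A y -> algebraic_in E y) -> algebraic_in A x -> algebraic_in E x.
Proof.
move=> sE AE [p [p0 cp px]]; have [F [f [_ fA]]] := algebraic_inE sE.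
apply/fA/integral_algebraic/(integral_root p0 px) => y /(nthP 0)[i _ <-].
by apply/integral_algebraic/fA/AE.
Qed.

Lemma algebraic_in_sqr E x : is_subfield E -> algebraic_in E (x ^+ 2) -> algebraic_in E x.
Proof.
move=> sE Ex2; have sA := algebraic_in_subfield sE.
apply: (algebraic_in_trans sE (A := algebraic_in E)) => //.
exists ('X^2 - (x ^+ 2)%:P); split; last by rewrite rootE !hornerE subrr.
  by rewrite -size_poly_gt0 size_XnsubC.
move=> i; rewrite coefB coefXn coefC; have [_ As _] := sA.
by apply: As; [exact: subfield_nat | case: ifP => // _; apply: subfield0].
Qed.

Definition adjoin E (us : seq L) : L -> Prop := fun x =>
  forall A, is_subfield A -> (forall y, E y -> A y) -> (forall u, u \in us -> A u) -> A x.

Lemma adjoin_subfield E us : is_subfield (adjoin E us).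
Proof.
split=> [A [] //|x y Ex Ey A sA EA uA|x y Ex Ey A sA EA uA].
  by have [_ As _] := sA; apply: As; [exact: Ex | exact: Ey].
by have [_ _ Ad] := sA; apply: Ad; [exact: Ex | exact: Ey].
Qed.

Lemma adjoin_base E us x : E x -> adjoin E us x.
Proof. by move=> Ex A _ EA _; apply: EA. Qed.

Lemma adjoin_mem E us x : x \in us -> adjoin E us x.
Proof. by move=> ux A _ _; apply. Qed.

Lemma adjoin_sub E A us : is_subfield A -> (forall y, E y -> A y) ->
  (forall u, u \in us -> A u) -> forall x, adjoin E us x -> A x.
Proof. by move=> sA EA uA x; apply. Qed.

(** A relation for [x] over [E(b)], cleared of denominators, is a polynomial in two variables over
    [E] that vanishes at [(b, x)]. Read as a polynomial in [b] over [E(x)] it is nonzero, since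
    otherwise its leading coefficient would be a relation for [x] over [E]. *)
Lemma algebraic_exchange E x b : is_subfield E -> algebraic_in (adjoin E [:: b]) x ->
  ~ algebraic_in E x -> algebraic_in (adjoin E [:: x]) b.
Proof.
move=> sE [p [p0 cp px]] nx; have [F [f [fE fA]]] := algebraic_inE sE.
pose ev y : {rmorphism {poly F} -> L} := (horner_eval y \o map_poly f : {rmorphism _ -> _}).
have cpf i : fractions (ev b) p`_i.
  apply: (adjoin_sub (fractions_subfield (ev b)) _ _ (cp i)) => [y /fE[z ->]|u].
    exists z%:P, 1; rewrite rmorph1 oner_neq0 divr1 /= map_polyC /horner_eval hornerC.
    by split.
  rewrite inE => /eqP ->; exists 'X, 1; rewrite rmorph1 oner_neq0 divr1 /= map_polyX.
  by rewrite /horner_eval hornerX.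
have [d [P [d0 PE]]] := fractions_clear cpf.
have P0 : P != 0.
  by apply: contraNneq p0 => P0; have /eqP := PE; rewrite P0 rmorph0 scaler_eq0 (negPf d0).
pose PL := map_poly (map_poly f) P.
have evE y (Q : {poly {poly F}}) : map_poly (ev y) Q = map_poly (horner_eval y) (map_poly (map_poly f) Q).
  by rewrite -map_poly_comp.
have ev2 y w (Q : {poly {poly L}}) : (map_poly (horner_eval y) Q).[w] = Q.[w, y].
  rewrite -[in RHS]/(horner_eval y _) -horner_map /= /horner_eval hornerC //.
have Pxb : (swapXY PL).[b, x] = 0.
  rewrite horner2_swapXY -ev2 -evE -PE hornerZ; move/rootP: px => ->; exact: mulr0.
pose g := map_poly (ev x) (swapXY P).
have gb : root g b by rewrite /root /g evE -swapXY_map ev2 Pxb.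
have [g0|g0] := eqVneq g 0.
  case: nx; apply/fA; have : swapXY P != 0 by rewrite swapXY_eq0.
  rewrite -lead_coef_eq0; set q := lead_coef _ => q0.
  exists q => //; rewrite rootE; have := congr1 (fun h : {poly L} => h`_(size (swapXY P)).-1) g0.
  by rewrite /g coef_map coef0 /= => /eqP.
exists g; split=> // i; rewrite coef_map /=; set h := (swapXY P)`_i.
rewrite /horner_eval horner_coef; elim/big_ind: _ => [||j _].
- exact: (subfield0 (adjoin_subfield _ _)).
- by move=> u w; apply: (subfieldD (adjoin_subfield _ _)).
apply: (subfieldM (adjoin_subfield _ _)).
  by apply: adjoin_base; apply/fE; rewrite coef_map; exists h`_j.
by apply: (subfieldX _ (adjoin_subfield _ _)); apply: adjoin_mem; rewrite mem_head.
Qed.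

(** Independence stated one element at a time, the form that suits the exchange argument;
    [triangular_indep_mpoly] relates it to polynomial relations. *)
Definition triangular_indep E (xs : seq L) : Prop := forall i, (i < size xs)%N ->
  ~ algebraic_in (adjoin E (take i xs)) xs`_i.

(** Induction on the size of [us]. The head [x] of [xs] becomes algebraic at some entry [u] of [us];
    by exchange [u] is algebraic over [x] and the remaining entries, so [u] is dropped and [E] is
    replaced by [E(x)], over which the tail of [xs] is still independent. *)
Lemma steinitz E (us xs : seq L) : is_subfield E -> (size us < size xs)%N ->
  (forall x, x \in xs -> algebraic_in (adjoin E us) x) -> ~ triangular_indep E xs.
Proof.
move: {2}(size us) (erefl (size us)) => m; elim: m E us xs => [|m IH] E us xs sus sE.
  rewrite (size0nil sus) => sxs cx ind; apply: (ind 0%N sxs).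
  rewrite take0; apply: cx; exact: mem_nth.
case: xs => // x xs; rewrite sus /= ltnS => sxs cx ind.
have nx : ~ algebraic_in E x.
  by move=> ax; apply: (ind 0%N isT); apply: algebraic_in_eq ax => y; apply: adjoin_base.
have [j [ju aj naj]] : exists j, [/\ (j < size us)%N,
    algebraic_in (adjoin E (take j.+1 us)) x & ~ algebraic_in (adjoin E (take j us)) x].
  have : algebraic_in (adjoin E (take (size us) us)) x by rewrite take_size; apply/cx/mem_head.
  elim: {1 3}(size us) (leqnn (size us)) => [|k IHk] ku.
    rewrite take0 => ax; case: nx; apply: algebraic_in_trans ax => // y ay.
    by apply: algebraic_in_id => //; apply: (adjoin_sub sE _ _ ay).
  have [ak _|nak ak] := pselect (algebraic_in (adjoin E (take k us)) x).
    by apply: IHk ak; apply: ltnW.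
  by exists k.
pose u := us`_j; pose us' := take j us ++ drop j.+1 us.
have usE : us = take j us ++ u :: drop j.+1 us by rewrite -drop_nth // cat_take_drop.
pose E' := adjoin E [:: x]; have sE' : is_subfield E' by apply: adjoin_subfield.
have au : algebraic_in (adjoin E' us') u.
  have : algebraic_in (adjoin (adjoin E (take j us)) [:: x]) u.
    apply: algebraic_exchange naj; first exact: adjoin_subfield.
    apply: algebraic_in_eq aj => y; apply: adjoin_sub; first exact: adjoin_subfield.
      by move=> z Ez; apply: adjoin_base; apply: adjoin_base.
    rewrite (take_nth 0) // => z; rewrite mem_rcons inE => /orP[/eqP->|zt].
      by apply: adjoin_mem; rewrite mem_head.
    by apply: adjoin_base; apply: adjoin_mem.
  apply: algebraic_in_eq => y; apply: adjoin_sub; first exact: adjoin_subfield.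
    move=> z; apply: adjoin_sub; first exact: adjoin_subfield.
      by move=> w Ew; apply: adjoin_base; apply: adjoin_base.
    by move=> w wt; apply: adjoin_mem; rewrite mem_cat wt.
  by move=> z zx; apply: adjoin_base; apply: adjoin_mem.
apply: (IH E' us' xs) => //.
- by rewrite size_cat size_take size_drop ju; move: ju sus; clear; lia.
- by rewrite size_cat size_take size_drop ju; move: ju sus sxs; clear; lia.
- move=> y yxs; apply: (@algebraic_in_trans _ (adjoin E us)); first exact: adjoin_subfield.
    apply: adjoin_sub; first by apply: algebraic_in_subfield; apply: adjoin_subfield.
      move=> z Ez; apply: algebraic_in_id; first exact: adjoin_subfield.
      by apply: adjoin_base; apply: adjoin_base.
    move=> z; rewrite usE mem_cat inE orbCA => /orP[/eqP->//|zu].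
    apply: algebraic_in_id; first exact: adjoin_subfield.
    by apply: adjoin_mem; rewrite mem_cat.
  by apply: cx; rewrite inE yxs orbT.
move=> i ixs ai; apply: (ind i.+1 ixs); apply: algebraic_in_eq ai => y /=.
apply: adjoin_sub; first exact: adjoin_subfield.
  apply: adjoin_sub; first exact: adjoin_subfield.
    by move=> z Ez; apply: adjoin_base.
  by move=> z; rewrite inE => /eqP->; apply: adjoin_mem; rewrite mem_head.
by move=> z zt; apply: adjoin_mem; rewrite inE zt orbT.
Qed.

End Algebraicity.

Section TriangularIndependence.
Variable L : fieldType.
Implicit Types (E A : L -> Prop).

Lemma algebraic_in_adjoin_trans E us vs x :
    (forall u, u \in us -> algebraic_in (adjoin E vs) u) ->
  algebraic_in (adjoin E us) x -> algebraic_in (adjoin E vs) x.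
Proof.
move=> au; have sv := adjoin_subfield E vs; apply: (algebraic_in_trans sv).
apply: adjoin_sub; [exact: algebraic_in_subfield | | exact: au].
by move=> y Ey; apply: (algebraic_in_id sv); apply: adjoin_base.
Qed.

(** A dependent entry of [us] could be dropped, and all of [xs] would still be algebraic over the
    remaining ones, which are too few by [steinitz]. *)
Lemma triangular_indep_basis E (us xs : seq L) : is_subfield E ->
    triangular_indep E xs -> size us = size xs ->
    (forall x, x \in xs -> algebraic_in (adjoin E us) x) -> triangular_indep E us.
Proof.
move=> sE ind suE cx i iu ai; pose us' := take i us ++ drop i.+1 us.
apply: (@steinitz _ E us' xs) => //.
  by rewrite -suE size_cat size_take size_drop iu; move: iu; clear; lia.
move=> x /cx; apply: algebraic_in_adjoin_trans => u.
rewrite -{1}(cat_take_drop i us) (drop_nth 0) // mem_cat inE orbCA => /orP[/eqP->|uu].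
  apply: algebraic_in_eq ai; apply: adjoin_sub; first exact: adjoin_subfield.
    by move=> y Ey; apply: adjoin_base.
  by move=> y yt; apply: adjoin_mem; rewrite mem_cat yt.
by apply: (algebraic_in_id (adjoin_subfield _ _)); apply: adjoin_mem; rewrite mem_cat.
Qed.

(** The definition depends on the order, so [vs] is first completed to a rearrangement [ws] of [us]
    of which it is a prefix; rearrangements are independent by [triangular_indep_basis]. *)
Lemma triangular_indep_sub E (us vs : seq L) : is_subfield E ->
    triangular_indep E us -> uniq vs -> {subset vs <= us} -> triangular_indep E vs.
Proof.
move=> sE ind uvs vus.
have uus : uniq us.
  apply/(uniqP 0) => i j; rewrite !inE => iu ju eij.
  wlog ltij : i j iu ju eij / (i < j)%N.
    by move=> W; case: (ltngtP i j) => // ?; [exact: W | apply/esym; exact: W].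
  case: (ind j ju); apply: (algebraic_in_id (adjoin_subfield _ _)).
  by apply: adjoin_mem; rewrite -eij -(nth_take 0 ltij) mem_nth // size_take ju.
pose ws := vs ++ [seq u <- us | u \notin vs].
have wsE : perm_eq ws us.
  apply: uniq_perm => //.
    rewrite cat_uniq uvs filter_uniq // andbT; apply/hasPn => y; rewrite mem_filter.
    by case/andP.
  move=> y; rewrite mem_cat mem_filter; by case: (boolP (y \in vs)) => //= /vus ->.
have indw : triangular_indep E ws.
  apply: (triangular_indep_basis sE ind); first by rewrite (perm_size wsE).
  move=> x xu; apply: (algebraic_in_id (adjoin_subfield _ _)); apply: adjoin_mem.
  by rewrite (perm_mem wsE).
move=> i iv; have := indw i; rewrite size_cat nth_cat iv takel_cat ?(ltnW iv) //.
by apply; apply: leq_trans iv _; apply: leq_addr.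
Qed.

Variables (K : fieldType) (iota : {rmorphism K -> L}).
Local Notation rK := (fun x : L => exists k, x = iota k).

Lemma mmap_poly_to_mpoly n (s : 'I_n.+1 -> L) (P : {poly {mpoly K[n]}}) :
  mmap iota s (poly_to_mpoly K n P) =
  (map_poly (mmap iota (fun i => s (widen_ord (leqnSn n) i))) P).[s ord_max].
Proof.
elim/poly_ind: P => [|P c IH]; first by rewrite !rmorph0 horner0.
rewrite (rmorphD (poly_to_mpoly K n)) (rmorphM (poly_to_mpoly K n)).
have hD (p q : {mpoly K[n.+1]}) : mmap iota s (p + q) = mmap iota s p + mmap iota s q by exact: rmorphD.
have hM (p q : {mpoly K[n.+1]}) : mmap iota s (p * q) = mmap iota s p * mmap iota s q by exact: rmorphM.
rewrite hD hM IH.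
rewrite [map_poly _ (_ + _)]rmorphD /= [map_poly _ (_ * _)]rmorphM hornerD hornerM /= !map_polyX !map_polyC /= /horner_eval !hornerX !hornerC.
rewrite mmapX mmap1U; congr (_ + _).
apply: (@mpoly_rmorph_ext _ _ _ (mmap iota s \o @mwiden n K)
  (mmap iota (fun i => s (widen_ord (leqnSn n) i)))) => [k|i] /=.
  by rewrite mwidenC !mmapC.
by rewrite mwidenX mnmwiden1 !mmapX !mmap1U.
Qed.

Lemma mmap_fractions n (s : 'I_n -> L) (us : seq L) x :
    (forall u, u \in us -> exists i, u = s i) -> adjoin rK us x ->
  fractions (mmap iota s : {mpoly K[n]} -> L) x.
Proof.
move=> us_s; apply: adjoin_sub; first exact: (fractions_subfield (mmap iota s)).
  by move=> _ [k ->]; exists k%:MP, 1; rewrite rmorph1 oner_neq0 divr1 mmapC.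
move=> u /us_s[i ->]; exists 'X_i, 1.
by rewrite rmorph1 oner_neq0 divr1 mmapX mmap1U.
Qed.

Lemma mmap_in_adjoin n (us : seq L) (p : {mpoly K[n]}) : (n <= size us)%N ->
  adjoin rK us (mmap iota (fun i : 'I_n => us`_i) p).
Proof.
move=> nu; have sA := adjoin_subfield rK us.
rewrite /mmap; elim/big_ind: _ => [||m _]; [exact: (subfield0 sA) | by move=> x y; apply: (subfieldD sA) |].
apply: (subfieldM sA); first by apply: adjoin_base; exists p@_m.
rewrite /mmap1; elim/big_ind: _ => [||i _]; [by case: sA | by move=> x y; apply: (subfieldM sA) |].
apply: (subfieldX _ sA); apply: adjoin_mem; apply: mem_nth.
exact: leq_trans (ltn_ord i) nu.
Qed.

Lemma triangular_indep_rcons E us u : triangular_indep E (rcons us u) <->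
  triangular_indep E us /\ ~ algebraic_in (adjoin E us) u.
Proof.
split=> [ind|[ind nu] i].
  split=> [i iu|].
    have := ind i; rewrite size_rcons nth_rcons iu -cats1 takel_cat ?(ltnW iu) //.
    by apply; apply: ltnW.
  by have := ind (size us); rewrite size_rcons nth_rcons ltnn eqxx -cats1 take_size_cat //; apply.
rewrite size_rcons ltnS leq_eqVlt => /predU1P[->|iu].
  by rewrite nth_rcons ltnn eqxx -cats1 take_size_cat.
by rewrite nth_rcons iu -cats1 takel_cat ?(ltnW iu) //; apply: ind.
Qed.

(** Induction on [n], reading a polynomial in [n.+1] variables as a polynomial in the last one.
    Conversely a relation for the last entry over the field of the others becomes polynomial once
    its denominators are cleared. *)
Lemma triangular_indep_mpoly n (us : seq L) : size us = n ->
  triangular_indep rK us <->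
  forall p : {mpoly K[n]}, mmap iota (fun i : 'I_n => us`_i) p = 0 -> p = 0.
Proof.
elim: n us => [|n IH] us sus.
  split=> [_ p|_ i]; last by rewrite sus.
  have -> : p = (p@_0)%:MP.
    by apply/mpolyP => m; rewrite mcoeffC (_ : m = 0%MM) ?eqxx ?mulr1 //; apply/mnmP; case.
  by rewrite mmapC => /eqP; rewrite fmorph_eq0 => /eqP ->.
case/lastP: us sus => // us u; rewrite size_rcons => -[sus].
have sE : (fun i : 'I_n => (rcons us u)`_(widen_ord (leqnSn n) i)) = (fun i : 'I_n => us`_i).
  by apply: funext => i; rewrite nth_rcons /= sus ltn_ord.
have uE : (rcons us u)`_(@ord_max n) = u by rewrite nth_rcons /= sus ltnn eqxx.
rewrite triangular_indep_rcons (IH us sus); split=> [[ind nu] p|ind]; last split.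
- rewrite -(poly_to_mpolyK p) mmap_poly_to_mpoly sE uE; move: (muni p) => P P0.
  suff -> : P = 0 by rewrite rmorph0.
  apply/eqP/contraT => nP; case: nu.
  exists (map_poly (mmap iota (fun i : 'I_n => us`_i)) P); split; last exact/eqP.
    apply: contra_neq nP => E; apply/polyP => i; rewrite coef0; apply: ind.
    by have := congr1 (fun q : {poly L} => q`_i) E; rewrite coef_map coef0.
  by move=> i; rewrite coef_map; apply: mmap_in_adjoin; rewrite sus.
- move=> p p0; have : poly_to_mpoly K n p%:P = 0.
    by apply: ind; rewrite mmap_poly_to_mpoly map_polyC hornerC /= sE.
  by move/(congr1 (@muni n K)); rewrite muniK rmorph0 => /eqP; rewrite polyC_eq0 => /eqP.
move=> [p [p0 cp pu]].
have [|d [P [d0 E]]] := fractions_clear (f := mmap iota (fun i : 'I_n => us`_i)) (p := p).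
  move=> i; apply: mmap_fractions (cp i) => w /(nthP 0)[j ju <-].
  by rewrite sus in ju; exists (Ordinal ju).
case/eqP: p0; have P0 : poly_to_mpoly K n P = 0.
  by apply: ind; rewrite mmap_poly_to_mpoly sE uE -E hornerZ (rootP pu) mulr0.
move/(congr1 (@muni n K)): P0; rewrite muniK rmorph0 => P0.
by move/eqP: E; rewrite P0 rmorph0 scaler_eq0 (negPf d0) => /eqP.
Qed.

Lemma triangular_algebraically_independent (us : seq L) :
  triangular_indep rK us -> algebraically_independent iota (fun y => y \in us).
Proof.
move=> ind n s s_inj sus p; pose vs := [seq s i | i <- enum 'I_n].
have svs : size vs = n by rewrite size_map size_enum_ord.
have sE : s = fun i : 'I_n => vs`_i.
  by apply: funext => i; rewrite (nth_map i) ?size_enum_ord // nth_ord_enum.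
suff : forall q : {mpoly K[n]}, mmap iota (fun i : 'I_n => vs`_i) q = 0 -> q = 0.
  by rewrite -sE; apply.
apply/triangular_indep_mpoly => //.
apply: (triangular_indep_sub (range_subfield iota) ind).
  by rewrite map_inj_uniq ?enum_uniq.
by move=> _ /mapP[i _ ->].
Qed.

Lemma adjoin_generated us x :
  adjoin rK us x <-> generated_subfield iota (fun y => y \in us) x.
Proof.
split=> [ax E sE KE uE|gx E sE KE uE].
  by apply: ax => // _ [k ->].
by apply: gx => // k; apply: KE; exists k.
Qed.

End TriangularIndependence.

Lemma ratX_triangular (K : fieldType) n :
  triangular_indep (fun x => exists k, x = ratC K n k) [seq ratX K i | i <- enum 'I_n].
Proof.
apply/(@triangular_indep_mpoly _ _ (ratC K n) n); first by rewrite size_map size_enum_ord.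
have -> : (fun i : 'I_n => [seq ratX K i | i <- enum 'I_n]`_i) = @ratX K n.
  by apply: funext => i; rewrite (nth_map i) ?size_enum_ord // nth_ord_enum.
move=> p pE; apply/eqP; rewrite -tofrac_eq0 -pE; apply/eqP.
apply: (@mpoly_rmorph_ext _ _ _ (@FracField.tofrac {mpoly K[n]}) (mmap (ratC K n) (@ratX K n))) => [c|i].
  by rewrite [RHS]mmapC.
by rewrite [RHS]mmapX mmap1U.
Qed.

(** By transcendence degree, [n] elements over which the [n] variables are algebraic are
    independent. Every system of generators chosen below is proved independent in this way. *)
Lemma ratfun_triangular (K : fieldType) n (us : seq (ratfun K n)) : size us = n ->
    (forall i, algebraic_in (adjoin (fun x => exists k, x = ratC K n k) us) (ratX K i)) ->
  triangular_indep (fun x => exists k, x = ratC K n k) us.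
Proof.
move=> sus aX; apply: (triangular_indep_basis (range_subfield _) (@ratX_triangular K n)).
  by rewrite size_map size_enum_ord.
by move=> _ /mapP[i _ ->].
Qed.

Section FieldIdentities.
Variable F : fieldType.
Implicit Types a b c p q r : F.

Lemma mul_div_eq a b c p q r r' : a != 0 -> b != 0 -> c != 0 ->
  p / a * (q / b) = r / c * r' -> c * (p * q) = a * b * r * r'.
Proof.
move=> a0 b0 c0 E.
transitivity (c * (a * b) * (p / a * (q / b))); first by field; rewrite a0 b0.
by rewrite E; field.
Qed.

Lemma div_mul_eq1 a b p q : a != 0 -> b != 0 -> q / b * (p / a) = 1 -> p * q = a * b.
Proof.
move=> a0 b0 E; transitivity (a * b * (q / b * (p / a))); last by rewrite E mulr1.
by field; rewrite a0 b0.
Qed.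

Lemma mul_divK a p q : a != 0 -> a * q * (p / a) = q * p.
Proof. by move=> a0; field. Qed.

End FieldIdentities.

(** * Divisors and units of polynomial and Laurent rings *)

Section PolynomialRing.
Variables (M : fieldType) (n : nat).
Local Notation N := (ratfun M n).
Local Notation toF := (@FracField.tofrac {mpoly M[n]}).

Lemma mpolyX_neq0 (m : 'X_{1..n}) : 'X_[m] != 0 :> {mpoly M[n]}.
Proof.
apply/eqP => /(congr1 (mcoeff m)) /eqP.
by rewrite mcoeffX eqxx mcoeff0 oner_eq0.
Qed.

Definition polynomials : N -> Prop := fun y => exists p, y = toF p.

Lemma mpoly_mul_const (p q : {mpoly M[n]}) c : c != 0 -> p * q = c%:MP ->
  exists2 d, d != 0 & p = d%:MP.
Proof.
move=> c0 pq; have pq0 : p * q != 0 by rewrite pq mpolyC_eq0.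
move: (pq0); rewrite mulf_eq0 negb_or => /andP[p0 q0].
apply/msize_poly1P; have := msizeM p0 q0; rewrite pq msizeC c0 /=.
have sp : (0 < msize p)%N by rewrite lt0n msize_poly_eq0.
have sq : (0 < msize q)%N by rewrite lt0n msize_poly_eq0.
by move: sp sq; move: (msize p) (msize q) => a b; clear; lia.
Qed.

Lemma polynomials_divisors : exists (S : choiceType) (v : S -> N -> int),
  divisor_theory polynomials v.
Proof.
apply: divisor_theory_of_factorial.
- by exists 0; rewrite rmorph0.
- by exists 1; rewrite rmorph1.
- by move=> _ _ [p ->] [q ->]; exists (p * q); rewrite rmorphM.
- move=> f; have [p [q [q0 ->]]] := fraction_numden f.
  by exists (toF p), (toF q); rewrite tofrac_eq0; split=> //; [exists p | exists q].
- apply: (@factorial_range _ _ toF); last exact: mpoly_factorial.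
  by move=> x /eqP; rewrite tofrac_eq0 => /eqP.
Qed.

Lemma polynomials_unit u : unit_in polynomials u -> exists2 m, m != 0 & u = ratC M n m.
Proof.
move=> [[p ->] [_ [q ->]]]; rewrite -rmorphM -(rmorph1 toF) => /eqP.
rewrite tofrac_eq mulrC => /eqP pq.
by have [d d0 ->] := mpoly_mul_const (oner_neq0 M) pq; exists d.
Qed.

Definition laurent : N -> Prop := fun y => exists m p, toF 'X_[m] * y = toF p.

Lemma mon_neq0 m : toF 'X_[m] != 0.
Proof. by rewrite tofrac_eq0 mpolyX_neq0. Qed.

Lemma laurentP y : laurent y -> exists m p, y = toF p / toF 'X_[m].
Proof.
by move=> [m [p E]]; exists m, p; rewrite -E mulrAC divff ?mul1r ?mon_neq0.
Qed.

Lemma laurent_poly p : laurent (toF p).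
Proof. by exists 0%MM, p; rewrite mpolyX0 rmorph1 mul1r. Qed.

Lemma laurentM y z : laurent y -> laurent z -> laurent (y * z).
Proof.
move=> [m [p E]] [m' [q E']]; exists (m + m')%MM, (p * q).
by rewrite mpolyXD !tofracM -E -E'; ring.
Qed.

Lemma laurentD y z : laurent y -> laurent z -> laurent (y + z).
Proof.
move=> [m [p E]] [m' [q E']]; exists (m + m')%MM, ('X_[m'] * p + 'X_[m] * q).
by rewrite mpolyXD tofracD !tofracM -E -E'; ring.
Qed.

Lemma laurent_monV m : laurent (toF 'X_[m])^-1.
Proof. by exists m, 1; rewrite divff ?mon_neq0 ?rmorph1. Qed.

(** Localization of the polynomial ring at its variables: a prime that divides a monomial becomes a
    unit, and any other stays prime because it cannot divide the monomials that clear
    denominators. *)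
Lemma laurent_factorial : factorial_ring laurent.
Proof.
have B1 : laurent 1 by rewrite -(rmorph1 toF); apply: laurent_poly.
have primeL q : prime_in (fun _ => True) q -> unit_in laurent (toF q) \/ prime_in laurent (toF q).
  move=> [_ q0 nq qP].
  have [[m [c _ E]]|nm] := pselect (exists m, dvd_in (fun _ => True) q 'X_[m]).
    left; split; first exact: laurent_poly.
    exists (toF c / toF 'X_[m]); first by apply: laurentM; [exact: laurent_poly | exact: laurent_monV].
    by rewrite mulrAC -tofracM -E divff ?mon_neq0.
  right; split; [exact: laurent_poly | by rewrite tofrac_eq0 | |].
    move=> [_ [w /laurentP[m [p ->]]]]; rewrite mulrAC -tofracM => E.
    apply: nm; exists m, p => //; apply/eqP; rewrite -tofrac_eq eq_sym; apply/eqP.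
    by apply: (mulIf (invr_neq0 (mon_neq0 m))); rewrite E divff ?mon_neq0.
  have dE y m p c : y = toF p / toF 'X_[m] -> p = c * q -> dvd_in laurent (toF q) y.
    move=> -> ->; exists (toF c / toF 'X_[m]); last by rewrite tofracM; ring.
    by apply: laurentM; [exact: laurent_poly | exact: laurent_monV].
  move=> y z /laurentP[m [p yE]] /laurentP[m' [p' zE]] [w /laurentP[k [r wE]] E].
  have mq m0 p0 : dvd_in (fun _ => True) q ('X_[m0] * p0) -> dvd_in (fun _ => True) q p0.
    by move=> /qP[//|//|dm|//]; case: nm; exists m0.
  have : dvd_in (fun _ => True) q (p * p').
    apply: (mq k); exists ('X_[m + m'] * r) => //; apply/eqP; rewrite -tofrac_eq.
    move: E; rewrite yE zE wE mpolyXD !tofracM => E; apply/eqP.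
    by apply: mul_div_eq E; apply: mon_neq0.
  by case/qP => // -[c _ cE]; [left; apply: dE yE cE | right; apply: dE zE cE].
move=> y /laurentP[m [p ->]] y0.
have p0 : p != 0 by apply: contra_neq y0 => ->; rewrite rmorph0 mul0r.
have [u [s [[_ [w _ wu]] ps ->]]] := mpoly_factorial (n := n) I p0.
have U1 : unit_in laurent (toF u / toF 'X_[m]).
  split; first by apply: laurentM; [exact: laurent_poly | exact: laurent_monV].
  exists (toF 'X_[m] * toF w); first by apply: laurentM; exact: laurent_poly.
  transitivity (toF (w * u)); last by rewrite wu rmorph1.
  by rewrite tofracM; apply/mul_divK/mon_neq0.
rewrite tofracM rmorph_prod mulrAC.
elim: s ps (toF u / toF 'X_[m]) U1 => [|q s IH] ps v uv.
  by exists v, [::]; rewrite !big_nil.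
have ps' r : r \in s -> prime_in (fun _ => True) r by move=> sr; apply: ps; rewrite inE sr orbT.
rewrite big_cons; case: (primeL q (ps q (mem_head _ _))) => [uq|pq].
  by rewrite mulrA; apply: IH => //; apply: (unit_inM laurentM).
have [v' [t [uv' pt E]]] := IH ps' v uv.
exists v', (toF q :: t); split; first exact: uv'.
  by move=> r; rewrite inE => /predU1P[->|/pt].
by rewrite big_cons mulrCA E mulrCA.
Qed.

Lemma laurent_divisors : exists (S : choiceType) (v : S -> N -> int),
  divisor_theory laurent v.
Proof.
apply: divisor_theory_of_factorial.
- by rewrite -(rmorph0 toF); apply: laurent_poly.
- by rewrite -(rmorph1 toF); apply: laurent_poly.
- exact: laurentM.
- move=> f; have [p [q [q0 ->]]] := fraction_numden f.
  by exists (toF p), (toF q); rewrite tofrac_eq0; split=> //; apply: laurent_poly.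
- exact: laurent_factorial.
Qed.

(** Setting ['X_i] to 0 is a ring morphism whose kernel consists of the multiples of ['X_i]; as its
    target is a domain, ['X_i] is prime, which is [var_dvd_mul]. *)
Lemma var_zero_decomposition i (p : {mpoly M[n]}) : exists q,
  p = mmap (@mpolyC n M) (fun j => if j == i then 0 else 'X_j) p + 'X_i * q.
Proof.
pose phi : {rmorphism {mpoly M[n]} -> {mpoly M[n]}} :=
  mmap (@mpolyC n M) (fun j => if j == i then 0 else 'X_j).
suff H : forall p, exists q, p = phi p + 'X_i * q by exact: H.
elim/mpolyind=> [|c m {}p _ _ [q pE]]; first by exists 0; rewrite rmorph0 mulr0 addr0.
suff [r rE] : exists r, 'X_[m] = phi 'X_[m] + 'X_i * r.
  exists (c *: r + q); rewrite {1}pE {1}rE rmorphD -!mul_mpolyC rmorphM.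
  have -> : phi c%:MP = c%:MP by apply: mmapC.
  by ring.
have -> : phi 'X_[m] = \prod_(j < n) (if j == i then 0 else 'X_j) ^+ m j by exact: mmapX.
have [mi|mi] := posnP (m i).
  exists 0; rewrite mulr0 addr0 mpolyXE_id; apply: eq_bigr => j _.
  by case: eqP => // ->; rewrite mi !expr0.
exists 'X_[m - U_(i)]; rewrite -mpolyXD addmC submK ?lep1mP -?lt0n //.
rewrite (bigD1 i) //= eqxx expr0n.
by rewrite (negPf (lt0n_neq0 mi)) mul0r add0r.
Qed.

Lemma var_dvd_mul i (p q r : {mpoly M[n]}) : p * q = 'X_i * r ->
  (exists p', p = 'X_i * p') \/ (exists q', q = 'X_i * q').
Proof.
move=> E; have [p' pE] := var_zero_decomposition i p.
have [q' qE] := var_zero_decomposition i q.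
pose phi : {rmorphism _ -> _} := mmap (@mpolyC n M) (fun j => if j == i then 0 else 'X_j).
have /eqP : phi p * phi q = 0.
  rewrite -rmorphM E rmorphM; have -> : phi 'X_i = 0 by rewrite [LHS]mmapX mmap1U eqxx.
  by rewrite mul0r.
rewrite mulf_eq0 => /orP[]/eqP E0; [left; exists p' | right; exists q'].
  by rewrite {1}pE -/(phi p) E0 add0r.
by rewrite {1}qE -/(phi q) E0 add0r.
Qed.

Lemma mul_eq_monomial (p q : {mpoly M[n]}) m c : c != 0 -> p * q = c%:MP * 'X_[m] ->
  exists d k, d != 0 /\ p = d%:MP * 'X_[k].
Proof.
move=> c0; move: {2}(mdeg m) (erefl (mdeg m)) => l.
elim: l m p q => [|l IH] m p q lE.
  move/eqP: lE; rewrite mdeg_eq0 => /eqP ->; rewrite mpolyX0 mulr1.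
  by move/(mpoly_mul_const c0) => [d d0 ->]; exists d, 0%MM; rewrite mpolyX0 mulr1.
have [i mi] : exists i, (0 < m i)%N.
  apply/existsP; apply: contraT; rewrite negb_exists => /forallP m0.
  suff m00 : m = 0%MM by rewrite m00 mdeg0 in lE.
  by apply/mnmP => i; apply/eqP; rewrite mnm0E -leqn0 leqNgt; apply: m0.
have mE : m = (U_(i) + (m - U_(i)))%MM by rewrite addmC submK // lep1mP -lt0n.
have dE : mdeg (m - U_(i)) = l by move: lE; rewrite {1}mE mdegD mdeg1 add1n => -[].
have X0 : 'X_i != 0 :> {mpoly M[n]} by exact: mpolyX_neq0.
rewrite mE mpolyXD mulrCA => E; case: (var_dvd_mul E) => -[r rE].
  have [|d [k [d0 kE]]] := IH _ r q dE.
    by apply: (mulfI X0); rewrite -E rE mulrA.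
  by exists d, (U_(i) + k)%MM; rewrite mpolyXD rE kE; split=> //; ring.
apply: (IH _ p r dE); apply: (mulfI X0); rewrite -E rE; ring.
Qed.

Lemma laurent_unit u : unit_in laurent u ->
  exists m k k', m != 0 /\ u = ratC M n m * (toF 'X_[k] / toF 'X_[k']).
Proof.
move=> [/laurentP[m [p ->]] [_ /laurentP[m' [q ->]]]] E.
have : p * q = 1%:MP * 'X_[m + m'].
  apply/eqP; rewrite -tofrac_eq mul1r mpolyXD !tofracM; apply/eqP.
  by apply: div_mul_eq1 E; apply: mon_neq0.
move/(mul_eq_monomial (oner_neq0 M)) => [d [k [d0 ->]]].
by exists d, k, m; split=> //; rewrite tofracM mulrA.
Qed.

Lemma laurent_stable (h : {rmorphism N -> N}) : (forall c, exists d, h (ratC M n c) = ratC M n d) ->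
    (forall i, laurent (h (ratX M i)) /\ laurent (h (ratX M i))^-1) ->
  forall y, laurent y -> laurent (h y).
Proof.
move=> hC hX.
have B1 : laurent 1 by rewrite -(rmorph1 toF); apply: laurent_poly.
have hm m : laurent (h (toF 'X_[m])) /\ laurent (h (toF 'X_[m]))^-1.
  rewrite mpolyXE_id !rmorph_prod -prodfV.
  split; elim/big_ind: _ => [||i _]; try by [| exact: laurentM].
    rewrite !rmorphXn; elim: (m i) => [|e IH]; first by rewrite expr0.
    by rewrite exprS; apply: laurentM => //; case: (hX i).
  rewrite !rmorphXn -exprVn; elim: (m i) => [|e IH]; first by rewrite expr0.
  by rewrite exprS; apply: laurentM => //; case: (hX i).
move=> y /laurentP[m [p ->]]; rewrite fmorph_div; apply: laurentM; last by case: (hm m).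
elim/mpolyind: p => [|c k p _ _ IH].
  by rewrite !rmorph0 -(rmorph0 toF); apply: laurent_poly.
rewrite !rmorphD; apply: laurentD => //; rewrite -mul_mpolyC !rmorphM.
apply: laurentM; last by case: (hm k).
by have [d] := hC c; rewrite /= => ->; apply: laurent_poly.
Qed.

End PolynomialRing.

(** * Semilinear automorphisms of rational function fields *)

Section Twists.
Variables (M : fieldType) (n : nat).
Local Notation N := (ratfun M n).
Local Notation rM := (fun x : N => exists m, x = ratC M n m).

Lemma ratfun_twist (g : {rmorphism M -> M}) (s : 'I_n -> N) :
    (forall i, algebraic_in (adjoin rM [seq s i | i <- enum 'I_n]) (ratX M i)) ->
  exists h : {rmorphism N -> N},
    (forall m, h (ratC M n m) = ratC M n (g m)) /\ forall i, h (ratX M i) = s i.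
Proof.
move=> aX; pose us := [seq s i | i <- enum 'I_n].
have sus : size us = n by rewrite size_map size_enum_ord.
have sE : (fun i : 'I_n => us`_i) = s.
  by apply: funext => i; rewrite (nth_map i) ?size_enum_ord // nth_ord_enum.
have [|h [hC hX]] := @ratfun_lift M N n (ratC M n \o g : {rmorphism _ -> _}) s.
  rewrite -sE; apply/triangular_indep_mpoly => // i iu ai.
  apply: (ratfun_triangular sus aX iu); apply: algebraic_in_eq ai => y.
  apply: adjoin_sub; first exact: adjoin_subfield.
    by move=> _ [m ->]; apply: adjoin_base; exists (g m).
  by move=> u uu; apply: adjoin_mem.
by exists h.
Qed.

(** These forms cover the generators of [G], their product [tau], [sigma], and the action of [G] on
    the coefficients of [M(T)]. Involutivity and commutation can then be checked on each variable
    separately. *)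
Definition is_twist (g : {rmorphism M -> M}) (h : {rmorphism N -> N}) : Prop :=
  (forall m, h (ratC M n m) = ratC M n (g m)) /\
  forall i, [\/ h (ratX M i) = ratX M i, h (ratX M i) = (ratX M i)^-1
              | h (ratX M i) = - ratX M i].

Lemma twist_exists (g : {rmorphism M -> M}) (s : 'I_n -> N) :
    (forall i, [\/ s i = ratX M i, s i = (ratX M i)^-1 | s i = - ratX M i]) ->
  exists2 h, is_twist g h & forall i, h (ratX M i) = s i.
Proof.
move=> sX; have [|h [hC hX]] := @ratfun_twist g s.
  move=> i; set us := [seq _ | _ <- _]; have sA := adjoin_subfield rM us.
  have si : adjoin rM us (s i) by apply: adjoin_mem; apply: map_f; rewrite mem_enum.
  apply: (algebraic_in_id sA); case: (sX i) => E; rewrite E in si => //.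
    by rewrite -[ratX M i]invrK; apply: (subfieldV sA).
  by rewrite -[ratX M i]opprK; apply: (subfieldN sA).
exists h; last exact: hX.
by split=> [|i]; [exact: hC | rewrite hX; exact: sX].
Qed.

Lemma twist_involutive g h : is_twist g h -> involutive g -> involutive h.
Proof.
move=> [hC hX] gK.
apply: (@ratfun_rmorph_ext _ _ _ (h \o h : {rmorphism _ -> _}) idfun) => [m|i] /=.
  by rewrite !hC gK.
by case: (hX i) => E; rewrite E ?fmorphV ?rmorphN E ?invrK ?opprK.
Qed.

Lemma twist_commute g h g' h' : is_twist g h -> is_twist g' h' ->
  (forall m, g (g' m) = g' (g m)) -> forall f, h (h' f) = h' (h f).
Proof.
move=> [hC hX] [hC' hX'] gg.
apply: (@ratfun_rmorph_ext _ _ _ (h \o h' : {rmorphism _ -> _}) (h' \o h : {rmorphism _ -> _})) => [m|i] /=.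
  by rewrite !hC' !hC hC' gg.
by case: (hX i) => E; case: (hX' i) => E'; rewrite E E' ?fmorphV ?rmorphN ?E ?E' ?invrN.
Qed.

Lemma twist_laurent g h : is_twist g h -> forall y, laurent y -> laurent (h y).
Proof.
move=> [hC hX]; apply: laurent_stable => [c|i]; first by exists (g c).
have xL : laurent (ratX M i) by apply: laurent_poly.
have xVL : laurent (ratX M i)^-1 by apply: laurent_monV.
have NL y : laurent y -> laurent (- y).
  by move=> [m [p E]]; exists m, (- p); rewrite tofracN -E mulrN.
case: (hX i) => ->; rewrite ?invrK ?invrN; split; do ?[exact: xL | exact: xVL];
  by apply: NL; [exact: xL || exact: xVL].
Qed.

Lemma twist_polynomials g h : is_twist g h -> (forall i, h (ratX M i) = ratX M i) ->
  forall y, polynomials y -> polynomials (h y).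
Proof.
move=> [hC _] hX _ [p ->]; exists (map_mpoly g p).
apply: (@mpoly_rmorph_ext _ _ _ (h \o @FracField.tofrac {mpoly M[n]})
  (@FracField.tofrac {mpoly M[n]} \o map_mpoly g)) => [c|i] /=.
  by rewrite hC map_mpolyC.
by rewrite [LHS]hX map_mpolyX.
Qed.

End Twists.

(** * Moebius coordinates *)

Section Moebius.
Variable F : fieldType.
Implicit Types r x s q : F.

(** The points 0 and infinity go to [r] and [- r], the fixed points of [s |-> r ^ 2 / s], so that
    this inversion becomes [x |-> - x]. Exchanging [r] and [- r] amounts to inverting [x]. *)
Definition moebius r x : F := r * (1 + x) / (1 - x).

Lemma moebiusK r x : 2%:R != 0 :> F -> r != 0 -> 1 - x != 0 ->
  (moebius r x - r) / (moebius r x + r) = x.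
Proof.
move=> two0 r0 x1; have -> : moebius r x - r = 2%:R * r * x / (1 - x).
  by rewrite /moebius; field.
have -> : moebius r x + r = 2%:R * r / (1 - x) by rewrite /moebius; field.
by field; rewrite x1 r0 two0.
Qed.

Lemma moebius_opp r x : r != 0 -> 1 - x != 0 -> 1 + x != 0 ->
  moebius r (- x) = r ^+ 2 / moebius r x.
Proof.
by move=> r0 x1 x1'; rewrite /moebius opprK; field; rewrite x1 x1' r0.
Qed.

Lemma moebius_inv r x : x != 0 -> 1 - x != 0 -> moebius (- r) x^-1 = moebius r x.
Proof.
move=> x0 x1; have x1' : x - 1 != 0 by rewrite -oppr_eq0 opprB.
have -> : moebius (- r) x^-1 = - r * ((x + 1) / x) / ((x - 1) / x).
  by rewrite /moebius; congr (_ * _ / _); field.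
rewrite /moebius; have -> : 1 - x = - (x - 1) by ring.
by rewrite invrN; field; rewrite x0 x1'.
Qed.

(** Two functions of [s], defined over the field of [q], that change sign under [s |-> q / s]. For
    [q = r ^ 2] they are [(x + x^-1) / 2] and [(x^-1 - x) / (4 r)] in the Moebius coordinate, so [x]
    and its inverse are combinations of them once [r] is available. *)
Definition odd_part1 q s : F := (s ^+ 2 + q) / (s ^+ 2 - q).
Definition odd_part2 q s : F := s / (s ^+ 2 - q).

Let odd_quotient k p s : k != 0 -> k * p / - (k * s) = - (p / s).
Proof. by move=> k0; rewrite invrN mulrN invfM mulrACA divff // mul1r. Qed.

Lemma odd_part1_inv q s : q != 0 -> s != 0 -> odd_part1 q (q / s) = - odd_part1 q s.
Proof.
move=> q0 s0; rewrite -(odd_quotient _ _ (_ : q / s ^+ 2 != 0)); last first.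
  by rewrite mulf_neq0 // invr_eq0 expf_neq0.
by rewrite /odd_part1; congr (_ / _); field.
Qed.

Lemma odd_part2_inv q s : q != 0 -> s != 0 -> odd_part2 q (q / s) = - odd_part2 q s.
Proof.
move=> q0 s0; rewrite -(odd_quotient _ _ (_ : q / s ^+ 2 != 0)); last first.
  by rewrite mulf_neq0 // invr_eq0 expf_neq0.
by rewrite /odd_part2; congr (_ / _); field.
Qed.

Lemma odd_part1_moebius r x : 2%:R != 0 :> F -> r != 0 -> x != 0 -> 1 - x != 0 ->
  odd_part1 (r ^+ 2) (moebius r x) = (x + x^-1) / 2%:R.
Proof.
move=> two0 r0 x0 x1; rewrite /odd_part1.
have -> : moebius r x ^+ 2 - r ^+ 2 = (2%:R * r / (1 - x)) ^+ 2 * x.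
  by rewrite /moebius; field.
have -> : moebius r x ^+ 2 + r ^+ 2 = 2%:R * (1 + x ^+ 2) * (r / (1 - x)) ^+ 2.
  by rewrite /moebius; field.
have four0 : 4%:R != 0 :> F by rewrite (natrM F 2 2) mulf_neq0.
by field; rewrite x0 two0 four0 r0 x1.
Qed.

Lemma odd_part2_moebius r x : 2%:R != 0 :> F -> r != 0 -> x != 0 -> 1 - x != 0 ->
  odd_part2 (r ^+ 2) (moebius r x) = (x^-1 - x) / (4%:R * r).
Proof.
move=> two0 r0 x0 x1; rewrite /odd_part2.
have four0 : 4%:R != 0 :> F by rewrite (natrM F 2 2) mulf_neq0.
have -> : moebius r x ^+ 2 - r ^+ 2 = 4%:R * (r / (1 - x)) ^+ 2 * x.
  by rewrite /moebius; field.
by rewrite /moebius; field; rewrite x0 four0 r0 x1.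
Qed.

Lemma odd_parts_moebius r x : 2%:R != 0 :> F -> r != 0 -> x != 0 -> 1 - x != 0 ->
  let A := odd_part1 (r ^+ 2) (moebius r x) in
  let B := odd_part2 (r ^+ 2) (moebius r x) in
  x = A - 2%:R * r * B /\ x^-1 = A + 2%:R * r * B.
Proof.
move=> two0 r0 x0 x1 /=; rewrite odd_part1_moebius // odd_part2_moebius //.
have four0 : 4%:R != 0 :> F by rewrite (natrM F 2 2) mulf_neq0.
by split; field; rewrite x0 two0 four0 r0.
Qed.

End Moebius.

Lemma moebius_rmorph (F F' : fieldType) (h : {rmorphism F -> F'}) r x :
  h (moebius r x) = moebius (h r) (h x).
Proof. by rewrite /moebius fmorph_div rmorphM rmorphD rmorphB rmorph1. Qed.

Lemma odd_part1_rmorph (F F' : fieldType) (h : {rmorphism F -> F'}) q s :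
  h (odd_part1 q s) = odd_part1 (h q) (h s).
Proof. by rewrite /odd_part1 fmorph_div rmorphD rmorphB !rmorphXn. Qed.

Lemma odd_part2_rmorph (F F' : fieldType) (h : {rmorphism F -> F'}) q s :
  h (odd_part2 q s) = odd_part2 (h q) (h s).
Proof. by rewrite /odd_part2 fmorph_div rmorphB !rmorphXn. Qed.

Lemma map_mpoly_preimage (K M : fieldType) (j : {rmorphism K -> M}) n (p : {mpoly M[n]}) :
  (forall m, exists k, p@_m = j k) -> exists q, p = map_mpoly j q.
Proof.
elim/mpolyind: p => [|c m p mp c0 IH] cp; first by exists 0; rewrite rmorph0.
have pm : p@_m = 0 by apply: memN_msupp_eq0.
have [|q ->] := IH.
  move=> m'; have [->|nm] := eqVneq m' m; first by exists 0; rewrite pm rmorph0.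
  have [k kE] := cp m'; exists k; rewrite -kE mcoeffD mcoeffZ mcoeffX eq_sym (negPf nm).
  by rewrite mulr0 add0r.
have [k kE] := cp m; exists (k *: 'X_[m] + q).
rewrite rmorphD /= map_mpolyZ map_mpolyX; congr (_ *: _ + _).
by rewrite -kE mcoeffD mcoeffZ mcoeffX eqxx mulr1 pm addr0.
Qed.

(** A transcendence basis may a priori be infinite, whereas polynomial rings in finitely many
    variables are used. The elements that depend on a finite part of [S] form a subfield. *)
Lemma generated_finite (K L : fieldType) (iota : {rmorphism K -> L}) (S : L -> Prop) (fs : seq L) :
    (forall f, f \in fs -> generated_subfield iota S f) ->
  exists T : seq L, [/\ uniq T, forall t, t \in T -> S t
    & forall f, f \in fs -> generated_subfield iota (fun y => y \in T) f].
Proof.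
have mono (T T' : seq L) f : {subset T <= T'} ->
    generated_subfield iota (fun y => y \in T) f -> generated_subfield iota (fun y => y \in T') f.
  by move=> TT' gf E sE KE TE; apply: gf => // s /TT'; apply: TE.
have one f : generated_subfield iota S f -> exists2 T : seq L, (forall t, t \in T -> S t)
    & generated_subfield iota (fun y => y \in T) f.
  move=> gf; apply: (gf (fun f => exists2 T : seq L, (forall t, t \in T -> S t)
    & generated_subfield iota (fun y => y \in T) f)); last first.
  - move=> s Ss; exists [:: s]; first by move=> t; rewrite inE => /eqP ->.
    by move=> E _ _ SE; apply: SE; rewrite inE.
  - by move=> k; exists [::] => // E _ KE _; apply: KE.
  have tw (op : L -> L -> L) : (forall E, is_subfield E -> forall x y, E x -> E y -> E (op x y)) ->
      forall x y, (exists2 T : seq L, (forall t, t \in T -> S t) & generated_subfield iota (fun y => y \in T) x) ->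
      (exists2 T : seq L, (forall t, t \in T -> S t) & generated_subfield iota (fun y => y \in T) y) ->
      (exists2 T : seq L, (forall t, t \in T -> S t) & generated_subfield iota (fun y => y \in T) (op x y)).
    move=> opE x y [T TS gx] [T' TS' gy]; exists (T ++ T').
      by move=> t; rewrite mem_cat => /orP[/TS|/TS'].
    move=> E sE KE TE; apply: opE => //.
      by apply: gx => // s sT; apply: TE; rewrite mem_cat sT.
    by apply: gy => // s sT; apply: TE; rewrite mem_cat sT orbT.
  split; last by apply: tw => E [].
    by exists [::] => // E [].
  by apply: (tw (fun x y => x - y)) => E [].
move=> gfs; suff [T TS gT] : exists2 T : seq L, (forall t, t \in T -> S t)
    & forall f, f \in fs -> generated_subfield iota (fun y => y \in T) f.
  exists (undup T); rewrite undup_uniq; split=> // [t|f /gT].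
    by rewrite mem_undup; apply: TS.
  by apply: mono => t; rewrite mem_undup.
elim: fs gfs => [|f fs IH] gfs; first by exists [::].
have [|T TS gT] := IH; first by move=> h hfs; apply: gfs; rewrite inE hfs orbT.
have [T' TS' gT'] := one f (gfs f (mem_head _ _)).
exists (T ++ T'); first by move=> t; rewrite mem_cat => /orP[/TS|/TS'].
move=> h; rewrite inE => /predU1P[->|/gT]; last by apply: mono => t tT; rewrite mem_cat tT.
by apply: mono gT' => t tT; rewrite mem_cat tT orbT.
Qed.

Lemma ratX_neq0 (M : fieldType) n (i : 'I_n) : ratX M i != 0.
Proof. exact: mon_neq0. Qed.

Lemma ratX_sub1_neq0 (M : fieldType) n (i : 'I_n) (e : bool) :
  1 + (-1) ^+ e * ratX M i != 0.
Proof.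
have -> : 1 + (-1) ^+ e * ratX M i = FracField.tofrac (1 + (-1) ^+ e * 'X_i).
  by rewrite rmorphD rmorphM rmorph1 rmorphXn rmorphN rmorph1.
rewrite tofrac_eq0; apply/eqP => /(congr1 (mcoeff 0%MM)) /eqP.
rewrite mcoeff0 mcoeffD mcoeff1 eqxx; suff -> : ((-1) ^+ e * 'X_i)@_0 = 0 :> M.
  by rewrite addr0 oner_eq0.
have X0 : ('X_i : {mpoly M[n]})@_0 = 0 by rewrite mcoeffX mnm1_eq0.
by case: e; rewrite ?expr1 ?expr0 ?mulN1r ?mul1r ?mcoeffN X0 ?oppr0.
Qed.

Lemma mul_expand (R : comNzRingType) (a b t a' b' t' : R) :
  (a - t * b) * (a' - t' * b') =
  a * a' - t' * (a * b') - t * (b * a') + t * t' * (b * b').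
Proof. by ring. Qed.

Lemma sqr_ratio (F : fieldType) (x y : F) : x != 0 -> y != 0 ->
  x * x = y * y * (x / y) ^+ 2.
Proof. by move=> x0 y0; field. Qed.

Lemma div_eq_mul (F : fieldType) (a b c : F) : a / b = c -> c != 0 -> a = c * b.
Proof.
move=> <-; rewrite mulf_eq0 negb_or invr_eq0 => /andP[_ b0].
by rewrite mulfVK.
Qed.

Section Monomials3.
Variable M : fieldType.
Local Notation X := (@ratX M 3).
Local Notation toF := (@FracField.tofrac {mpoly M[3]}).

Definition i0 : 'I_3 := @Ordinal 3 0 isT.
Definition i1 : 'I_3 := @Ordinal 3 1 isT.
Definition i2 : 'I_3 := @Ordinal 3 2 isT.

Lemma ord3P (i : 'I_3) : [\/ i = i0, i = i1 | i = i2].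
Proof.
by case: i => -[|[|[|]]] // ?; [constructor 1 | constructor 2 | constructor 3]; apply: val_inj.
Qed.

Lemma mon3E (k : 'X_{1..3}) :
  toF 'X_[k] = X i0 ^+ k i0 * X i1 ^+ k i1 * X i2 ^+ k i2.
Proof.
rewrite mpolyXE_id !big_ord_recl big_ord0 mulr1 !tofracM !tofracXn mulrA.
by congr (toF 'X_(_) ^+ k _ * toF 'X_(_) ^+ k _ * toF 'X_(_) ^+ k _); apply: val_inj.
Qed.

Lemma exprz_shift (F : fieldType) (x : F) (i : int) (e : nat) : x != 0 -> 0 <= i + Posz e ->
  x ^ i * x ^+ e = x ^+ absz (i + Posz e).
Proof. by move=> x0 ie; rewrite !exprnP -expfzDr // gez0_abs. Qed.

Lemma mul_shift3 (F : comNzRingType) (m x y z x' y' z' : F) :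
  m * (x * y * z) = 1 -> m * (x * x' * (y * y') * (z * z')) = x' * y' * z'.
Proof.
move=> E; transitivity (m * (x * y * z) * (x' * y' * z')); first by ring.
by rewrite E mul1r.
Qed.

Lemma mon3_indep (m : M) (i j k : int) :
  ratC M 3 m * (X i0 ^ i * X i1 ^ j * X i2 ^ k) = 1 -> [/\ i = 0, j = 0 & k = 0].
Proof.
pose f (t : 'I_3) := if t == i0 then i else if t == i1 then j else k.
(* Multiplying by the [e]-th power of each variable makes all exponents nonnegative, and the
   relation becomes one between two monomials of the polynomial ring. *)
pose e := (absz i + absz j + absz k)%N.
have fe t : 0 <= f t + Posz e by rewrite /f; case: ifP => _; [|case: ifP => _]; rewrite /e; clear; lia.
pose a := [multinom absz (f t + Posz e)%R | t < 3]; pose b := [multinom e | t < 3].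
move/(mul_shift3 (X i0 ^+ e) (X i1 ^+ e) (X i2 ^+ e)).
rewrite -[i]/(f i0) -[j]/(f i1) -[k]/(f i2) !exprz_shift ?ratX_neq0 //.
have -> : X i0 ^+ e * X i1 ^+ e * X i2 ^+ e = toF 'X_[b] by rewrite mon3E !mnmE.
have -> : X i0 ^+ absz (f i0 + Posz e) * X i1 ^+ absz (f i1 + Posz e) * X i2 ^+ absz (f i2 + Posz e)
    = toF 'X_[a] by rewrite mon3E !mnmE.
rewrite -tofracM => /eqP; rewrite tofrac_eq => /eqP /(congr1 (mcoeff b)) /eqP.
rewrite mcoeffCM !mcoeffX eqxx; have [ab _|_] := eqVneq a b; last first.
  by rewrite mulr0 eq_sym oner_eq0.
have f0 t : f t = 0.
  have := congr1 (fun c : 'X_{1..3} => c t) ab; rewrite !mnmE.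
  by move: (fe t); move: (f t) (e) => u w; clear; lia.
by split; [exact: (f0 i0) | exact: (f0 i1) | exact: (f0 i2)].
Qed.

Lemma mon3_ratio (F : fieldType) (x y z : F) (a b c a' b' c' : nat) :
  x != 0 -> y != 0 -> z != 0 ->
  (x ^+ a * y ^+ b * z ^+ c) / (x ^+ a' * y ^+ b' * z ^+ c') =
  x ^ (a%:Z - a'%:Z) * y ^ (b%:Z - b'%:Z) * z ^ (c%:Z - c'%:Z).
Proof.
move=> x0 y0 z0; rewrite !expfzDr // -!exprnN -!exprnP.
by field; rewrite !expf_neq0.
Qed.

Lemma laurent_unit3 (u : ratfun M 3) : unit_in (@laurent M 3) u ->
  exists m (i j k : int), (exists2 m0, m0 != 0 & m = ratC M 3 m0) /\
    u = m * (X i0 ^ i * X i1 ^ j * X i2 ^ k).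
Proof.
move=> /laurent_unit[m [k [k' [m0 ->]]]].
exists (ratC M 3 m), (Posz (k i0) - Posz (k' i0)), (Posz (k i1) - Posz (k' i1)), (Posz (k i2) - Posz (k' i2)); split; first by exists m.
by rewrite !mon3E mon3_ratio ?ratX_neq0.
Qed.

End Monomials3.

(** * Nonrationality *)

Section Nonrationality.
Variables (K M : fieldType) (j : {rmorphism K -> M}) (g : 'I_3 -> {rmorphism M -> M}).
Variables (r : 'I_3 -> M) (q : 'I_3 -> K).
Hypotheses (gK : forall i, involutive (g i))
  (gC : forall i k m, g i (g k m) = g k (g i m)) (gj : forall i k, g i (j k) = j k)
  (fixM : forall m, (forall i, g i m = m) -> exists k, m = j k)
  (two0 : 2%:R != 0 :> M) (r0 : forall i, r i != 0) (rq : forall i, r i ^+ 2 = j (q i))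
  (gr : forall i k, g i (r k) = if i == k then - r k else r k).
Variable sigma : {rmorphism ratfun K 3 -> ratfun K 3}.
Hypotheses (sigmaC : forall k, sigma (ratC K 3 k) = ratC K 3 k)
  (sigmaX : forall i, sigma (ratX K i) = ratC K 3 (q i) / ratX K i).

Local Notation N := (ratfun M 3).
Local Notation X := (@ratX M 3).
Local Notation cM := (ratC M 3).

Let two0N : 2%:R != 0 :> N.
Proof. by rewrite -(rmorph_nat cM) fmorph_eq0. Qed.

Let cr0 i : cM (r i) != 0. Proof. by rewrite fmorph_eq0. Qed.
Let X0 i : X i != 0. Proof. exact: ratX_neq0. Qed.
Let X1 i : 1 - X i != 0.
Proof. by have := ratX_sub1_neq0 M i true; rewrite expr1 mulN1r. Qed.
Let X1' i : 1 + X i != 0.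
Proof. by have := ratX_sub1_neq0 M i false; rewrite expr0 mul1r. Qed.

Let q0 i : q i != 0.
Proof. by rewrite -(fmorph_eq0 j) -rq expf_neq0. Qed.

Lemma kappa_exists : exists kappa : {rmorphism ratfun K 3 -> N},
  (forall k, kappa (ratC K 3 k) = cM (j k)) /\
  (forall i, kappa (ratX K i) = moebius (cM (r i)) (X i)).
Proof.
pose s i := moebius (cM (r i)) (X i); pose us := [seq s i | i <- enum 'I_3].
have sus : size us = 3 by rewrite size_map size_enum_ord.
have sE : (fun i : 'I_3 => us`_i) = s.
  by apply: funext => i; rewrite (nth_map i) ?size_enum_ord // nth_ord_enum.
have ind : triangular_indep (fun x => exists k, x = cM k) us.
  apply: (ratfun_triangular sus) => i; have sA := adjoin_subfield (fun x => exists k, x = cM k) us.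
  apply: (algebraic_in_id sA); rewrite -(moebiusK two0N (cr0 i) (X1 i)).
  have si : adjoin (fun x => exists k, x = cM k) us (moebius (cM (r i)) (X i)).
    by apply: adjoin_mem; apply: (map_f s); rewrite mem_enum.
  have ri : adjoin (fun x => exists k, x = cM k) us (cM (r i)).
    by apply: adjoin_base; exists (r i).
  have [_ As Ad] := sA; apply: Ad; first exact: As.
  exact: (subfieldD sA).
have [|kappa [kC kX]] := @ratfun_lift K N 3 (cM \o j : {rmorphism _ -> _}) s.
  rewrite -sE; apply/triangular_indep_mpoly => // i iu ai; apply: (ind i iu).
  apply: algebraic_in_eq ai => y; apply: adjoin_sub; first exact: adjoin_subfield.
    by move=> _ [m ->]; apply: adjoin_base; exists (j m).
  by move=> u uu; apply: adjoin_mem.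
by exists kappa; split=> [k|i]; [rewrite kC | rewrite kX].
Qed.

Variable kappa : {rmorphism ratfun K 3 -> N}.
Hypotheses (kappaC : forall k, kappa (ratC K 3 k) = cM (j k))
  (kappaX : forall i, kappa (ratX K i) = moebius (cM (r i)) (X i)).

Let h_exists i : exists2 h, is_twist (g i) h &
  forall k, h (X k) = if i == k then (X k)^-1 else X k.
Proof. by apply: twist_exists => k; case: ifP => _; [constructor 2 | constructor 1]. Qed.

(** A Moebius expression is unchanged when its root changes sign and its variable is inverted at the
    same time; so the function field over [K], embedded by [kappa], is fixed by this twisted Galois
    action. *)
Let twist_kappa (g' : {rmorphism M -> M}) (h : {rmorphism N -> N}) : is_twist g' h ->
    (forall k, g' (j k) = j k) ->
    (forall k, (g' (r k) = r k /\ h (X k) = X k) \/ (g' (r k) = - r k /\ h (X k) = (X k)^-1)) ->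
  forall f, h (kappa f) = kappa f.
Proof.
move=> [hC _] g'j hX.
apply: (@ratfun_rmorph_ext _ _ _ (h \o kappa : {rmorphism _ -> _}) kappa) => [k|k] /=.
  by rewrite kappaC hC g'j.
rewrite kappaX moebius_rmorph hC; case: (hX k) => -[-> ->] //.
by rewrite rmorphN (moebius_inv _ (X0 k) (X1 k)).
Qed.

Let twist_kappa1 i (h : {rmorphism N -> N}) : is_twist (g i) h ->
  (forall k, h (X k) = if i == k then (X k)^-1 else X k) -> forall f, h (kappa f) = kappa f.
Proof.
move=> hT hX; apply: (twist_kappa hT) => // k; rewrite gr hX.
by case: ifP; [right | left].
Qed.

Section Theta.
Variable T : seq (ratfun K 3).
Hypothesis indT : forall p : {mpoly K[size T]},
  mmap (ratC K 3) (fun i : 'I_(size T) => T`_i) p = 0 -> p = 0.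
Local Notation n := (size T).
Local Notation s := (fun i : 'I_n => kappa T`_i).

Let mmap_twist i (h : {rmorphism N -> N}) : is_twist (g i) h ->
  (forall k, h (X k) = if i == k then (X k)^-1 else X k) ->
  forall p : {mpoly M[n]}, h (mmap cM s p) = mmap cM s (map_mpoly (g i) p).
Proof.
move=> hT hX; have hk := twist_kappa1 hT hX; case: hT => hC _.
apply: (@mpoly_rmorph_ext _ _ _ (h \o mmap cM s : {rmorphism _ -> _})
  (mmap cM s \o map_mpoly (g i) : {rmorphism _ -> _})) => [c|k] /=.
  by rewrite mmapC map_mpolyC mmapC hC.
by rewrite mmapX map_mpolyX mmapX mmap1U hk.
Qed.

(* Averaging over the Galois group turns a relation over [M] into one over [K]. *)
Lemma theta_indep (p : {mpoly M[n]}) : mmap cM s p = 0 -> p = 0.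
Proof.
move=> p0; apply/eqP/contraT => np0.
have [m mp] : exists m, p@_m != 0.
  apply: contrapT => nm; case/eqP: np0; apply/mpolyP => m; rewrite mcoeff0.
  by apply/eqP/contraT => pm; case: nm; exists m.
(* With one coefficient normalized to 1, the sum over the eight conjugates has the coefficient 8
   there, which is nonzero because 2 is. *)
pose p' := (p@_m)^-1 *: p.
have p'0 : mmap cM s p' = 0 by rewrite mmapZ p0 mulr0.
have p'm : p'@_m = 1 by rewrite mcoeffZ mulVf.
pose tr i (P : {mpoly M[n]}) := P + map_mpoly (g i) P.
have tr0 i P : mmap cM s P = 0 -> mmap cM s (tr i P) = 0.
  move=> P0; have [h hT hX] := h_exists i.
  by rewrite /tr rmorphD /= -(mmap_twist hT hX) P0 rmorph0 addr0.
have trm i P k : P@_m = k%:R -> (tr i P)@_m = (k + k)%:R.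
  move=> Pm; rewrite natrD mcoeffD mcoeff_map_mpoly Pm; congr (_ + _).
  exact: rmorph_nat.
have tr_fix i k P : (i = k \/ (forall m, g i P@_m = P@_m)) -> forall m, g i (tr k P)@_m = (tr k P)@_m.
  move=> [<-|H] m'; rewrite !mcoeffD !mcoeff_map_mpoly rmorphD.
    by rewrite gK addrC.
  by rewrite gC H.
pose P := tr i2 (tr i1 (tr i0 p')).
have P0 : mmap cM s P = 0 by do 3!apply: (tr0).
have Pm : P@_m = 8%:R by rewrite (trm _ _ 4%N) // (trm _ _ 2%N) // (trm _ _ 1%N).
have [|Q PQ] := @map_mpoly_preimage K M j n P.
  move=> m'; apply: fixM => i; case: (ord3P i) => ->; apply: (tr_fix); [right=> ? | right=> ? | by left].
    by apply: (tr_fix); right=> ?; apply: (tr_fix); left.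
  by apply: (tr_fix); left.
have Q0 : Q = 0.
  apply: indT; apply/eqP; rewrite -(fmorph_eq0 kappa); apply/eqP; rewrite -P0 PQ.
  apply: (@mpoly_rmorph_ext _ _ _ (kappa \o mmap (ratC K 3) (fun i : 'I_n => T`_i) : {rmorphism _ -> _})
    (mmap cM s \o map_mpoly j : {rmorphism _ -> _})) => [c|k] /=.
    by rewrite mmapC map_mpolyC mmapC kappaC.
  by rewrite !mmapX map_mpolyX mmapX !mmap1U.
have := Pm; rewrite PQ Q0 rmorph0 mcoeff0 => /eqP; rewrite eq_sym.
by rewrite (natrM M 2 4) (natrM M 2 2) !mulf_eq0 (negPf two0).
Qed.

Lemma theta_exists : exists theta : {rmorphism ratfun M n -> N},
  (forall m, theta (ratC M n m) = cM m) /\ (forall i, theta (ratX M i) = kappa T`_i).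
Proof. by have [theta [tC tX]] := ratfun_lift theta_indep; exists theta. Qed.

End Theta.

Let A i := odd_part1 (ratC K 3 (q i)) (ratX K i).
Let B i := odd_part2 (ratC K 3 (q i)) (ratX K i).

Let sigmaA i : sigma (A i) = - A i.
Proof. by rewrite odd_part1_rmorph sigmaC sigmaX odd_part1_inv ?fmorph_eq0 ?ratX_neq0. Qed.

Let sigmaB i : sigma (B i) = - B i.
Proof. by rewrite odd_part2_rmorph sigmaC sigmaX odd_part2_inv ?fmorph_eq0 ?ratX_neq0. Qed.

Let X_AB i : X i = kappa (A i) - 2%:R * cM (r i) * kappa (B i) /\
  (X i)^-1 = kappa (A i) - - (2%:R * cM (r i)) * kappa (B i).
Proof.
rewrite odd_part1_rmorph odd_part2_rmorph kappaC kappaX -rq rmorphXn mulNr opprK.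
exact: (odd_parts_moebius two0N (cr0 i) (X0 i) (X1 i)).
Qed.

Let odds : seq (ratfun K 3) := [seq A i | i <- enum 'I_3] ++ [seq B i | i <- enum 'I_3].

Let A_odds i : A i \in odds.
Proof. by rewrite mem_cat map_f ?mem_enum. Qed.

Let B_odds i : B i \in odds.
Proof. by rewrite mem_cat orbC map_f ?mem_enum. Qed.

Let odds_mul u w : u \in odds -> w \in odds -> sigma (u * w) = u * w.
Proof.
have so x : x \in odds -> sigma x = - x.
  by rewrite mem_cat => /orP[]/mapP[i _ ->].
by move=> /so su /so sw; rewrite rmorphM su sw mulrNN.
Qed.

(** Each [X i] and its inverse are combinations over [M] of odd elements defined over [K]. The
    product of two of them involves only products of two odd elements, which are [sigma]-invariant;
    this places [X i * X k] and [X i / X k] in [M(T)]. *)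
Let range_products (E : N -> Prop) : is_subfield E -> (forall m, E (cM m)) ->
    (forall u w, u \in odds -> w \in odds -> E (kappa (u * w))) ->
  forall i k, E (X i * X k) /\ E (X i / X k).
Proof.
move=> sE EC Eo i k; have Et l : E (2%:R * cM (r l)) by apply: (subfieldM sE); [exact: subfield_nat | ].
have gen t t' : E t -> E t' ->
    E ((kappa (A i) - t * kappa (B i)) * (kappa (A k) - t' * kappa (B k))).
  move=> tE tE'; rewrite mul_expand -!rmorphM; have [_ Es _] := sE.
  apply: (subfieldD sE); last by apply: (subfieldM sE); [exact: (subfieldM sE) | exact: Eo].
  by apply: (Es); [apply: (Es)|]; [exact: Eo | apply: (subfieldM sE) => //; exact: Eo ..].
have [Xi _] := X_AB i; have [Xk Xk'] := X_AB k.
by split; [rewrite Xi Xk | rewrite Xk' Xi]; apply: gen => //; apply: (subfieldN sE).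
Qed.

Theorem nonrational : ~ purely_transcendental (ratC K 3) (fun f => sigma f = f).
Proof.
move=> [S [indS genS]].
have [|T [uT TS gT]] := @generated_finite _ _ (ratC K 3) S [seq u * w | u <- odds, w <- odds].
  by move=> f /allpairsP[[u w] [/= uo wo ->]]; apply/genS/odds_mul.
have indT (p : {mpoly K[size T]}) : mmap (ratC K 3) (fun i : 'I_(size T) => T`_i) p = 0 -> p = 0.
  apply: indS => [i k /eqP|i]; last by apply/TS/mem_nth.
  by rewrite nth_uniq // => /eqP /val_inj.
have [theta [thetaC thetaX]] := theta_exists indT.
have sR := range_subfield theta.
have RX i k : (exists f, X i * X k = theta f) /\ (exists f, X i / X k = theta f).
  apply: (range_products sR) => [m|u w uo wo]; first by exists (ratC M (size T) m); rewrite thetaC.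
  have gf := gT (u * w) (allpairs_f _ uo wo).
  apply: (gf (fun f => exists y, kappa f = theta y) (preim_subfield kappa sR)).
    by move=> k'; exists (ratC M (size T) (j k')); rewrite kappaC thetaC.
  by move=> t /(nthP 0)[l lT <-]; exists (ratX M (Ordinal lT)); rewrite thetaX.
(* The Galois group is generated by [g i0], [g i1] and [gt], so its norm is a [norm4] times the
   image of that [norm4] under [tau]. *)
pose gt : {rmorphism M -> M} := (g i0 \o (g i1 \o g i2) : {rmorphism _ -> _}).
have gtE m : gt m = g i0 (g i1 (g i2 m)) by [].
have gtK : involutive gt.
  move=> m; rewrite !gtE (gC i2 i0) (gC i1 i0) gK (gC i2 i1) gK gK //.
have gtC i m : g i (gt m) = gt (g i m) by rewrite !gtE !(gC i).
have gtj k : gt (j k) = j k by rewrite gtE !gj.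
have gtr k : gt (r k) = - r k.
  by rewrite gtE; case: (ord3P k) => ->; rewrite !(gr, rmorphN).
have [h0 h0T h0X] := h_exists i0; have [h1 h1T h1X] := h_exists i1.
have [tau tauT tauX] : exists2 h, is_twist gt h & forall k, h (X k) = (X k)^-1.
  by apply: twist_exists => k; constructor 2.
have [sg sgT sgX] : exists2 h, is_twist idfun h & forall k, h (X k) = - X k.
  by apply: twist_exists => k; constructor 3.
have tau_kappa : forall f, tau (kappa f) = kappa f.
  by apply: (twist_kappa tauT gtj) => k; right.
have sg_kappa : forall f, sg (kappa f) = kappa (sigma f).
  apply: (@ratfun_rmorph_ext _ _ _ (sg \o kappa : {rmorphism _ -> _}) (kappa \o sigma : {rmorphism _ -> _})) => [k|k] /=.
    by rewrite sigmaC kappaC (sgT.1).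
  rewrite sigmaX fmorph_div kappaX kappaC moebius_rmorph (sgT.1) sgX.
  by rewrite (moebius_opp (cr0 k) (X1 k) (X1' k)) -rq rmorphXn.
(* On [M(T)] the same Galois elements act on coefficients only and fix the variables, hence preserve
   the polynomial ring; [eqv] says that [theta] matches this action with the twisted one. *)
have wex (g' : {rmorphism M -> M}) : exists2 w, is_twist g' w & forall k, w (@ratX M (size T) k) = ratX M k.
  by apply: twist_exists => k; constructor 1.
have eqv (g' : {rmorphism M -> M}) (h : {rmorphism N -> N}) w : is_twist g' h ->
    is_twist g' w -> (forall k, w (@ratX M (size T) k) = ratX M k) ->
    (forall f, h (kappa f) = kappa f) -> forall f, h (theta f) = theta (w f).
  move=> [hC _] [wC _] wX hk.
  apply: (@ratfun_rmorph_ext _ _ _ (h \o theta : {rmorphism _ -> _}) (theta \o w : {rmorphism _ -> _})) => [m|k] /=.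
    by rewrite thetaC hC wC thetaC.
  by rewrite thetaX wX hk thetaX.
have [w0 w0T w0X] := wex (g i0); have [w1 w1T w1X] := wex (g i1); have [wt wtT wtX] := wex gt.
have e0 := eqv _ _ _ h0T w0T w0X (twist_kappa1 h0T h0X).
have e1 := eqv _ _ _ h1T w1T w1X (twist_kappa1 h1T h1X).
have et := eqv _ _ _ tauT wtT wtX tau_kappa.
have sg_theta f : sg (theta f) = theta f.
  move: f; apply: (@ratfun_rmorph_ext _ _ _ (sg \o theta : {rmorphism _ -> _}) theta) => [m|k] /=.
    by rewrite thetaC (sgT.1).
  rewrite thetaX sg_kappa; congr (kappa _); apply/genS => E sE KE SE; apply: SE.
  exact/TS/mem_nth.
(* The squares of the three coordinates and the ratios of the first to the other two, seen in
   [M(T)]: the data of [norm_decomposition]. *)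
have [fx fxE] := (RX i0 i0).1; have [fq fqE] := (RX i0 i1).2; have [fr frE] := (RX i0 i2).2.
have [fy fyE] := (RX i1 i1).1; have [fz fzE] := (RX i2 i2).1.
have fn0 f i : X i * X i = theta f -> f != 0.
  move=> E; have : theta f != 0 by rewrite -E; apply: mulf_neq0; exact: X0.
  by rewrite fmorph_eq0.
have thI : injective theta by apply: fmorph_inj.
have winv (h : {rmorphism N -> N}) w f i (e : bool) : (forall f, h (theta f) = theta (w f)) ->
    X i * X i = theta f -> h (X i) = (if e then (X i)^-1 else X i) -> w f = if e then f^-1 else f.
  by move=> hw E hX; apply: thI; rewrite -hw -E rmorphM hX; case: (e); rewrite ?fmorphV -?E ?invfM.
have [SP [vP dtP]] := polynomials_divisors M (size T).
have XY : fx = fy * fq ^+ 2.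
  by apply: thI; rewrite rmorphM rmorphXn -fxE -fyE -fqE; apply: sqr_ratio; apply: X0.
have XZ : fx = fz * fr ^+ 2.
  by apply: thI; rewrite rmorphM rmorphXn -fxE -fzE -frE; apply: sqr_ratio; apply: X0.
have [e [p [en0 pn0 up ut]]] := norm_decomposition dtP
  (twist_involutive w0T (gK i0)) (twist_involutive w1T (gK i1)) (twist_involutive wtT gtK)
  (twist_polynomials w0T w0X) (twist_polynomials w1T w1X) (twist_polynomials wtT wtX)
  (fn0 _ _ fxE) (fn0 _ _ fyE) (fn0 _ _ fzE) XY XZ
  (winv _ _ _ _ true e0 fxE (h0X i0)) (winv _ _ _ _ false e1 fxE (h1X i0))
  (winv _ _ _ _ true et fxE (tauX i0)) (winv _ _ _ _ false e0 fyE (h0X i1))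
  (winv _ _ _ _ true e1 fyE (h1X i1)) (winv _ _ _ _ true et fyE (tauX i1))
  (winv _ _ _ _ false e0 fzE (h0X i2)) (winv _ _ _ _ false e1 fzE (h1X i2))
  (winv _ _ _ _ true et fzE (tauX i2)).
have [mu mu0 muE] := polynomials_unit up; have [nu nu0 nuE] := polynomials_unit ut.
have n4E f : theta (norm4 w0 w1 f) = norm4 h0 h1 (theta f).
  by rewrite /norm4 !(rmorphM theta) -e0 -e1 -e0 -e1.
have p2E : theta p ^+ 2 = cM mu * (X i0 ^+ 2 *
    (norm4 h0 h1 (theta e) * tau (norm4 h0 h1 (theta e)))).
  have -> : X i0 ^+ 2 = theta fx by rewrite expr2.
  rewrite -n4E et -(rmorphXn theta) -thetaC -!(rmorphM theta); congr (theta _).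
  by apply: (div_eq_mul muE); move: mu0; rewrite -(fmorph_eq0 (ratC M (size T))).
have tpE : tau (theta p) = cM nu * (theta p / X i0 ^+ 2).
  have -> : X i0 ^+ 2 = theta fx by rewrite expr2.
  rewrite et -(fmorph_div theta) -thetaC -(rmorphM theta); congr (theta _).
  by apply: (div_eq_mul nuE); move: nu0; rewrite -(fmorph_eq0 (ratC M (size T))).
have [SL [vL dtL]] := laurent_divisors M 3.
pose Cst (y : N) := exists2 m, m != 0 & y = cM m.
have CT (g' : {rmorphism M -> M}) h : is_twist g' h -> forall m, Cst m -> Cst (h m).
  by move=> [hC _] _ [m m0 ->]; exists (g' m); rewrite ?fmorph_eq0 // hC.
have CM (m m' : N) : Cst m -> Cst m' -> Cst (m * m').
  by move=> [k k0 ->] [k' k0' ->]; exists (k * k'); rewrite ?mulf_neq0 ?rmorphM.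
have CV (m : N) : Cst m -> Cst m^-1.
  by move=> [k k0 ->]; exists k^-1; rewrite ?invr_eq0 ?fmorphV.
have CN (m : N) : Cst m -> Cst (- m).
  by move=> [k k0 ->]; exists (- k); rewrite ?oppr_eq0 ?rmorphN.
have LC m : laurent (cM m) by apply: laurent_poly.
have CU (m : N) : Cst m -> unit_in (@laurent M 3) m.
  move=> [k k0 ->]; split; first exact: LC.
  by exists (cM k^-1); [exact: LC | rewrite -(rmorphM cM) mulVf // rmorph1].
have XU : unit_in (@laurent M 3) (X i0).
  split; first exact: laurent_poly.
  by exists (X i0)^-1; [exact: laurent_monV | exact: mulVf (X0 i0)].
have C0 (m : N) : Cst m -> m != 0 by move=> [k k0 ->]; rewrite fmorph_eq0.
have Csg (m : N) : Cst m -> sg m = m by move=> [k k0 ->]; rewrite (sgT.1).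
have ind (m : N) (a b c : int) : Cst m -> m * (X i0 ^ a * X i1 ^ b * X i2 ^ c) = 1 ->
    [/\ a = 0, b = 0 & c = 0].
  by move=> [k _ ->]; apply: mon3_indep.
have te0 : theta e != 0 by move: en0; rewrite -(fmorph_eq0 theta).
have tp0 : theta p != 0 by move: pn0; rewrite -(fmorph_eq0 theta).
have idC (g' : {rmorphism M -> M}) m : g' (idfun m) = idfun (g' m) by [].
apply: (monomial_units_contradiction dtL
  (twist_involutive h0T (gK i0)) (twist_involutive h1T (gK i1)) (twist_involutive tauT gtK)
  (twist_involutive sgT (fun=> erefl))
  (twist_laurent h0T) (twist_laurent h1T) (twist_laurent tauT) (twist_laurent sgT)
  (twist_commute h0T tauT (gtC i0)) (twist_commute h1T tauT (gtC i1))
  (twist_commute h0T sgT (idC _)) (twist_commute h1T sgT (idC _)) (twist_commute tauT sgT (idC _))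
  (X0 i0) (X0 i1) (X0 i2) two0N XU CU C0 CN CM CV (CT _ _ h0T) (CT _ _ h1T) (CT _ _ tauT) Csg
  (@laurent_unit3 M) ind
  (h0X i0) (h0X i1) (h0X i2) (h1X i0) (h1X i1) (h1X i2) (tauX i0) (tauX i1) (tauX i2)
  (sgX i0) (sgX i1) (sgX i2) (e := theta e) (p := theta p) (mu := cM mu) (nu := cM nu)).
- exact: te0.
- exact: tp0.
- exact: sg_theta.
- exact: sg_theta.
- by exists mu.
- by exists nu.
- exact: p2E.
- exact: tpE.
Qed.

End Nonrationality.

Lemma adjoin3 (L : fieldType) (E : L -> Prop) (x y z : L) :
  [/\ adjoin E [:: x; y; z] x, adjoin E [:: x; y; z] y & adjoin E [:: x; y; z] z].
Proof. by split; apply: adjoin_mem; rewrite !inE eqxx ?orbT. Qed.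

(** * Rationality of split conic bundles *)

Section QuadraticSubfield.
Variables (L : fieldType) (E : L -> Prop) (z : L).
Hypotheses (sE : is_subfield E) (Ez : E (z ^+ 2)).

Definition quadratic : L -> Prop := fun x => exists u w, [/\ E u, E w & x = u + w * z].

Lemma quadratic_base x : E x -> quadratic x.
Proof. by move=> Ex; exists x, 0; rewrite mul0r addr0; split=> //; apply: subfield0. Qed.

Lemma quadratic_gen : quadratic z.
Proof. by exists 0, 1; rewrite mul1r add0r; split=> //; [exact: subfield0 | case: sE]. Qed.

Lemma quadratic_subfield : is_subfield quadratic.
Proof.
have [E1 Es Ed] := sE; split; first exact: quadratic_base.
  move=> _ _ [u [w [Eu Ew ->]]] [u' [w' [Eu' Ew' ->]]].
  by exists (u - u'), (w - w'); split; [exact: Es | exact: Es | ring].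
move=> _ _ [u [w [Eu Ew ->]]] [u' [w' [Eu' Ew' ->]]].
have [d0|d0] := eqVneq (u' + w' * z) 0.
  by rewrite d0 invr0 mulr0; apply: quadratic_base; apply: subfield0.
(* If the conjugate of the nonzero denominator vanishes, then [z] lies in [E] and so does the
   quotient; otherwise multiplying by the conjugate makes the denominator a norm. *)
have [n0|n0] := eqVneq (u' - w' * z) 0.
  have [w0|w0] := eqVneq w' 0.
    by move: d0 n0; rewrite w0 mul0r addr0 subr0 => /negP d0 /eqP.
  have Ez1 : E z.
    have -> : z = u' / w' by apply: (mulIf w0); rewrite mulfVK // (subr0_eq n0) mulrC.
    exact: Ed.
  apply: quadratic_base; apply: Ed; apply: (subfieldD sE) => //; exact: (subfieldM sE).
pose n := u' ^+ 2 - w' ^+ 2 * z ^+ 2.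
have nE : n = (u' + w' * z) * (u' - w' * z) by rewrite /n; ring.
have nn0 : n != 0 by rewrite nE mulf_neq0.
have En : E n by apply: Es; [exact: (subfieldX _ sE) | apply: (subfieldM sE) => //; exact: (subfieldX _ sE)].
exists ((u * u' - w * w' * z ^+ 2) / n), ((w * u' - u * w') / n); split.
- apply: Ed => //; apply: Es; first exact: (subfieldM sE).
  by apply: (subfieldM sE) => //; apply: (subfieldM sE).
- by apply: Ed => //; apply: Es; apply: (subfieldM sE).
- rewrite nE; field; rewrite d0 n0 //.
Qed.

Lemma quadratic_algebraic x : quadratic x -> algebraic_in E x.
Proof.
move=> [u [w [Eu Ew ->]]]; have sA := algebraic_in_subfield sE.
apply: (subfieldD sA); first exact: algebraic_in_id.
apply: (subfieldM sA); first exact: algebraic_in_id.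
by apply: algebraic_in_sqr => //; apply: algebraic_in_id.
Qed.

Lemma quadratic_fixed (s : {rmorphism L -> L}) x : 2%:R != 0 :> L -> z != 0 ->
  (forall y, E y -> s y = y) -> s z = - z -> quadratic x -> s x = x -> E x.
Proof.
move=> two0 z0 sfix sz [u [w [Eu Ew ->]]]; rewrite rmorphD rmorphM sz !sfix // => /addrI.
rewrite mulrN => /eqP; rewrite eq_sym -addr_eq0 -mulr2n -mulr_natr !mulf_eq0.
by rewrite (negPf z0) (negPf two0) !orbF => /eqP ->; rewrite mul0r addr0.
Qed.

End QuadraticSubfield.

Section ConicIdentities.
Variable F : fieldType.
Variables p t z A B : F.
Hypotheses (two0 : 2%:R != 0 :> F) (p0 : p != 0) (t0 : t != 0) (z0 : z != 0).
Let D := p - A / p.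
Let D' := t - B / t.
Let P := p + A / p.
Let Q := t + B / t.
Hypotheses (D0 : D != 0) (D'0 : D' != 0).
Let m := D' / D.
(** One linear factor of [(P m) ^ 2 - Q ^ 2]. It parametrizes the conic satisfied by [P] and [Q]
    over the field of [m], since the equation determines the other factor. *)
Let n := P * m - Q.
Let w := D / z.
Hypothesis n0 : n != 0.

(* [(P m - Q) (P m + Q) = 4 (A m^2 - B)], since [P^2 - D^2 = 4 A] and
   [Q^2 - D'^2 = 4 B]: the conic bundle splits. *)
Lemma conic_P : P = (n + 4%:R * (A * m ^+ 2 - B) / n) / (2%:R * m).
Proof.
have m0 : m != 0 by rewrite mulf_neq0 ?invr_eq0.
have mD : m * D = D' by rewrite /m mulfVK.
have PD : P ^+ 2 = D ^+ 2 + 4%:R * A by rewrite /P /D; field.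
have QD : Q ^+ 2 = D' ^+ 2 + 4%:R * B by rewrite /Q /D'; field.
have nE : n * (P * m + Q) = 4%:R * (A * m ^+ 2 - B).
  have -> : n * (P * m + Q) = P ^+ 2 * m ^+ 2 - Q ^+ 2 by rewrite /n; ring.
  by rewrite PD QD -mD; ring.
rewrite -nE; have -> : (n + n * (P * m + Q) / n) = 2%:R * m * P.
  by rewrite mulrAC divff // mul1r /n; ring.
by rewrite mulrAC divff ?mul1r // mulf_neq0.
Qed.

Lemma conic_Q : Q = P * m - n. Proof. by rewrite /n; ring. Qed.

Lemma conic_z : z ^+ 2 = (P ^+ 2 - 4%:R * A) / w ^+ 2.
Proof.
have -> : P ^+ 2 - 4%:R * A = D ^+ 2 by rewrite /P /D; field.
by rewrite /w; field; rewrite z0 D0.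
Qed.

Lemma conic_p : p = (P + w * z) / 2%:R.
Proof. by rewrite /w mulfVK // /P /D; field; rewrite two0 p0. Qed.

Lemma conic_t : t = (Q + m * w * z) / 2%:R.
Proof.
have -> : m * w * z = D' by rewrite -mulrA /w mulfVK // /m mulfVK.
by rewrite /Q /D'; field; rewrite two0 t0.
Qed.

Lemma conic_fixed (s : {rmorphism F -> F}) : A != 0 -> B != 0 -> s A = A -> s B = B ->
  s p = A / p -> s t = B / t -> s z = - z -> [/\ s m = m, s n = n & s w = w].
Proof.
move=> A0 B0 sA sB sp st sz.
have sD : s D = - D by rewrite /D rmorphB fmorph_div sA sp invf_div mulrCA divff // mulr1 opprB.
have sD' : s D' = - D' by rewrite /D' rmorphB fmorph_div sB st invf_div mulrCA divff // mulr1 opprB.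
have sP : s P = P by rewrite /P rmorphD fmorph_div sA sp invf_div mulrCA divff // mulr1 addrC.
have sQ : s Q = Q by rewrite /Q rmorphD fmorph_div sB st invf_div mulrCA divff // mulr1 addrC.
have sm : s m = m by rewrite /m fmorph_div sD sD' invrN mulrNN.
by split=> //; [rewrite /n rmorphB rmorphM sm sP sQ | rewrite /w fmorph_div sD sz invrN mulrNN].
Qed.

Lemma conic_generated (E : F -> Prop) : is_subfield E -> E A -> E B -> E m -> E n -> E w ->
  [/\ E (z ^+ 2), quadratic E z p & quadratic E z t].
Proof.
move=> sE EA EB Em En Ew; have [_ Es Ed] := sE.
have E2 := subfield_nat 2 sE; have E4 := subfield_nat 4 sE.
have EP : E P.
  rewrite conic_P; apply: (Ed); last exact: (subfieldM sE).
  apply: (subfieldD sE) => //; apply: (Ed) => //; apply: (subfieldM sE) => //.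
  by apply: (Es) => //; apply: (subfieldM sE) => //; apply: (subfieldX _ sE).
have EQ : E Q by rewrite conic_Q; apply: Es => //; apply: (subfieldM sE).
split.
- rewrite conic_z; apply: Ed; last exact: (subfieldX _ sE).
  by apply: Es; [exact: (subfieldX _ sE) | exact: (subfieldM sE)].
- exists (P / 2%:R), (w / 2%:R); split; [exact: Ed | exact: Ed |].
  by rewrite [LHS]conic_p; field.
- exists (Q / 2%:R), (m * w / 2%:R); split; [exact: Ed | by apply: Ed => //; exact: (subfieldM sE) |].
  by rewrite [LHS]conic_t; field.
Qed.

End ConicIdentities.

Lemma div_neq0 (F : fieldType) (x y : F) : x != 0 -> y != 0 -> x / y != 0.
Proof. by move=> x0 y0; rewrite mulf_neq0 ?invr_eq0. Qed.

Lemma mon3_neq0 (F : fieldType) (x y z : F) a b c : x != 0 -> y != 0 -> z != 0 ->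
  x ^+ a * y ^+ b * z ^+ c != 0.
Proof. by move=> x0 y0 z0; rewrite !mulf_neq0 ?expf_neq0. Qed.

Lemma mon3_div (F : fieldType) (x y z : F) a b : x != 0 -> y != 0 ->
  z = x ^+ a * y ^+ b * z / (x ^+ a * y ^+ b).
Proof. by move=> x0 y0; rewrite mulrAC divff ?mul1r // mulf_neq0 ?expf_neq0. Qed.

Lemma mon2_div (F : fieldType) (x z : F) a : x != 0 -> z = x ^+ a * z / x ^+ a.
Proof. by move=> x0; rewrite mulrAC divff ?mul1r // expf_neq0. Qed.

Lemma div_add1 (F : fieldType) (x k : F) : k != 0 -> x / k + 1 = (x + k) / k.
Proof. by move=> k0; rewrite mulrDl divff. Qed.

Lemma div_sub1 (F : fieldType) (x k : F) : k != 0 -> x / k - 1 = (x - k) / k.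
Proof. by move=> k0; rewrite mulrBl divff. Qed.

Section OddGenerator.
Variable F : fieldType.
Implicit Types x y z k p t A B : F.

Lemma cayley_odd x : x != 0 -> x + 1 != 0 ->
  (x^-1 - 1) / (x^-1 + 1) = - ((x - 1) / (x + 1)).
Proof.
move=> x0 x1; have -> : x^-1 - 1 = - (x - 1) / x by field.
have -> : x^-1 + 1 = (x + 1) / x by field.
by field; rewrite x0 x1.
Qed.

Lemma cayleyK x : 2%:R != 0 :> F -> x + 1 != 0 ->
  x = (1 + (x - 1) / (x + 1)) / (1 - (x - 1) / (x + 1)).
Proof.
move=> two0 x1; have -> : 1 + (x - 1) / (x + 1) = 2%:R * x / (x + 1) by field.
have -> : 1 - (x - 1) / (x + 1) = 2%:R / (x + 1) by field.
by field; rewrite two0 x1.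
Qed.

Lemma div_sub_neq0 x A : x != 0 -> x ^+ 2 - A != 0 -> x - A / x != 0.
Proof.
move=> x0; have -> : x ^+ 2 - A = (x - A / x) * x by field.
by rewrite mulf_eq0 negb_or => /andP[].
Qed.

Lemma conic_n_neq0 p t A B : 2%:R != 0 :> F -> p != 0 -> t != 0 -> p - A / p != 0 ->
  A * t ^+ 2 - B * p ^+ 2 != 0 ->
  (p + A / p) * ((t - B / t) / (p - A / p)) - (t + B / t) != 0.
Proof.
move=> two0 p0 t0 D0 n0; apply: contra_neq n0 => E.
have : ((p + A / p) * ((t - B / t) / (p - A / p)) - (t + B / t)) * (p - A / p)
    = 2%:R * (A * t ^+ 2 - B * p ^+ 2) / (p * t).
  set m := (t - B / t) / (p - A / p).
  have mD : m * (p - A / p) = t - B / t by rewrite mulfVK.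
  transitivity ((p + A / p) * (m * (p - A / p)) - (t + B / t) * (p - A / p)); first by ring.
  by rewrite mD; field; rewrite p0 t0.
rewrite E mul0r => /esym/eqP; rewrite !mulf_eq0 invr_eq0 mulf_eq0 (negPf two0) (negPf p0) (negPf t0) !orbF /=.
by move/eqP.
Qed.

Lemma monomial_inverse (x0 x1 x2 q0 q1 q2 k : F) (e0 e1 e2 : nat) :
  k != 0 -> x0 != 0 -> x1 != 0 -> x2 != 0 -> q0 ^+ e0 * q1 ^+ e1 * q2 ^+ e2 = k ^+ 2 ->
  (q0 / x0) ^+ e0 * (q1 / x1) ^+ e1 * (q2 / x2) ^+ e2 / k =
  (x0 ^+ e0 * x1 ^+ e1 * x2 ^+ e2 / k)^-1.
Proof.
move=> k0 x00 x10 x20 E; rewrite !expr_div_n.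
have X0 := expf_neq0 e0 x00; have X1 := expf_neq0 e1 x10; have X2 := expf_neq0 e2 x20.
transitivity (q0 ^+ e0 * q1 ^+ e1 * q2 ^+ e2 / (x0 ^+ e0 * x1 ^+ e1 * x2 ^+ e2) / k).
  by field; rewrite X0 X1 X2 k0.
by rewrite E; field; rewrite X0 X1 X2 k0.
Qed.

End OddGenerator.

Lemma ratfun_subfield (K : fieldType) n (A : ratfun K n -> Prop) : is_subfield A ->
  (forall k, A (ratC K n k)) -> (forall i, A (ratX K i)) -> forall f, A f.
Proof.
move=> sA KA XA f; have [num [den [_ ->]]] := fraction_numden f.
have PA (P : {mpoly K[n]}) : A (FracField.tofrac P).
  elim/mpolyind: P => [|c k P _ _ IH]; first by rewrite rmorph0; apply: subfield0.
  rewrite tofracD; apply: (subfieldD sA) => //; rewrite -mul_mpolyC tofracM.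
  apply: (subfieldM sA); first exact: KA.
  rewrite mpolyXE_id rmorph_prod; elim/big_ind: _ => [||i _].
  - by case: sA.
  - by move=> x y; apply: (subfieldM sA).
  - by rewrite rmorphXn; exact: (subfieldX _ sA (XA i)).
by have [_ _ Ad] := sA; apply: Ad.
Qed.

Lemma sqr_diff_sum (F : fieldType) (x A : F) : x != 0 ->
  (x - A / x) ^+ 2 = (x + A / x) ^+ 2 - 2%:R * 2%:R * A.
Proof. by move=> x0; field. Qed.

Lemma half_sum (F : fieldType) (x A : F) : 2%:R != 0 :> F ->
  x = (x + A) / 2%:R + 1 / 2%:R * (x - A).
Proof. by move=> two0; field. Qed.

Section Rationality.
Variables (K : fieldType) (sigma : {rmorphism ratfun K 3 -> ratfun K 3}).
Hypotheses (two0 : 2%:R != 0 :> K)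
  (sigmaC : forall k, sigma (ratC K 3 k) = ratC K 3 k).
Local Notation N := (ratfun K 3).
Local Notation cK := (ratC K 3).
Local Notation rK := (fun x : N => exists k, x = cK k).

(** The quotients [m] and [w] of odd elements are invariant, and so is [n]. The field [E] that they
    generate contains [z ^ 2], and [E + E z] contains [p], [t], [z], hence everything; as [sigma]
    negates [z], its fixed field is exactly [E]. Independence of the three generators follows by
    transcendence degree. *)
Lemma rational_of_odd (p t z : N) (a b : K) : a != 0 -> b != 0 ->
    p != 0 -> t != 0 -> z != 0 -> p - cK a / p != 0 -> t - cK b / t != 0 ->
    (p + cK a / p) * ((t - cK b / t) / (p - cK a / p)) - (t + cK b / t) != 0 ->
    sigma p = cK a / p -> sigma t = cK b / t -> sigma z = - z ->
    (forall E, is_subfield E -> (forall k, E (cK k)) -> E p -> E t -> E z -> forall i, E (ratX K i)) ->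
  purely_transcendental cK (fun f => sigma f = f).
Proof.
move=> a0 b0 p0 t0 z0 D0 D'0 n0 sp st sz gen.
have two0N : 2%:R != 0 :> N by rewrite -(rmorph_nat cK) fmorph_eq0.
pose D := p - cK a / p; pose m := (t - cK b / t) / D.
pose n := (p + cK a / p) * m - (t + cK b / t); pose w := D / z.
pose us := [:: m; n; w]; pose E := adjoin rK us; have sE : is_subfield E by apply: adjoin_subfield.
have EK k : E (cK k) by apply: adjoin_base; exists k.
have [Em En Ew] : [/\ E m, E n & E w] by apply: adjoin3.
have [Ez Qp Qt] := conic_generated two0N p0 t0 z0 D0 D'0 n0 sE (EK a) (EK b) Em En Ew.
have sQ := quadratic_subfield sE Ez.
have QX i : quadratic E z (ratX K i).
  apply: (gen _ sQ) => [k||| ]; [exact: quadratic_base | exact: Qp | exact: Qt | exact: quadratic_gen].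
have Qall := ratfun_subfield sQ (fun k => quadratic_base z sE (EK k)) QX.
have ca0 : cK a != 0 by rewrite fmorph_eq0.
have cb0 : cK b != 0 by rewrite fmorph_eq0.
have [sm sn sw] := conic_fixed ca0 cb0 (sigmaC a) (sigmaC b) sp st sz.
have Efix y : E y -> sigma y = y.
  have sF : is_subfield (fun y => sigma y = y).
    split; first exact: rmorph1.
      by move=> x1 x2 e1 e2; rewrite rmorphB e1 e2.
    by move=> x1 x2 e1 e2; rewrite fmorph_div e1 e2.
  apply: (adjoin_sub sF) => [_ [k ->]|u]; first exact: sigmaC.
  by rewrite !inE => /or3P[]/eqP ->.
exists (fun y => y \in us); split.
  apply: triangular_algebraically_independent; apply: ratfun_triangular => // i.
  exact: (quadratic_algebraic sE Ez (QX i)).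
move=> f; rewrite -adjoin_generated; split=> [sf|Ef]; last exact: Efix.
exact: (quadratic_fixed two0N z0 Efix sz (Qall f) sf).
Qed.

Lemma two_monomials_neq0 (m m' : 'X_{1..3}) (c d : K) : c != 0 -> m != m' ->
  cK c * FracField.tofrac 'X_[m] + cK d * FracField.tofrac 'X_[m'] != 0.
Proof.
move=> c0 mm; rewrite -!tofracM -tofracD tofrac_eq0.
apply/eqP => /(congr1 (mcoeff m)) /eqP; rewrite mcoeff0 mcoeffD !mcoeffCM !mcoeffX.
by rewrite eqxx [m' == m]eq_sym (negPf mm) mulr0 addr0 mulr1 (negPf c0).
Qed.

Lemma ratX_sqr i : ratX K i ^+ 2 = FracField.tofrac 'X_[(U_(i) *+ 2)%MM] :> N.
Proof. by rewrite -mpolyXn tofracXn. Qed.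

Lemma ratX_sqr_sub_neq0 i (q : K) : ratX K i ^+ 2 - cK q != 0.
Proof.
have -> : ratX K i ^+ 2 - cK q = cK 1 * FracField.tofrac 'X_[(U_(i) *+ 2)%MM]
    + cK (- q) * FracField.tofrac 'X_[0%MM].
  by rewrite -ratX_sqr mpolyX0 rmorphN (rmorph1 cK) tofrac1 mul1r mulr1.
apply: two_monomials_neq0; first exact: oner_neq0.
by apply/eqP => /(congr1 (fun c : 'X_{1..3} => c i)); rewrite mulmnE mnm1E eqxx mnm0E.
Qed.

Lemma ratX_sqr_comb_neq0 i k (a b : K) : a != 0 -> i != k ->
  cK a * ratX K k ^+ 2 - cK b * ratX K i ^+ 2 != 0.
Proof.
move=> a0 ik; have -> : cK a * ratX K k ^+ 2 - cK b * ratX K i ^+ 2 =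
    cK a * FracField.tofrac 'X_[(U_(k) *+ 2)%MM] + cK (- b) * FracField.tofrac 'X_[(U_(i) *+ 2)%MM].
  by rewrite -!ratX_sqr rmorphN mulNr.
apply: two_monomials_neq0 => //.
apply/eqP => /(congr1 (fun c : 'X_{1..3} => c k)); rewrite !mulmnE !mnm1E eqxx (negPf ik).
by rewrite mul0n.
Qed.

(** The square condition says that [sigma] inverts [Y / k], whose Cayley transform [z] is therefore
    odd. A variable [o] that occurs in the monomial [Y] is recovered from [Y] and the two others,
    and these serve as [p] and [t]. *)
Lemma rational_of_square (q : 'I_3 -> K) (e0 e1 e2 : bool) (k : K) :
    (forall i, q i != 0) -> (forall i, sigma (ratX K i) = cK (q i) / ratX K i) ->
    e0 || e1 || e2 -> k ^+ 2 = q i0 ^+ e0 * q i1 ^+ e1 * q i2 ^+ e2 ->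
  purely_transcendental cK (fun f => sigma f = f).
Proof.
move=> q0 sX ee kE.
have two0N : 2%:R != 0 :> N by rewrite -(rmorph_nat cK) fmorph_eq0.
have k0 : k != 0.
  have : k ^+ 2 != 0 by rewrite kE !mulf_neq0 ?expf_neq0.
  by rewrite expf_eq0.
have ck0 : cK k != 0 by rewrite fmorph_eq0.
have X0 (i : 'I_3) : ratX K i != 0 by apply: ratX_neq0.
pose Y := ratX K i0 ^+ e0 * ratX K i1 ^+ e1 * ratX K i2 ^+ e2.
have Y0 : Y != 0 by exact: (mon3_neq0 _ _ _ (X0 i0) (X0 i1) (X0 i2)).
pose me := [multinom nat_of_bool (if t == i0 then e0 else if t == i1 then e1 else e2) | t < 3].
have YE : Y = FracField.tofrac 'X_[me] by rewrite mon3E !mnmE.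
have me0 : me != 0%MM.
  apply: contraTneq ee => me0; have E t : me t = 0%N by rewrite me0 mnm0E.
  have := E i0; have := E i1; have := E i2; rewrite !mnmE /=.
  by case: (e0); case: (e1); case: (e2).
have Yk c : Y + cK c != 0.
  have -> : Y + cK c = cK 1 * FracField.tofrac 'X_[me] + cK c * FracField.tofrac 'X_[0%MM].
    by rewrite -YE mpolyX0 (rmorph1 cK) tofrac1 mul1r mulr1.
  exact: two_monomials_neq0 (oner_neq0 K) me0.
pose z' := Y / cK k; have z'0 : z' != 0 by exact: div_neq0 Y0 ck0.
have z'1 : z' + 1 != 0.
  by rewrite [z' + 1](div_add1 _ ck0); exact: div_neq0 (Yk k) ck0.
have z'1' : z' - 1 != 0.
  rewrite [z' - 1](div_sub1 _ ck0); apply: div_neq0 ck0.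
  by rewrite -(rmorphN cK); exact: Yk.
have sz' : sigma z' = z'^-1.
  rewrite /z' /Y fmorph_div !rmorphM !rmorphXn !sX sigmaC.
  apply: (monomial_inverse ck0 (X0 i0) (X0 i1) (X0 i2)).
  by rewrite -!(rmorphXn cK) -!(rmorphM cK) -kE.
pose z := (z' - 1) / (z' + 1).
have z0 : z != 0 by exact: div_neq0 z'1' z'1.
have sz : sigma z = - z.
  by rewrite /z fmorph_div rmorphB rmorphD rmorph1 sz'; exact: cayley_odd z'0 z'1.
have Yz (E : N -> Prop) : is_subfield E -> (forall c, E (cK c)) -> E z -> E Y.
  move=> sE EK Ez; rewrite -[Y](mulfVK ck0) -/z'.
  apply: (subfieldM sE); last exact: EK.
  rewrite (cayleyK two0N z'1); have [E1 Es Ed] := sE.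
  exact: (Ed _ _ (subfieldD sE E1 Ez) (Es _ _ E1 Ez)).
have main (i l o : 'I_3) : i != l -> (forall t : 'I_3, [\/ t = i, t = l | t = o]) ->
    (forall E : N -> Prop, is_subfield E -> E (ratX K i) -> E (ratX K l) -> E Y -> E (ratX K o)) ->
    purely_transcendental cK (fun f => sigma f = f).
  move=> il ilo gen.
  have Di t : ratX K t - cK (q t) / ratX K t != 0.
    exact: div_sub_neq0 (X0 t) (ratX_sqr_sub_neq0 t (q t)).
  have genX (E : N -> Prop) : is_subfield E -> (forall c, E (cK c)) ->
      E (ratX K i) -> E (ratX K l) -> E z -> forall t, E (ratX K t).
    move=> sE EK Ei El Ez t; case: (ilo t) => ->; [exact: Ei | exact: El |].
    exact: gen sE Ei El (Yz E sE EK Ez).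
  have n0 := conic_n_neq0 two0N (X0 i) (X0 l) (Di i) (ratX_sqr_comb_neq0 (q l) (q0 i) il).
  exact: (rational_of_odd (q0 i) (q0 l) (X0 i) (X0 l) z0 (Di i) (Di l) n0
    (sX i) (sX l) sz genX).
case: (boolP e2) => [e2T|e2F].
  apply: (main i0 i1 i2 isT) => [t|E sE Ei El EY]; first exact: ord3P.
  have -> : ratX K i2 = Y / (ratX K i0 ^+ e0 * ratX K i1 ^+ e1).
    by rewrite /Y e2T expr1; apply: mon3_div; apply: X0.
  have [_ _ Ed] := sE; apply: (Ed _ _ EY).
  exact: subfieldM sE (subfieldX _ sE Ei) (subfieldX _ sE El).
case: (boolP e1) => [e1T|e1F].
  apply: (main i0 i2 i1 isT) => [t|E sE Ei El EY].
    by case: (ord3P t) => ->; [constructor 1 | constructor 3 | constructor 2].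
  have -> : ratX K i1 = Y / ratX K i0 ^+ e0.
    by rewrite /Y e1T (negPf e2F) expr1 expr0 mulr1; apply: mon2_div; apply: X0.
  have [_ _ Ed] := sE; exact: (Ed _ _ EY (subfieldX _ sE Ei)).
apply: (main i1 i2 i0 isT) => [t|E sE Ei El EY].
  by case: (ord3P t) => ->; [constructor 3 | constructor 1 | constructor 2].
move: ee EY; rewrite (negPf e1F) (negPf e2F) !orbF /Y => ->.
by rewrite (negPf e1F) (negPf e2F) expr1 !expr0 !mulr1.
Qed.

End Rationality.

Lemma fixed_by_cyclic_groupE (T : Type) (s : T -> T) x :
  fixed_by_cyclic_group s x <-> s x = x.
Proof.
split=> [fx|sx tau [n nP]]; first by apply: fx; exists 1%N; left.
have itx : iter n s x = x by elim: n {nP} => //= n ->.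
case: nP => [->//|[_ tK]]; by rewrite -{1}itx tK.
Qed.

Lemma purely_transcendental_ext (K L : fieldType) (iota : {rmorphism K -> L}) (E A : L -> Prop) :
  (forall x, E x <-> A x) -> purely_transcendental iota E <-> purely_transcendental iota A.
Proof.
move=> EA; split=> -[S [indS genS]]; exists S; split=> // x.
  by rewrite -EA.
by rewrite EA.
Qed.

(** * Reduction to a simultaneous inversion of three variables *)

Section Transfer.
Variables (K L1 L2 : fieldType) (iota1 : {rmorphism K -> L1}) (iota2 : {rmorphism K -> L2}).
Variables (h : {rmorphism L1 -> L2}) (E1 : L1 -> Prop) (E2 : L2 -> Prop).
Hypotheses (hC : forall k, h (iota1 k) = iota2 k)
  (hE : forall x, E2 x <-> exists2 y, x = h y & E1 y).

Lemma mmap_transfer n (s : 'I_n -> L1) (p : {mpoly K[n]}) :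
  h (mmap iota1 s p) = mmap iota2 (fun i => h (s i)) p.
Proof.
move: p; apply: (@mpoly_rmorph_ext _ _ _ (h \o mmap iota1 s : {rmorphism _ -> _})
  (mmap iota2 (fun i => h (s i)))) => [c|i] /=.
  by rewrite !mmapC hC.
by rewrite !mmapX !mmap1U.
Qed.

Lemma generated_transfer (S1 : L1 -> Prop) (S2 : L2 -> Prop) y :
    (forall s, S2 s <-> exists2 t, s = h t & S1 t) ->
  generated_subfield iota2 S2 (h y) <-> generated_subfield iota1 S1 y.
Proof.
move=> S12; split=> [gy E sE KE SE|gy E sE KE SE]; last first.
  apply: (gy (fun x => E (h x)) (preim_subfield h sE)) => [k|s Ss]; first by rewrite hC.
  by apply: SE; apply/S12; exists s.
pose A x := exists2 t, x = h t & E t.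
have sA : is_subfield A.
  have [E1' Es Ed] := sE; split; first by exists 1; rewrite ?rmorph1.
    by move=> _ _ [u -> Eu] [w -> Ew]; exists (u - w); [rewrite rmorphB | exact: Es].
  by move=> _ _ [u -> Eu] [w -> Ew]; exists (u / w); [rewrite fmorph_div | exact: Ed].
have [|s /S12[t -> St]|t /fmorph_inj-> //] := gy A sA.
  by move=> k; exists (iota1 k); rewrite ?hC.
by exists t => //; apply: SE.
Qed.

(** The injective [h] carries a basis of [E1] to a basis of [E2]. Conversely a basis of [E2]
    consists of elements of [E2], hence of images, and its preimage is a basis of [E1]. *)
Lemma purely_transcendental_transfer :
  purely_transcendental iota1 E1 <-> purely_transcendental iota2 E2.
Proof.
have hI : injective h by apply: fmorph_inj.
split=> -[S [indS genS]].
  pose S2 x := exists2 t, x = h t & S t.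
  exists S2; split=> [n s s_inj sS p p0|x].
    pose s1 i := s2val (cid2 (sS i)).
    have sE : s = fun i => h (s1 i) by apply: funext => i; apply: s2valP (cid2 (sS i)).
    apply: (indS n s1) => [i k ik|i|]; last 1 first.
    - by apply: hI; rewrite mmap_transfer -sE p0 rmorph0.
    - by apply: s_inj; rewrite sE ik.
    - exact: (s2valP' (cid2 (sS i))).
  rewrite hE; split=> [[y -> /genS gy]|gx].
    by apply/(generated_transfer (S1 := S)).
  have [|k|s [t -> St]|y xE gy] := gx (fun x => exists2 y, x = h y & generated_subfield iota1 S y).
  - split; first by exists 1; [rewrite rmorph1 | move=> E []].
      move=> _ _ [u -> gu] [w -> gw]; exists (u - w); first by rewrite rmorphB.
      by move=> E sE KE SE; have [_ Es _] := sE; apply: Es; [exact: gu | exact: gw].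
    move=> _ _ [u -> gu] [w -> gw]; exists (u / w); first by rewrite fmorph_div.
    by move=> E sE KE SE; have [_ _ Ed] := sE; apply: Ed; [exact: gu | exact: gw].
  - by exists (iota1 k); [rewrite hC | move=> E _ KE _; apply: KE].
  - by exists t => // E _ _ SE; apply: SE.
  - by exists y => //; apply/genS.
pose S1 t := S (h t).
have SE2 s : S s -> E2 s by move=> Ss; apply/genS => E _ _; apply.
have S12 s : S s <-> exists2 t, s = h t & S1 t.
  split=> [Ss|[t -> //]]; have /hE[t tE _] := SE2 s Ss.
  by exists t; rewrite // /S1 -tE.
exists S1; split=> [n s s_inj sS p p0|x].
  apply: (indS n (fun i => h (s i))) => [i k /hI /s_inj //|i|]; first exact: sS.
  by rewrite -mmap_transfer p0 rmorph0.
rewrite -(generated_transfer x S12) -genS hE; split=> [Ex|[y /hI <- //]].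
by exists x.
Qed.

End Transfer.

Section ReductionIdentities.
Variables (F : fieldType) (x1 x2 a : F).
Hypotheses (two0 : 2%:R != 0 :> F) (x10 : x1 != 0) (x20 : x2 != 0)
  (p0 : x1 + x2 != 0) (m0 : x1 - x2 != 0) (a1 : x1 ^+ 2 - a != 0) (a2 : x2 ^+ 2 - a != 0).
Let s := (x1 * x2 + a) / (x1 + x2).
Let t := (x1 * x2 - a) / (x1 - x2).
Let d := (x1 + x2) * (x1 - x2).

Let d0 : d != 0. Proof. by rewrite mulf_neq0. Qed.
Let stB : s - t = - (2%:R * x1 * (x2 ^+ 2 - a)) / d.
Proof. by rewrite /s /t /d; field; rewrite p0 m0. Qed.
Let stD : s + t = 2%:R * x2 * (x1 ^+ 2 - a) / d.
Proof. by rewrite /s /t /d; field; rewrite p0 m0. Qed.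
Let stM : a - s * t = - ((x2 ^+ 2 - a) * (x1 ^+ 2 + a)) / d.
Proof. by rewrite /s /t /d; field; rewrite p0 m0. Qed.

(** In the application [sigma ^ 2] sends [x1] to [a / x1], and this expresses the trace of [x1]
    through [s] and [t]. Together with [reduction_x2] it shows that adjoining [x1], of degree at
    most two, recovers the whole field. *)
Lemma reduction_x1 : x1 + a / x1 = 2%:R * (a - s * t) / (s - t).
Proof. by rewrite stB stM; field; rewrite ?oppr_eq0 ?mulf_neq0 ?x10 ?a2 ?d0. Qed.

Lemma reduction_x2 : x2 = (2%:R * a - (s - t) * x1) / (s + t).
Proof.
rewrite stB stD; have -> : 2%:R * a - - (2%:R * x1 * (x2 ^+ 2 - a)) / d * x1
    = 2%:R * (a * d + x1 ^+ 2 * (x2 ^+ 2 - a)) / d by field.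
have -> : a * d + x1 ^+ 2 * (x2 ^+ 2 - a) = x2 ^+ 2 * (x1 ^+ 2 - a) by rewrite /d; ring.
by field; rewrite ?mulf_neq0 ?x20 ?a1 ?d0 ?two0.
Qed.

Lemma reduction_sigma (h : {rmorphism F -> F}) : a != 0 -> h a = a -> h x1 = a / x2 -> h x2 = x1 ->
  h s = a / s /\ h t = - a / t.
Proof.
move=> a0 ha h1 h2.
rewrite /s /t !fmorph_div rmorphD !rmorphB rmorphD rmorphM ha h1 h2 !invf_div.
have -> : a / x2 * x1 + a = a * (x1 + x2) / x2 by field.
have -> : a / x2 + x1 = (x1 * x2 + a) / x2 by field.
have -> : a / x2 * x1 - a = a * (x1 - x2) / x2 by field.
have -> : a / x2 - x1 = - (x1 * x2 - a) / x2 by field.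
have canc u w : u / x2 / (w / x2) = u / w by rewrite invf_div mulrA mulfVK.
by rewrite !canc invrN mulrN mulNr !mulrA.
Qed.

End ReductionIdentities.

Section Reduction.
Variables (K : fieldType) (a c : K) (sigma : {rmorphism ratfun K 3 -> ratfun K 3}).
Hypotheses (two0 : 2%:R != 0 :> K) (a0 : a != 0) (c0 : c != 0).
Local Notation N := (ratfun K 3).
Local Notation cK := (ratC K 3).
Local Notation X := (@ratX K 3).
Local Notation rK := (fun x : N => exists k, x = cK k).
Hypotheses (sigmaC : forall k, sigma (cK k) = cK k)
  (sigma0 : sigma (X i0) = cK a / X i1) (sigma1 : sigma (X i1) = X i0)
  (sigma2 : sigma (X i2) = cK c / X i2).

Definition reduced_const (i : 'I_3) : K := if i == i0 then a else if i == i1 then - a else c.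

Lemma reduced_const_neq0 i : reduced_const i != 0.
Proof. by rewrite /reduced_const; case: ifP => _ //; case: ifP => _; rewrite ?oppr_eq0. Qed.

Lemma div_divK (F : fieldType) (x y : F) : x != 0 -> x / (x / y) = y.
Proof. by move=> x0; rewrite invf_div mulrCA divff // mulr1. Qed.

Lemma inversion_involutive (F : fieldType) (h : {rmorphism F -> F}) (q x : F) :
  q != 0 -> h q = q -> h x = q / x -> h (h x) = x.
Proof. by move=> q0 hq hx; rewrite hx fmorph_div hq hx div_divK. Qed.

Lemma inversion_anti_involutive (F : fieldType) (h : {rmorphism F -> F}) (q x : F) :
  q != 0 -> h q = q -> h (h x) = q / x -> h (h (x - q / x)) = - (x - q / x).
Proof. by move=> q0 hq hx; rewrite !rmorphB !fmorph_div !hq hx div_divK // opprB. Qed.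

Lemma inversion_exists : exists s1 : {rmorphism N -> N},
  (forall k, s1 (cK k) = cK k) /\ forall i, s1 (X i) = cK (reduced_const i) / X i.
Proof.
apply: (@ratfun_twist K 3 idfun (fun i => cK (reduced_const i) / X i)) => i.
set us := [seq _ | _ <- _]; have sA := adjoin_subfield rK us; apply: (algebraic_in_id sA).
have qi : cK (reduced_const i) != 0 by rewrite fmorph_eq0 reduced_const_neq0.
rewrite -[X i](div_divK _ qi); have [_ _ Ad] := sA; apply: Ad.
  by apply: adjoin_base; exists (reduced_const i).
by apply: adjoin_mem; apply: (map_f (fun i => cK (reduced_const i) / X i)); rewrite mem_enum.
Qed.

(** The element [eps = x1 - a / x1] generates the function field over [E = K(s, t, x3)], and
    [sigma ^ 2] fixes [E] and negates [eps]. An element fixed by [sigma] is fixed by [sigma ^ 2],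
    hence lies in [E], which [h] identifies with a function field on which [sigma] becomes [s1]. *)
Lemma reduction (s1 : {rmorphism N -> N}) : (forall k, s1 (cK k) = cK k) ->
    (forall i, s1 (X i) = cK (reduced_const i) / X i) ->
  purely_transcendental cK (fun f => s1 f = f) <-> purely_transcendental cK (fun f => sigma f = f).
Proof.
move=> s1C s1X.
have two0N : 2%:R != 0 :> N by rewrite -(rmorph_nat cK) fmorph_eq0.
have ca0 : cK a != 0 by rewrite fmorph_eq0.
have X0 (i : 'I_3) : X i != 0 by apply: ratX_neq0.
have comb e : e != 0 -> X i0 + cK e * X i1 != 0.
  move=> e0; have -> : X i0 + cK e * X i1 = cK 1 * FracField.tofrac 'X_[U_(i0)%MM]
      + cK e * FracField.tofrac 'X_[U_(i1)%MM] by rewrite (rmorph1 cK) mul1r.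
  apply: two_monomials_neq0; first exact: oner_neq0.
  by apply/eqP => /(congr1 (fun m : 'X_{1..3} => m i0)); rewrite !mnm1E.
have p0 : X i0 + X i1 != 0.
  by have := comb 1 (oner_neq0 K); rewrite (rmorph1 cK) mul1r.
have m0 : X i0 - X i1 != 0.
  have n10 : -1 != 0 :> K by rewrite oppr_eq0 oner_eq0.
  by have := comb (-1) n10; rewrite rmorphN (rmorph1 cK) mulN1r.
have a1 := ratX_sqr_sub_neq0 i0 a; have a2 := ratX_sqr_sub_neq0 i1 a.
pose s := (X i0 * X i1 + cK a) / (X i0 + X i1).
pose t := (X i0 * X i1 - cK a) / (X i0 - X i1).
have [ss st] := reduction_sigma (X0 i1) ca0 (sigmaC a) sigma0 sigma1.
rewrite -/s -/t in ss st.
pose us := [:: s; t; X i2]; pose E := adjoin rK us; have sE := adjoin_subfield rK us.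
have [Es Et Ex] : [/\ E s, E t & E (X i2)] by apply: adjoin3.
have EK k : E (cK k) by apply: adjoin_base; exists k.
have [_ EB ED] := sE; have E2 := subfield_nat 2 sE.
pose eps := X i0 - cK a / X i0; pose T := X i0 + cK a / X i0.
have ET : E T.
  rewrite /T (reduction_x1 (a := cK a) two0N (X0 i0) p0 m0 a2) -/s -/t.
  apply: (ED); last exact: EB.
  by apply: (subfieldM sE) => //; apply: (EB); [exact: EK | exact: (subfieldM sE)].
have eps2 : eps ^+ 2 = T ^+ 2 - 2%:R * 2%:R * cK a by exact: sqr_diff_sum (X0 i0).
have Eeps : E (eps ^+ 2).
  rewrite eps2; apply: (EB); first exact: (subfieldX _ sE ET).
  by apply: (subfieldM sE); [exact: (subfieldM sE) | exact: EK].
have sQ := quadratic_subfield sE Eeps.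
have Q0 : quadratic E eps (X i0).
  exists (T / 2%:R), (1 / 2%:R); split; [exact: ED | by apply: ED => //; case: sE |].
  exact: half_sum two0N.
have Q1 : quadratic E eps (X i1).
  rewrite [X i1](reduction_x2 (a := cK a) two0N (X0 i1) p0 m0 a1) -/s -/t.
  have [_ QB QD] := sQ; have qb := quadratic_base eps sE.
  apply: (QD); last by apply: qb; exact: (subfieldD sE).
  apply: (QB); first by apply: qb; apply: (subfieldM sE) => //; exact: EK.
  by apply: (subfieldM sQ) => //; apply: qb; exact: EB.
have QX i : quadratic E eps (X i).
  by case: (ord3P i) => ->; [exact: Q0 | exact: Q1 | exact: quadratic_base].
have Qall := ratfun_subfield sQ (fun k => quadratic_base eps sE (EK k)) QX.
have ind : triangular_indep rK us.
  by apply: ratfun_triangular => // i; exact: (quadratic_algebraic sE Eeps (QX i)).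
pose us_ (i : 'I_3) := us`_i.
have [|h [hC hX]] := @ratfun_lift K N 3 cK us_; first by apply/triangular_indep_mpoly.
have hE x : E x -> exists y, x = h y.
  apply: (adjoin_sub (range_subfield h)) => [_ [k ->]|u]; first by exists (cK k); rewrite hC.
  move=> /(nthP 0)[i i3 <-]; exists (X (Ordinal i3)); by rewrite hX.
have hsig f : h (s1 f) = sigma (h f).
  move: f; apply: (@ratfun_rmorph_ext _ _ _ (h \o s1 : {rmorphism _ -> _}) (sigma \o h : {rmorphism _ -> _})) => [k|i] /=.
    by rewrite s1C hC sigmaC.
  rewrite s1X fmorph_div hC !hX; case: (ord3P i) => ->; rewrite /us_ /=.
  - by rewrite ss.
  - by rewrite st -(rmorphN cK).
  - by rewrite sigma2.
apply: (purely_transcendental_transfer (h := h)) => [//|f]; split=> [sf|[y -> s1y]]; last first.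
  by rewrite -hsig s1y.
have ssf : (sigma \o sigma : {rmorphism _ -> _}) f = f by rewrite /= sf.
have na0 : - cK a != 0 by rewrite oppr_eq0; exact: ca0.
have sna : sigma (- cK a) = - cK a by rewrite rmorphN sigmaC.
have cc0 : cK c != 0 by rewrite fmorph_eq0.
have ssE y : E y -> (sigma \o sigma : {rmorphism _ -> _}) y = y.
  have sF : is_subfield (fun y => (sigma \o sigma : {rmorphism _ -> _}) y = y).
    split; first exact: rmorph1.
      by move=> y1 y2 e1 e2; rewrite rmorphB e1 e2.
    by move=> y1 y2 e1 e2; rewrite fmorph_div e1 e2.
  apply: (adjoin_sub sF) => [_ [k ->]|u]; first by rewrite /= !sigmaC.
  move=> /(nthP 0)[[|[|[|]]] //] _ <- /=.
  - exact: (inversion_involutive ca0 (sigmaC a) ss).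
  - exact: (inversion_involutive na0 sna st).
  - exact: (inversion_involutive cc0 (sigmaC c) sigma2).
have seps : (sigma \o sigma : {rmorphism _ -> _}) eps = - eps.
  have s0 : sigma (sigma (X i0)) = cK a / X i0 by rewrite sigma0 fmorph_div sigmaC sigma1.
  exact: (inversion_anti_involutive ca0 (sigmaC a) s0).
have e0 : eps != 0 by exact: div_sub_neq0 (X0 i0) a1.
have Ef := quadratic_fixed two0N e0 ssE seps (Qall f) ssf.
have [y fy] := hE f Ef; exists y => //; apply: (fmorph_inj h).
by rewrite hsig -fy sf.
Qed.

End Reduction.

(** * Multiquadratic extensions *)

Section QuadraticExtension.
Variables (F : fieldType) (d : F).

(** A pair [(u, w)] stands for [u + w * sqrt d]. The type carries [nsq] as a parameter because the
    inverse is correct only when [d] is not a square. *)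
Record quad_ext (nsq : forall x : F, x ^+ 2 != d) := QuadExt { quad_val : F * F }.

Variable nsq : forall x : F, x ^+ 2 != d.
Local Notation Q := (quad_ext nsq).
HB.instance Definition _ := [isNew for @quad_val nsq].
HB.instance Definition _ := [Choice of Q by <:].

Definition quad_mk (u w : F) : Q := QuadExt nsq (u, w).
Local Notation re x := (quad_val x).1.
Local Notation im x := (quad_val x).2.

Lemma quad_eq (x y : Q) : re x = re y -> im x = im y -> x = y.
Proof. by case: x => -[u w]; case: y => -[u' w'] /= -> ->. Qed.

Let add (x y : Q) := quad_mk (re x + re y) (im x + im y).
Let opp (x : Q) := quad_mk (- re x) (- im x).
Let zero := quad_mk 0 0.
Let one := quad_mk 1 0.
Let mul (x y : Q) := quad_mk (re x * re y + d * (im x * im y)) (re x * im y + im x * re y).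
Let nrm (x : Q) := re x ^+ 2 - d * im x ^+ 2.
Let inv (x : Q) := quad_mk (re x / nrm x) (- im x / nrm x).

Let addA : associative add. Proof. by move=> x y z; apply: quad_eq; rewrite /= addrA. Qed.
Let addC : commutative add. Proof. by move=> x y; apply: quad_eq; rewrite /= addrC. Qed.
Let add0 : left_id zero add. Proof. by move=> x; apply: quad_eq; rewrite /= add0r. Qed.
Let addN : left_inverse zero opp add. Proof. by move=> x; apply: quad_eq; rewrite /= addNr. Qed.
HB.instance Definition _ := GRing.isZmodule.Build Q addA addC add0 addN.

Let mulA : associative mul. Proof. by move=> x y z; apply: quad_eq; rewrite /=; ring. Qed.
Let mulC : commutative mul. Proof. by move=> x y; apply: quad_eq; rewrite /=; ring. Qed.
Let mul1 : left_id one mul. Proof. by move=> x; apply: quad_eq; rewrite /=; ring. Qed.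
Let mulDl : left_distributive mul add.
Proof. by move=> x y z; apply: quad_eq; rewrite /=; ring. Qed.
Let one0 : one != zero.
Proof. by apply/eqP => /(congr1 (fun x => re x)) /= /eqP; rewrite oner_eq0. Qed.
HB.instance Definition _ := GRing.Zmodule_isComNzRing.Build Q mulA mulC mul1 mulDl one0.

Let nrm0 (x : Q) : x != zero -> nrm x != 0.
Proof.
apply: contra_neq => n0; have [i0|i0] := eqVneq (im x) 0.
  move: n0; rewrite /nrm i0 expr0n mulr0 subr0 => /eqP; rewrite expf_eq0 /= => /eqP r0.
  exact: quad_eq.
case/eqP: (nsq (re x / im x)); rewrite expr_div_n (subr0_eq n0) mulfK //.
by rewrite expf_neq0.
Qed.

Let mulV (x : Q) : x != zero -> mul (inv x) x = one.
Proof.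
move=> /nrm0 n0; apply: quad_eq => /=.
  transitivity (nrm x / nrm x); last by rewrite divff.
  by rewrite -[X in _ = X / _]/(re x ^+ 2 - d * im x ^+ 2); field.
by field.
Qed.

Let inv0 : inv zero = zero.
Proof. by apply: quad_eq; rewrite /= ?oppr0 mul0r. Qed.
HB.instance Definition _ := GRing.ComNzRing_isField.Build Q mulV inv0.

Definition quad_base (u : F) : Q := quad_mk u 0.
Lemma quad_base_zmod : zmod_morphism quad_base.
Proof. by move=> u w; apply: quad_eq; rewrite /= ?subr0. Qed.

Lemma quad_base_monoid : monoid_morphism quad_base.
Proof. by split=> // u w; apply: quad_eq; rewrite /=; ring. Qed.
HB.instance Definition _ := GRing.isZmodMorphism.Build F Q quad_base quad_base_zmod.
HB.instance Definition _ := GRing.isMonoidMorphism.Build F Q quad_base quad_base_monoid.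

Section Lift.
Variables (g : {rmorphism F -> F}) (e : F).
Hypotheses (gd : g d = d) (e2 : e ^+ 2 = 1).

Definition quad_lift (x : Q) : Q := quad_mk (g (re x)) (e * g (im x)).
Lemma quad_lift_zmod : zmod_morphism quad_lift.
Proof. by move=> x y; apply: quad_eq; rewrite /= rmorphB // mulrBr. Qed.

Lemma quad_lift_monoid : monoid_morphism quad_lift.
Proof.
split=> [|x y]; apply: quad_eq; rewrite /= ?rmorph1 ?rmorph0 ?mulr0 //.
  rewrite rmorphD !rmorphM gd; transitivity (g (re x) * g (re y) + d * (e ^+ 2 * (g (im x) * g (im y)))).
    by rewrite e2 mul1r.
  by ring.
by rewrite rmorphD !rmorphM; ring.
Qed.
HB.instance Definition _ := GRing.isZmodMorphism.Build Q Q quad_lift quad_lift_zmod.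
HB.instance Definition _ := GRing.isMonoidMorphism.Build Q Q quad_lift quad_lift_monoid.

Lemma quad_lift_rmorph : exists h : {rmorphism Q -> Q}, forall x, h x = quad_lift x.
Proof. by exists (quad_lift : {rmorphism Q -> Q}). Qed.

End Lift.

Lemma quadratic_extension : exists (F' : fieldType) (j : {rmorphism F -> F'}) (r : F'),
  [/\ r ^+ 2 = j d, forall x, exists u w, x = j u + j w * r &
   forall (g : {rmorphism F -> F}) (e : F), g d = d -> e ^+ 2 = 1 ->
     exists h : {rmorphism F' -> F'}, forall u w, h (j u + j w * r) = j (g u) + j (e * g w) * r].
Proof.
have mkE u w : quad_mk u w = quad_base u + quad_base w * quad_mk 0 1.
  by apply: quad_eq; rewrite /=; ring.
exists Q, quad_base, (quad_mk 0 1); split.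
- by rewrite expr2; apply: quad_eq; rewrite /=; ring.
- by move=> x; exists (re x), (im x); rewrite -mkE; apply: quad_eq.
move=> g e gd e2; have [h hE] := quad_lift_rmorph gd e2; exists h => u w.
by rewrite -!mkE hE.
Qed.

End QuadraticExtension.

(** The square of [u + w * r] has the cross term [2 u w r], which must vanish because [r] is not in
    [F]; so [b] is [u ^ 2] or [w ^ 2 * d]. *)
Lemma sqr_in_quadratic (F F' : fieldType) (j : {rmorphism F -> F'}) (d b : F) (r x : F') :
    2%:R != 0 :> F -> (forall y : F, y ^+ 2 != d) -> d != 0 -> r ^+ 2 = j d ->
    (exists u w, x = j u + j w * r) -> x ^+ 2 = j b ->
  exists u : F, u ^+ 2 = b \/ u ^+ 2 = b * d.
Proof.
move=> two0 nsq d0 r2 [u [w ->]] E.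
have rN y : r != j y.
  by apply: contra_neq (nsq y) => E'; apply: (fmorph_inj j); rewrite rmorphXn -E' r2.
have E2 : j (u ^+ 2 + d * w ^+ 2 - b) + j (2%:R * u * w) * r = 0.
  rewrite rmorphB rmorphD !rmorphM ?rmorphXn rmorph_nat -r2 -E.
  by ring.
have uw0 : 2%:R * u * w = 0.
  apply/eqP/contraT => c0; have jc0 : j (2%:R * u * w) != 0 by rewrite fmorph_eq0.
  case/eqP: (rN (- (u ^+ 2 + d * w ^+ 2 - b) / (2%:R * u * w))).
  rewrite fmorph_div rmorphN; apply: (mulIf jc0); rewrite mulfVK // mulrC.
  by apply/eqP; rewrite -addr_eq0 addrC E2.
move: E2; rewrite uw0 rmorph0 mul0r addr0 => /eqP; rewrite fmorph_eq0 subr_eq0 => /eqP E2.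
move/eqP: uw0; rewrite !mulf_eq0 (negPf two0) /= => /orP[]/eqP z.
  by exists (d * w); right; rewrite -E2 z; ring.
by exists u; left; rewrite -E2 z; ring.
Qed.

(** The Galois theory of the extension by the square roots of the first [n] values of [q], stated
    through commuting involutions. The last field is the Kummer property: an element of [K] that
    becomes a square is already one up to a product of the [q i]. It is what shows that the next
    constant is still not a square in [F], so that the tower can grow. *)
Record kummer_tower (K F : fieldType) (j : {rmorphism K -> F}) (q : nat -> K) (n : nat)
    (g : nat -> {rmorphism F -> F}) (r : nat -> F) : Prop := KummerTower {
  kt_involutive : forall i, (i < n)%N -> involutive (g i);
  kt_commute : forall i k, (i < n)%N -> (k < n)%N -> forall x, g i (g k x) = g k (g i x);
  kt_base : forall i, (i < n)%N -> forall k, g i (j k) = j k;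
  kt_fixed : forall x, (forall i, (i < n)%N -> g i x = x) -> exists k, x = j k;
  kt_root : forall i, (i < n)%N -> r i ^+ 2 = j (q i);
  kt_sign : forall i k, (i < n)%N -> (k < n)%N -> g i (r k) = if i == k then - r k else r k;
  kt_square : forall x b, x ^+ 2 = j b ->
    exists (u : K) (e : nat -> bool), u ^+ 2 = b * \prod_(i < n) q i ^+ e i }.

Lemma kummer_tower_exists (K : fieldType) (q : nat -> K) (n : nat) :
    2%:R != 0 :> K -> (forall i, q i != 0) ->
    (forall i (e : nat -> bool) u, (i < n)%N -> u ^+ 2 != q i * \prod_(k < i) q k ^+ e k) ->
  exists (F : fieldType) (j : {rmorphism K -> F}) g r, kummer_tower j q n g r.
Proof.
move=> two0 q0; elim: n => [|n IH] nsq.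
  exists K, idfun, (fun=> idfun), (fun=> 0); split=> // [x _|x b E]; first by exists x.
  by exists x, (fun=> false); rewrite big_ord0 mulr1 E.
have [|F [j [g [r kt]]]] := IH; first by move=> i e u ltin; apply: nsq; apply: ltnW.
have nsqF (x : F) : x ^+ 2 != j (q n).
  apply/eqP => /(kt_square kt)[u [e E]]; have := nsq n e u (ltnSn n).
  by rewrite E eqxx.
have [F' [j' [s [s2 rep lift]]]] := quadratic_extension nsqF.
have two0F : 2%:R != 0 :> F by rewrite -(rmorph_nat j) fmorph_eq0.
have two0F' : 2%:R != 0 :> F' by rewrite -(rmorph_nat j') fmorph_eq0.
have s0 : s != 0.
  have : s ^+ 2 != 0 by rewrite s2 !fmorph_eq0.
  by rewrite expf_eq0.
have [g' g'E] : exists g' : nat -> {rmorphism F' -> F'}, forall i, forall u w,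
    g' i (j' u + j' w * s) = if (i < n)%N then j' (g i u) + j' (g i w) * s else j' u - j' w * s.
  suff H i : exists h : {rmorphism F' -> F'}, forall u w, h (j' u + j' w * s) =
      if (i < n)%N then j' (g i u) + j' (g i w) * s else j' u - j' w * s.
    by exists (fun i => sval (cid (H i))) => i; apply: (svalP (cid (H i))).
  case ltin: (i < n)%N.
    have [h hE] := lift (g i) 1 (kt_base kt ltin (q n)) (expr1n _ _).
    by exists h => u w; rewrite hE mul1r.
  have [h hE] := lift idfun (-1) erefl (sqrr_sign _ 1).
  by exists h => u w; rewrite hE /= mulN1r rmorphN mulNr.
have gj' i u : g' i (j' u) = if (i < n)%N then j' (g i u) else j' u.
  by have := g'E i u 0; rewrite !rmorph0 !mul0r !addr0 subr0 => ->.
have gs i : g' i s = if (i < n)%N then s else - s.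
  by have := g'E i 0 1; rewrite !rmorph0 !rmorph1 !add0r !mul1r.
have cases i : (i < n.+1)%N -> (i < n)%N \/ i = n.
  by rewrite ltnS leq_eqVlt => /predU1P[]; auto.
pose r' i := if (i < n)%N then j' (r i) else s.
exists F', (j' \o j : {rmorphism _ -> _}), g', r'; split.
- move=> i /cases[ltin|->] x; have [u [w ->]] := rep x; rewrite !g'E ?ltin ?ltnn.
    by rewrite !g'E ltin !(kt_involutive kt ltin).
  by rewrite -mulNr -rmorphN g'E ltnn rmorphN mulNr opprK.
- move=> i k /cases[ltin|->] /cases[ltkn|->] x; have [u [w ->]] := rep x.
  + by rewrite !(g'E, ltin, ltkn) !(kt_commute kt ltin ltkn).
  + by rewrite !(g'E, ltin, ltnn) -!mulNr -!rmorphN !(g'E, ltin, ltnn) rmorphN.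
  + by rewrite !(g'E, ltkn, ltnn) -!mulNr -!rmorphN !(g'E, ltkn, ltnn) rmorphN.
  + by [].
- by move=> i /cases[ltin|->] k /=; rewrite gj' ?ltnn // ltin (kt_base kt ltin).
- move=> x fx; have [u [w xE]] := rep x.
  have w0 : w = 0.
    have := fx n (ltnSn n); rewrite xE g'E ltnn => /addrI/eqP.
    rewrite eq_sym -addr_eq0 -mulr2n -mulr_natr !mulf_eq0 (negPf s0) (negPf two0F') !orbF.
    by rewrite fmorph_eq0 => /eqP.
  rewrite w0 rmorph0 mul0r addr0 in xE.
  have [|k uE] := kt_fixed kt (x := u).
    move=> i ltin; apply: (fmorph_inj j'); have := fx i (ltnW ltin).
    by rewrite xE gj' ltin.
  by exists k; rewrite xE uE.
- move=> i /cases[ltin|->]; rewrite /r' ?ltnn // ltin.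
  by rewrite -rmorphXn (kt_root kt ltin).
- move=> i k /cases[ltin|->] /cases[ltkn|->]; rewrite /r' ?ltnn ?ltin ?ltkn.
  + by rewrite gj' ltin (kt_sign kt ltin ltkn); case: ifP; rewrite ?rmorphN.
  + by rewrite gs ltin; case: eqP ltin => // ->; rewrite ltnn.
  + by rewrite gj' ltnn; case: eqP ltkn => // <-; rewrite ltnn.
  + by rewrite gs ltnn eqxx.
move=> x b /= xb.
have [|u [uE|uE]] := sqr_in_quadratic two0F nsqF _ s2 (rep x) xb; first by rewrite fmorph_eq0.
  have [v [e vE]] := kt_square kt uE.
  exists v, (fun i => if i == n then false else e i); rewrite big_ord_recr /= eqxx expr0 mulr1 vE.
  by congr (_ * _); apply: eq_bigr => i _; rewrite ltn_eqF.
rewrite -rmorphM in uE; have [v [e vE]] := kt_square kt uE.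
exists v, (fun i => if i == n then true else e i); rewrite big_ord_recr /= eqxx expr1 vE.
rewrite -mulrA [q n * _]mulrC; congr (_ * (_ * _)).
by apply: eq_bigr => i _; rewrite ltn_eqF.
Qed.

(** The argument of [sqr_in_quadratic] for a subfield of a given field, where the extension is not
    constructed but found inside [L]. *)
Lemma sqr_descent (L : fieldType) (E : L -> Prop) (x r : L) : is_subfield E ->
    2%:R != 0 :> L -> E (r ^+ 2) -> ~ E r -> E (x ^+ 2) ->
    (exists u w, [/\ E u, E w & x = u + w * r]) ->
  exists2 u, E u & u ^+ 2 = x ^+ 2 \/ u ^+ 2 = x ^+ 2 * r ^+ 2.
Proof.
move=> sE two0 Er2 nr Ex2 [u [w [Eu Ew xE]]].
have E2 : x ^+ 2 - (u ^+ 2 + w ^+ 2 * r ^+ 2) = 2%:R * u * w * r by rewrite xE; ring.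
have uw0 : 2%:R * u * w = 0.
  apply/eqP/contraT => c0; case: nr; have [_ Es Ed] := sE.
  have -> : r = (x ^+ 2 - (u ^+ 2 + w ^+ 2 * r ^+ 2)) / (2%:R * u * w).
    by rewrite E2 mulrAC divff ?mul1r.
  apply: Ed; last by apply: (subfieldM sE) => //; apply: (subfieldM sE) => //; apply: subfield_nat.
  apply: Es => //; apply: (subfieldD sE); first exact: (subfieldX _ sE).
  by apply: (subfieldM sE) => //; apply: (subfieldX _ sE).
move/eqP: uw0; rewrite !mulf_eq0 (negPf two0) /= => /orP[]/eqP z.
  exists (w * r ^+ 2); first exact: (subfieldM sE).
  by right; rewrite xE z; ring.
by exists u => //; left; rewrite xE z mul0r addr0.
Qed.

(** * The degree of a field generated by three square roots *)

Section TriquadraticDegree.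
Variables (K : fieldType) (L : fieldExtType K).
Hypothesis two0 : 2%:R != 0 :> K.

Let two0L : 2%:R != 0 :> L.
Proof. by rewrite -(rmorph_nat (in_alg L)) fmorph_eq0. Qed.

Lemma aspace_subfield (V : {subfield L}) : is_subfield (fun x : L => x \in V).
Proof.
split; first exact: mem1v.
  by move=> x y; apply: rpredB.
by move=> x y Vx Vy; apply: memvM; rewrite ?memvV.
Qed.

Lemma adjoin_degree_sqrt (V : {subfield L}) (x : L) : x ^+ 2 \in V ->
  adjoin_degree V x = if x \in V then 1%N else 2%N.
Proof.
move=> Vx; have Vp : 'X^2 - (x ^+ 2)%:P \is a polyOver V.
  by rewrite rpredB ?polyOverC // rpredX // polyOverX.
have rp : root ('X^2 - (x ^+ 2)%:P) x by rewrite rootE !hornerE subrr.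
have := dvdp_leq _ (minPoly_dvdp Vp rp); rewrite size_minPoly size_XnsubC // ltnS.
have p0 : 'X^2 - (x ^+ 2)%:P != 0 by rewrite -size_poly_gt0 size_XnsubC.
move/(_ p0); have := adjoin_deg_eq1 V x; have : (0 < adjoin_degree V x)%N by [].
by case: (x \in V); case: (adjoin_degree V x) => [|[|[|]]].
Qed.

Lemma adjoin_sqrt_rep (V : {subfield L}) (x v : L) : x ^+ 2 \in V -> v \in <<V; x>>%VS ->
  exists u w, [/\ u \in V, w \in V & v = u + w * x].
Proof.
move=> Vx vE; pose p := Fadjoin_poly V x v.
have Vp : p \is a polyOver V by apply: Fadjoin_polyOver.
exists p`_0, p`_1; split; [exact: (polyOverP Vp) | exact: (polyOverP Vp) |].
rewrite -{1}(Fadjoin_poly_eq vE) -/p (@horner_coef_wide _ 2).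
  by rewrite !big_ord_recl big_ord0 /= expr0 mulr1 expr1 addr0.
apply: leq_trans (size_Fadjoin_poly _ _ _) _.
by rewrite adjoin_degree_sqrt //; case: ifP.
Qed.

Variables (a d c : K) (alpha iota gamma : L).
Hypotheses (a0 : a != 0) (d0 : d != 0).
Hypotheses (alpha2 : alpha ^+ 2 = a%:A) (iota2 : iota ^+ 2 = d%:A) (gamma2 : gamma ^+ 2 = c%:A).

Let V0 : {subfield L} := 1%AS.
Let V1 : {subfield L} := <<V0; alpha>>%AS.
Let V2 : {subfield L} := <<V1; iota>>%AS.

Let algV (V : {subfield L}) (k : K) : k%:A \in V.
Proof. by rewrite rpredZ // mem1v. Qed.

Let in_V0 x : x \in V0 -> exists k, x = k%:A.
Proof. by move=> /vlineP[k ->]; exists k. Qed.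

Let algI (x y : K) : x%:A = y%:A :> L -> x = y.
Proof. exact: (fmorph_inj (in_alg L)). Qed.

Let alg0 (x : K) : x != 0 -> x%:A != 0 :> L.
Proof. by rewrite -[x%:A]/(in_alg L x) fmorph_eq0. Qed.

Let sqr0 (x : L) k : k != 0 -> x ^+ 2 = k%:A -> x != 0.
Proof. by move=> k0 E; have := alg0 k0; rewrite -E expf_eq0. Qed.

Let dimE : \dim <<1 & [:: alpha; iota; gamma]>> =
  (adjoin_degree V2 gamma * (adjoin_degree V1 iota * adjoin_degree V0 alpha))%N.
Proof.
rewrite !adjoin_cons adjoin_nil agenv_id.
rewrite -[<<<<<<1; alpha>>; iota>>; gamma>>%VS]/(<<V2; gamma>>%VS) dim_Fadjoin.
rewrite -[\dim V2]/(\dim <<V1; iota>>) dim_Fadjoin.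
by rewrite -[\dim V1]/(\dim <<V0; alpha>>) dim_Fadjoin dimv1 muln1.
Qed.

(** The degree is a product of three factors equal to 1 or 2, so it is at most 4 exactly when some
    root lies in the field of the preceding ones. Descending with [sqr_descent] turns this into a
    relation between square classes; conversely a relation can be solved for the last root that
    occurs in it. *)
Lemma triquadratic_dim :
  (\dim <<1 & [:: alpha; iota; gamma]>> <= 4)%N <->
  exists e0 e1 e2 : bool, exists k : K, e0 || e1 || e2 /\ k ^+ 2 = a ^+ e0 * d ^+ e1 * c ^+ e2.
Proof.
have s0 := aspace_subfield V0; have s1 := aspace_subfield V1; have s2 := aspace_subfield V2.
rewrite dimE !adjoin_degree_sqrt ?alpha2 ?iota2 ?gamma2 ?algV //; split.
  have sqV0 (x : L) (b : K) : x \in V0 -> x ^+ 2 = b%:A -> exists k, k ^+ 2 = b.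
    move=> /in_V0[k ->] E; exists k; apply: algI; rewrite -E.
    by rewrite -[LHS]/(in_alg L (k ^+ 2)) rmorphXn.
  have [aV|aV] := boolP (alpha \in V0).
    by have [k kE] := sqV0 _ _ aV alpha2; exists true, false, false, k; rewrite kE !expr0 !mulr1.
  have sqV1 (x : L) (b : K) : x \in V1 -> x ^+ 2 = b%:A -> exists k, k ^+ 2 = b \/ k ^+ 2 = a * b.
    move=> xV xE; have [||||u uV] := sqr_descent (x := x) (r := alpha) s0 two0L.
    - by rewrite alpha2; apply: algV.
    - exact/negP.
    - by rewrite xE; apply: algV.
    - by apply: adjoin_sqrt_rep xV; rewrite alpha2; apply: algV.
    rewrite xE alpha2 => -[E|E]; first by have [k kE] := sqV0 _ _ uV E; exists k; left.
    rewrite -scalerAl mul1r scalerA mulrC in E.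
    by have [k kE] := sqV0 _ _ uV E; exists k; right; rewrite kE.
  have [iV|iV] := boolP (iota \in V1).
    move=> _; have [k [kE|kE]] := sqV1 _ _ iV iota2; first by exists false, true, false, k; rewrite kE !expr0 mulr1 mul1r.
    by exists true, true, false, k; rewrite kE expr0 mulr1.
  have [gV|gV] := boolP (gamma \in V2); last by [].
  have [||||u uV] := sqr_descent (x := gamma) (r := iota) s1 two0L.
  - by rewrite iota2; apply: algV.
  - exact/negP.
  - by rewrite gamma2; apply: algV.
  - by apply: adjoin_sqrt_rep gV; rewrite iota2; apply: algV.
  rewrite gamma2 iota2 => -[E|E] _.
    have [k [kE|kE]] := sqV1 _ _ uV E; first by exists false, false, true, k; rewrite kE !expr0 !mul1r.
    by exists true, false, true, k; rewrite kE expr0 mulr1.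
  rewrite -scalerAl mul1r scalerA in E.
  have [k [kE|kE]] := sqV1 _ _ uV E; first by exists false, true, true, k; rewrite kE expr0 mul1r mulrC.
  by exists true, true, true, k; rewrite kE mulrA mulrAC.
move=> [e0 [e1 [e2 [k [ee kE]]]]].
have E : (alpha ^+ e0 * iota ^+ e1 * gamma ^+ e2) ^+ 2 = (k%:A) ^+ 2.
  rewrite !exprMn -!exprM !(mulnC _ 2) !exprM alpha2 iota2 gamma2.
  have aX (x : K) n : x%:A ^+ n = (x ^+ n)%:A :> L by rewrite -[x%:A]/(in_alg L x) -rmorphXn.
  have aM (x y : K) : x%:A * y%:A = (x * y)%:A :> L by rewrite -[x%:A]/(in_alg L x) -[y%:A]/(in_alg L y) -rmorphM.
  by rewrite !aX !aM -kE.
have {}E : exists k', alpha ^+ e0 * iota ^+ e1 * gamma ^+ e2 = k'%:A.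
  move/eqP: E; rewrite eqf_sqr => /orP[]/eqP->; first by exists k.
  by exists (- k); rewrite scaleNr.
case: E => k' E.
have al0 := sqr0 a0 alpha2; have io0 := sqr0 d0 iota2.
have aV1 : alpha \in V1 by apply: memv_adjoin.
have aV2 : alpha \in V2 by apply: subvP_adjoin.
have iV2 : iota \in V2 by apply: memv_adjoin.
case: e2 ee kE E => [_ _|]; [rewrite expr1 => E|rewrite !expr0 orbF !mulr1].
  suff -> : gamma \in V2 by case: ifP; case: ifP.
  have -> : gamma = k'%:A / (alpha ^+ e0 * iota ^+ e1).
    by rewrite -E mulrAC divff ?mul1r // mulf_neq0 ?expf_neq0.
  have [_ _ Vd] := s2; apply: Vd; first exact: algV.
  by apply: memvM; apply: rpredX.
case: e1 => [_ _|]; [rewrite expr1 => E|rewrite !expr0 orbF !mulr1].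
  suff -> : iota \in V1 by case: ifP; case: ifP.
  have -> : iota = k'%:A / alpha ^+ e0 by rewrite -E mulrAC divff ?mul1r // expf_neq0.
  by have [_ _ Vd] := s1; apply: Vd; [exact: algV | apply: rpredX].
move=> -> _; rewrite expr1 => ->; rewrite algV.
by case: ifP; case: ifP.
Qed.

End TriquadraticDegree.

(** The constants [-1] and [- a] differ by the factor [a], so exchanging them only flips [e0] when
    [e1] holds, at the cost of a factor [a ^ 2] absorbed into the square. *)
Lemma square_class_twist (K : fieldType) (a c : K) : a != 0 ->
  (exists e0 e1 e2 : bool, exists k, e0 || e1 || e2 /\ k ^+ 2 = a ^+ e0 * (-1) ^+ e1 * c ^+ e2) <->
  (exists e0 e1 e2 : bool, exists k, e0 || e1 || e2 /\ k ^+ 2 = a ^+ e0 * (- a) ^+ e1 * c ^+ e2).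
Proof.
move=> a0; split=> -[e0 [[] [e2 [k [ee E]]]]].
- case: e0 ee E => _ E; rewrite ?expr0 ?expr1 in E.
    by exists false, true, e2, k; rewrite E expr0 expr1; split=> //; ring.
  by exists true, true, e2, (a * k); rewrite exprMn E !expr1; split=> //; ring.
- by exists e0, false, e2, k.
- case: e0 ee E => _ E; rewrite ?expr0 ?expr1 in E.
    exists false, true, e2, (k / a); split=> //; rewrite expr_div_n E expr0 expr1.
    by move: (c ^+ e2) => x; field.
  by exists true, true, e2, k; rewrite E !expr1; split=> //; ring.
- by exists e0, false, e2, k.
Qed.

(** * Conclusion *)

Lemma not_rational_of_nonsquare (K : fieldType) (a c : K)
    (s1 : {rmorphism ratfun K 3 -> ratfun K 3}) : 2%:R != 0 :> K -> a != 0 -> c != 0 ->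
    (forall k, s1 (ratC K 3 k) = ratC K 3 k) ->
    (forall i, s1 (ratX K i) = ratC K 3 (reduced_const a c i) / ratX K i) ->
    ~ (exists e0 e1 e2 : bool, exists k,
        e0 || e1 || e2 /\ k ^+ 2 = a ^+ e0 * (- a) ^+ e1 * c ^+ e2) ->
  ~ purely_transcendental (ratC K 3) (fun f => s1 f = f).
Proof.
move=> two0 a0 c0 s1C s1X nsq.
pose qn n := if n == 0%N then a else if n == 1%N then - a else c.
have qn0 n : qn n != 0 by rewrite /qn; case: ifP => // _; case: ifP; rewrite ?oppr_eq0.
have [|M [j [g [r kt]]]] := @kummer_tower_exists K qn 3 two0 qn0.
  move=> [|[|[|]]] // e u _; apply/eqP => E; apply: nsq; rewrite ?big_ord_recl ?big_ord0 /= in E.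
  - by exists true, false, false, u; rewrite E !expr0 !mulr1.
  - by exists (e 0%N), true, false, u; rewrite orbT E /qn /= mulr1 mulr1 mulrC.
  - by exists (e 0%N), (e 1%N), true, u; rewrite orbT E /qn /= mulr1 mulrC.
have qE (i : 'I_3) : qn i = reduced_const a c i by case: (ord3P i) => ->.
have two0M : 2%:R != 0 :> M by rewrite -(rmorph_nat j) fmorph_eq0.
have rq (i : 'I_3) : r i ^+ 2 = j (reduced_const a c i) by rewrite (kt_root kt (ltn_ord i)) qE.
have r0 (i : 'I_3) : r i != 0.
  have : r i ^+ 2 != 0 by rewrite rq fmorph_eq0 reduced_const_neq0.
  by rewrite expf_eq0.
have [kappa [kC kX]] := @kappa_exists K M j (fun i => r (val i)) two0M r0.
apply: (@nonrational K M j (fun i => g (val i)) (fun i => r (val i)) (reduced_const a c)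
  _ _ _ _ two0M r0 rq _ s1 s1C s1X kappa kC kX).
- by move=> i; exact: (kt_involutive kt (ltn_ord i)).
- by move=> i k m; exact: (kt_commute kt (ltn_ord i) (ltn_ord k)).
- by move=> i k; exact: (kt_base kt (ltn_ord i)).
- by move=> m fm; apply: (kt_fixed kt) => i i3; exact: (fm (Ordinal i3)).
- by move=> i k; exact: (kt_sign kt (ltn_ord i) (ltn_ord k)).
Qed.

Theorem theorem3 (K : fieldType) (charK : 2%N \notin [pchar K])
    (a c : K) (a_neq0 : a != 0) (c_neq0 : c != 0)
    (x1 x2 x3 : ratfun K 3)
    (def_x1 : x1 = ratX K (@Ordinal 3 0 isT))
    (def_x2 : x2 = ratX K (@Ordinal 3 1 isT))
    (def_x3 : x3 = ratX K (@Ordinal 3 2 isT))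
    (sigma : {rmorphism ratfun K 3 -> ratfun K 3})
    (sigma_aut : is_automorphism_over (ratC K 3) sigma)
    (sigma_x1 : sigma x1 = ratC K 3 a / x2)
    (sigma_x2 : sigma x2 = x1)
    (sigma_x3 : sigma x3 = ratC K 3 c / x3)
    (L : fieldExtType K) (sqrt_a sqrt_m1 sqrt_c : L)
    (sqrt_aE : sqrt_a ^+ 2 = a%:A)
    (sqrt_m1E : sqrt_m1 ^+ 2 = -1)
    (sqrt_cE : sqrt_c ^+ 2 = c%:A) :
  purely_transcendental (ratC K 3) (fixed_by_cyclic_group sigma)
  <-> (\dim <<1 & [:: sqrt_a; sqrt_m1; sqrt_c]>>%VS <= 4)%N.
Proof.
have two0 : 2%:R != 0 :> K by apply: contraNneq charK => two0; rewrite !inE /= two0 eqxx.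
have [_ sigmaC] := sigma_aut.
rewrite def_x1 def_x2 in sigma_x1 sigma_x2; rewrite def_x3 in sigma_x3.
have m10 : -1 != 0 :> K by rewrite oppr_eq0 oner_eq0.
have m1E : sqrt_m1 ^+ 2 = (-1)%:A by rewrite sqrt_m1E scaleN1r.
have [s1 [s1C s1X]] := inversion_exists a_neq0 c_neq0.
rewrite (purely_transcendental_ext _ (fixed_by_cyclic_groupE sigma)).
rewrite -(reduction two0 a_neq0 c_neq0 sigmaC sigma_x1 sigma_x2 sigma_x3 s1C s1X).
rewrite (triquadratic_dim two0 a_neq0 m10 sqrt_aE m1E sqrt_cE) (square_class_twist _ a_neq0).
split=> [rat|[e0 [e1 [e2 [k [ee kE]]]]]].
  apply: contrapT => nsq.
  exact: (not_rational_of_nonsquare two0 a_neq0 c_neq0 s1C s1X nsq).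
exact: (rational_of_square two0 s1C (@reduced_const_neq0 K a c a_neq0 c_neq0) s1X ee kE).
Qed.
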